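(* Let $\theta\in\mathfrak E^{-1}$ with $\overline\theta=\theta$ and $\theta\notin\mathfrak E^0$. For real $\lambda_w=w(1-w)>\frac14$, if the equation $(-\Delta-\lambda_w)u=\theta$ has a solution $u\in\mathfrak E^1$, then $\mathcal E\theta(w)=0$. More precisely, existence of a solution implies that, for all $\varepsilon>0$, $$\int_{\operatorname{Im}(w)-\varepsilon}^{\operatorname{Im}(w)+\varepsilon}\Big|\mathcal E\theta\Big(\tfrac12+it\Big)\Big|\,dt\;\ll_{w,\varepsilon}\;\varepsilon^{3/2}.$$
   Context: $\mathfrak H$ is the upper half-plane, $z=x+iy$, $\Gamma=SL_2(\mathbb Z)$, $\Gamma_\infty$ is the stabilizer of $i\infty$ in $\Gamma$, $\Delta=y^2(\partial_x^2+\partial_y^2)$, $d\omega=y^{-2}dx\,dy$, $\langle f,g\rangle=\int_{\Gamma\backslash\mathfrak H}f\overline g\,d\omega$ (so $\langle1,1\rangle=\pi/3$), $\lambda_s=s(1-s)$. Real $\lambda_w>\frac14$ means $\operatorname{Re}(w)=\frac12$, $w\ne\frac12$. The Eisenstein series is $E_s(z)=\sum_{\gamma\in\Gamma_\infty\backslash\Gamma}\operatorname{Im}(\gamma z)^s$ for $\operatorname{Re}(s)>1$, meromorphically continued in $s$. $\int_{(1/2)}$ is integration upward along $\operatorname{Re}(s)=\frac12$. $\mathfrak E^\infty_c$ is the space of pseudo-Eisenstein series $\Psi_\varphi(z)=\sum_{\gamma\in\Gamma_\infty\backslash\Gamma}\varphi(\operatorname{Im}(\gamma z))$ with $\varphi\in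 C_c^\infty(0,\infty)$. For $f\in\mathfrak E^\infty_c$ put $\mathcal Ef(s)=\int_{\Gamma\backslash\mathfrak H}f\,E_{1-s}\,d\omega$. For $r\in\mathbb R$, $\mathfrak E^r$ is the completion of $\mathfrak E^\infty_c$ for the norm $|f|_r^2=\frac{|\langle f,1\rangle|^2(1+\lambda_1)^r}{\langle1,1\rangle}+\frac1{4\pi i}\int_{(1/2)}|\mathcal Ef(s)|^2(1+\lambda_s)^r\,ds$. The maps $f\mapsto\langle f,1\rangle$, $f\mapsto\mathcal Ef$ (as an a.e.-defined function on $\operatorname{Re}(s)=\frac12$) and complex conjugation $f\mapsto\overline f$ extend by continuity to $\mathfrak E^r$. The operator $-\Delta$ extends by continuity to $\mathfrak E^r\to\mathfrak E^{r-2}$, with $\mathcal E(-\Delta f)(s)=\lambda_s\,\mathcal Ef(s)$. $\mathfrak E^0$ is a closed subspace of $L^2(\Gamma\backslash\mathfrak H)$, and $\mathfrak E^{-1}$ is the dual of $\mathfrak E^1$. The notation $\ll_{w,\varepsilon}$ means that the implied constant may depend on $w$ and $\varepsilon$; the vanishing $\mathcal E\theta(w)=0$ is understood in the sense of the displayed estimate. *)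

(* Defs.v *)
From HB Require Import structures.
From mathcomp Require Export all_boot all_order all_algebra.
From mathcomp Require Export all_classical all_reals all_analysis.
From mathcomp.analysis.showcase Require Export summability.
Export Order.TTheory GRing.Theory Num.Theory.
Export numFieldNormedType.Exports.
From mathcomp.real_closed Require Export complex.
Export Normc.
Set Implicit Arguments.
Unset Strict Implicit.
Unset Printing Implicit Defensive.

Local Open Scope classical_set_scope.
Local Open Scope complex_scope.
Local Open Scope ring_scope.

Section Defs.
Variable R : realType.
Local Notation C := (R[i]).

(* [y ^ s] for [0 < y] and [s] complex. *)
Definition cpow (y : R) (s : C) : C :=
  (y `^ Re s * cos (Im s * ln y)) +i* (y `^ Re s * sin (Im s * ln y)).

Definition lambda (s : C) : C := s * (1 - s).

(* Points [z = x + iy] of the plane are pairs [(x, y) : R * R]; functions on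
   the upper half-plane are total functions on [R * R]. *)
Definition toC (p : R * R) : C := p.1 +i* p.2.

Definition uhp : set (R * R) := [set p | 0 < p.2].

Definition Gamma : set 'M[int]_2 := [set g | \det g = 1].

(* [g] sends the cusp to [g 0 0 / g 1 0]. *)
Definition Gamma_inf : set 'M[int]_2 := Gamma `&` [set g | g 1 0 = 0].

Definition cosets : set (set 'M[int]_2) :=
  [set A | exists2 g, Gamma g & A = [set h *m g | h in Gamma_inf]].

Definition coset_repr (A : cosets) : 'M[int]_2 := xget 1%:M (val A).

Definition moebius (g : 'M[int]_2) (z : C) : C :=
  ((g 0 0)%:~R * z + (g 0 1)%:~R) / ((g 1 0)%:~R * z + (g 1 1)%:~R).

(* The sum over [Gamma_inf \ Gamma] of [h (Im (gamma z))], as an unordered sum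
   (limit along the finite sets of cosets); [Im (gamma z)] does not depend on
   the representative. *)
Definition coset_sum (h : R -> C) (p : R * R) : C :=
  let t (A : cosets) := h (Im (moebius (coset_repr A) (toC p))) in
  sum (fun A => Re (t A) : R^o) +i* sum (fun A => Im (t A) : R^o).

Definition continuous_uhp (f : R * R -> C) :=
  forall p, uhp p ->
    {for p, continuous (fun q => Re (f q))} /\
    {for p, continuous (fun q => Im (f q))}.

(* [s |-> E s] is meromorphic on the whole complex plane as a function with
   values in the space of continuous functions on the upper half-plane, with
   the topology of locally uniform convergence: near each [s0] it has a Laurent
   expansion [(s - s0) ^- m * \sum_k a_k (s - s0) ^+ k].  Either [m = 0] and
   the expansion also holds at [s0], or [s0] is a pole of order [m], at which
   the value of [E] is unconstrained. *)
Definition meromorphic (E : C -> R * R -> C) :=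
  forall s0 : C, exists (m : nat) (rho : R) (a : nat -> R * R -> C),
    [/\ 0 < rho,
        forall k, continuous_uhp (a k),
        m = 0%N \/ exists2 p, uhp p & a 0%N p != 0 &
        forall s, normc (s - s0) < rho -> s != s0 \/ m = 0%N ->
        forall K : set (R * R), compact K -> K `<=` uhp ->
        forall e : R, 0 < e -> exists N : nat, forall n, (N <= n)%N ->
        forall p, K p ->
          normc (\sum_(k < n) a k p * (s - s0) ^+ k - (s - s0) ^+ m * E s p)
            < e].

(* [E] is the meromorphic continuation of the Eisenstein series; this
   determines [E s p] on the upper half-plane for every [s] that is not a
   pole. *)
Definition eisenstein (E : C -> R * R -> C) :=
  (forall s p, 1 < Re s -> uhp p -> E s p = coset_sum (cpow ^~ s) p) /\
  meromorphic E.

Definition smooth (g : R -> R) :=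
  forall (n : nat) (x : R), derivable (derive1n n g) x 1.

Definition test_function (phi : R -> C) :=
  [/\ smooth (fun y => Re (phi y)), smooth (fun y => Im (phi y)) &
      exists a b : R, 0 < a /\ forall y, y < a \/ b < y -> phi y = 0].

(* For [p.2 <= 0] all terms of the sum vanish. *)
Definition pseudo_eisenstein : set (R * R -> C) :=
  [set f | exists2 phi, test_function phi & f = coset_sum phi].

Definition laplace (g : R * R -> R) (p : R * R) : R :=
  p.2 ^+ 2 * (derive1n 2 (fun x => g (x, p.2)) p.1
              + derive1n 2 (fun y => g (p.1, y)) p.2).

Definition Laplace (f : R * R -> C) (p : R * R) : C :=
  laplace (fun q => Re (f q)) p +i* laplace (fun q => Im (f q)) p.

Definition fundamental_domain : set (R * R) :=
  [set p | [/\ `|p.1| <= 2^-1, 1 <= p.1 ^+ 2 + p.2 ^+ 2 & 0 < p.2]].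

(* The integral over [Gamma \ H] for the measure [y^-2 dx dy], computed on the
   standard fundamental domain. *)
Definition hyp_Rintegral (g : R * R -> R) : R :=
  \int[(@lebesgue_measure R \x @lebesgue_measure R)%E]_(p in fundamental_domain)
     (g p / p.2 ^+ 2).

Definition hyp_integral (f : R * R -> C) : C :=
  hyp_Rintegral (fun p => Re (f p)) +i* hyp_Rintegral (fun p => Im (f p)).

Definition inner (f g : R * R -> C) : C :=
  hyp_integral (fun p => f p * (g p)^*).

Definition one : R * R -> C := fun=> 1.

Variable E : C -> R * R -> C.

Definition transform (f : R * R -> C) (s : C) : C :=
  hyp_integral (fun p => f p * E (1 - s) p).

Definition critical (t : R) : C := 2^-1 +i* t.

(* [lambda (critical t)] is real. *)
Definition weight (r t : R) : R := (1 + Re (lambda (critical t))) `^ r.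

(* On the critical line [ds = i dt], whence the factor [1 / (4 pi)]. *)
Definition norm_sq (r : R) (f : R * R -> C) : \bar R :=
  ((normc (inner f one) ^+ 2 * (1 + Re (lambda 1)) `^ r
     / Re (inner one one))%:E
   + ((4 * pi)^-1)%:E
     * \int[@lebesgue_measure R]_t
         (normc (transform f (critical t)) ^+ 2 * weight r t)%:E)%E.

(* The completion of the pseudo-Eisenstein series for the norm of index [r]:
   its elements are represented by Cauchy sequences, two of which are
   identified by [completion_eq]. The map [E^r -> E^r'] for [r' <= r] sends
   the class of a sequence to the class of the same sequence. Finiteness of
   the norms is automatic for pseudo-Eisenstein series; it is recorded because
   [norm_sq] takes extended real values. *)
Definition completion (r : R) : set (nat -> R * R -> C) :=
  [set u | [/\ forall n, pseudo_eisenstein (u n),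
               forall n, (norm_sq r (u n) < +oo)%E &
               forall e : R, 0 < e -> exists N : nat, forall m n,
                 (N <= m)%N -> (N <= n)%N ->
                 (norm_sq r (fun p => u m p - u n p)%R < e%:E)%E]].

Definition completion_eq (r : R) (u v : nat -> R * R -> C) :=
  (fun n => norm_sq r (fun p => u n p - v n p)) @ \oo --> 0%E.

(* Extensions by continuity: apply the operator along a representative. *)

Definition conj_ext (u : nat -> R * R -> C) : nat -> R * R -> C :=
  fun n p => (u n p)^*.

Definition shifted_laplacian (w : C) (u : nat -> R * R -> C) :
    nat -> R * R -> C :=
  fun n p => - Laplace (u n) p - lambda w * u n p.

(* [F] is a version of the almost everywhere defined function
   [t |-> (transform theta) (1/2 + it)], the limit of the transforms of the
   [theta n] in the weighted L^2 space; it exists by completeness of L^2. *)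
Definition is_transform (r : R) (theta : nat -> R * R -> C) (F : R -> C) :=
  [/\ measurable_fun setT (fun t => Re (F t)),
      measurable_fun setT (fun t => Im (F t)) &
      (fun n => \int[@lebesgue_measure R]_t
         (normc (F t - transform (theta n) (critical t)) ^+ 2
            * weight r t)%:E)%E @ \oo --> 0%E].

End Defs.

(* Main.v *)
(* For a pseudo-Eisenstein series f, Green's formula on the fundamental domain gives
   int (Delta f + lambda_s f) E_s = 0 for real s near 5, where E_s is the convergent
   series. The left side is meromorphic in s, so it vanishes identically, and on the
   critical line E((-Delta - lambda_w) f) = (lambda_s - lambda_w) E f off a countable
   set. Write tau = Im w and s = 1/2 + it, so that lambda_s - lambda_w = t^2 - tau^2.
   If u solves the equation, choose representatives u_n and theta_n with n so large
   that their errors are negligible at scale eps; then near tau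
     |E theta| <= |errors| + |t^2 - tau^2| |E u_n|,
   and the last factor is bounded in L^2 while the first is O(eps), so that
   Cauchy-Schwarz on an interval of length 2 eps yields eps * eps^(1/2). *)
Require Import Defs.
From mathcomp Require Import finmap measurable_realfun.
From mathcomp Require Import ring lra zify.
Set Implicit Arguments.
Unset Strict Implicit.
Unset Printing Implicit Defensive.
Local Open Scope classical_set_scope.
Local Open Scope complex_scope.
Local Open Scope ring_scope.

(** * Calculus on the upper half-plane *)

(** Off the half-plane of convergence the hypotheses give E_s only as a continuous function of z:
    neither differentiability in z nor automorphy is available, so Green's formula cannot be applied
    to E_s on the critical line. What can be continued in s is the weak identity, in which no
    derivative falls on E_s. For real s it is obtained with each term Im(gamma z)^s separately, an
    explicit eigenfunction. The boundary integrals of one term do not vanish; they cancel in the sum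
    over the cosets, which right multiplication by the matrices of z + 1 and -1/z permutes.
    Exchanging sum and integral needs a summable majorant, and the one used here works for s >= 2,
    so the base point 5 lies safely inside. A pseudo-Eisenstein series vanishes above some height.
    Its integrals over the fundamental domain therefore live on a compact region, and locally
    uniform convergence of the Laurent expansions is enough to integrate them. Since E_s is
    unconstrained at its poles, every identity on the critical line is claimed only off a countable
    set, which is negligible for the final estimate. *)

Section measurable_plane.
Variable R : realType.
Implicit Types (A K U : set (R * R)) (f g : R * R -> R).

(** The product sigma-algebra is generated by rectangles, so an open set has to be exhibited as a
    countable union: the rational boxes contained in [A], with [F] empty for every other
    quadruple. *)
Lemma open_measurable_plane A : open A -> measurable A.
Proof.
move=> oA.
pose box (a b c d : rat) : set (R * R) :=
  `]ratr a, ratr b[%classic `*` `]ratr c, ratr d[%classic.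
pose F a b c d := if `[< box a b c d `<=` A >] then box a b c d else set0.
have -> : A = \bigcup_a \bigcup_b \bigcup_c \bigcup_d F a b c d.
  apply/seteqP; split=> [[x y] Axy|p [a _ [b _ [c _ [d _]]]]]; last first.
    by rewrite /F; case: asboolP => // sub /sub.
  have /nbhs_ballP[e /= e0 be] : nbhs (x, y) A by exact: open_nbhs_nbhs.
  have ex (z : R) : exists q : rat, z - e < ratr q < z.
    have /rat_in_itvoo[q] : z - e < z by rewrite ltrBlDr ltrDl.
    by rewrite in_itv/=; exists q.
  have ex' (z : R) : exists q : rat, z < ratr q < z + e.
    have /rat_in_itvoo[q] : z < z + e by rewrite ltrDl.
    by rewrite in_itv/=; exists q.
  have [a /andP[a1 a2]] := ex x; have [b /andP[b1 b2]] := ex' x.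
  have [c /andP[c1 c2]] := ex y; have [d /andP[d1 d2]] := ex' y.
  exists a => //; exists b => //; exists c => //; exists d => //.
  rewrite /F; case: asboolP => [_|[]].
    by split; rewrite /= in_itv/=; apply/andP.
  move=> [u v] [/=]; rewrite !in_itv/= => /andP[u1 u2] /andP[v1 v2].
  apply: be; split; rewrite /ball/= ltr_norml; apply/andP; split.
  - by rewrite ltrBDr addrC -ltrBrDr opprK; lra.
  - lra.
  - lra.
  - lra.
do 4 (apply: bigcupT_measurable_rat => ?).
rewrite /F; case: asboolP => // _.
by apply: measurableX; exact: measurable_itv.
Qed.

Lemma closed_measurable_plane A : closed A -> measurable A.
Proof. by move/closed_openC/open_measurable_plane/measurableC; rewrite setCK. Qed.

Lemma compact_measurable_plane A : compact A -> measurable A.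
Proof. by move=> cA; apply: closed_measurable_plane; apply: compact_closed. Qed.

Lemma continuous_measurable_plane U K f : open U -> measurable K -> K `<=` U ->
  (forall p, U p -> {for p, continuous f}) -> measurable_fun K f.
Proof.
move=> oU mK KU cf; apply: (measurable_funS _ KU); first exact: open_measurable_plane.
apply: (measurability _ (measurable_realfun.RGenOpens.measurableE R)).
move=> _ [_ [a [b ->] <-]]; apply: open_measurable_plane.
rewrite openE => p [Up fp]; rewrite /interior.
apply: filterI; first exact: open_nbhs_nbhs.
apply: (cf _ Up); apply: open_nbhs_nbhs; split => //.
Qed.

Local Notation mu := (@lebesgue_measure R).
Local Notation mu2 := ((mu \x mu)%E).

Lemma integral_xsection A f : measurable A -> mu2.-integrable A (EFin \o f) ->
  (\int[mu2]_(p in A) (f p)%:E =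
   \int[mu]_x \int[mu]_(y in xsection A x) (f (x, y))%:E)%E.
Proof.
move=> mA fA.
rewrite integral_mkcond -integral12_prod_meas1; last by rewrite -integrable_mkcond.
apply: eq_integral => x _; rewrite [RHS]integral_mkcond.
apply: eq_integral => y _; rewrite !patchE /=.
by rewrite mem_xsection.
Qed.

Lemma integral_ysection A f : measurable A -> mu2.-integrable A (EFin \o f) ->
  (\int[mu2]_(p in A) (f p)%:E =
   \int[mu]_y \int[mu]_(x in ysection A y) (f (x, y))%:E)%E.
Proof.
move=> mA fA.
rewrite integral_mkcond -integral21_prod_meas1; last by rewrite -integrable_mkcond.
apply: eq_integral => y _; rewrite [RHS]integral_mkcond.
apply: eq_integral => x _; rewrite !patchE /=.
by rewrite mem_ysection.
Qed.

Lemma compact_bounded_plane U K f : compact K -> K `<=` U ->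
  (forall p, U p -> {for p, continuous f}) ->
  exists2 M : R, 0 < M & forall p, K p -> `|f p| <= M.
Proof.
move=> cK KU cf.
have : compact (f @` K).
  apply: continuous_compact => //; apply: continuous_in_subspaceT => p /set_mem Kp.
  by apply: cf; exact: KU.
move=> /compact_bounded[M [_ HM]].
exists (`|M| + 1); first by rewrite ltr_wpDl.
move=> p Kp; apply: (HM (`|M| + 1)); last by exists p.
by rewrite ltr_pwDr// ler_norm.
Qed.

Lemma compact_measure_plane K : compact K -> (mu2 K < +oo)%E.
Proof.
move=> cK; have mK : measurable K by exact: compact_measurable_plane.
have [M M0 HM] := @compact_bounded_plane setT K fst cK (@subsetT _ _) (fun p _ => cvg_fst).
have [N N0 HN] := @compact_bounded_plane setT K snd cK (@subsetT _ _) (fun p _ => cvg_snd).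
pose B : set (R * R) := `[- M, M] `*` `[- N, N].
apply: (@le_lt_trans _ _ (mu2 B)).
  apply: le_measure; first exact: mem_set.
    by apply: mem_set; apply: measurableX; exact: measurable_itv.
  by move=> p Kp; split; rewrite /= in_itv/= -ler_norml; [exact: HM|exact: HN].
rewrite product_measure1E; [|exact: measurable_itv|exact: measurable_itv].
by rewrite /= !lebesgue_measure_itv/= !lte_fin; case: ifP => _; case: ifP => _; rewrite ?mule0 ?mul0e ?ltry// -!EFinB -EFinM ltry.
Qed.

Lemma compact_integrable_plane U K f : open U -> compact K -> K `<=` U ->
  (forall p, U p -> {for p, continuous f}) -> mu2.-integrable K (EFin \o f).
Proof.
move=> oU cK KU cf.
have mK : measurable K by exact: compact_measurable_plane.
apply: measurable_bounded_integrable => //.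
- exact: compact_measure_plane.
- exact: continuous_measurable_plane KU cf.
have [M M0 HM] := compact_bounded_plane cK KU cf.
exists M; split; first by rewrite num_real.
by move=> x Mx p Kp; apply: (le_trans (HM _ Kp)); exact: ltW.
Qed.
End measurable_plane.

(** * Differentiability along curves *)

Section curve_differentiable.
Variable R : realType.
Implicit Types (P Q F G : R * R -> R) (p : R * R).

Definition continuous_half (P : R * R -> R) :=
  forall p, 0 < p.2 -> {for p, continuous P}.

(* [P] has partial derivatives [Px], [Py] and the chain rule holds along every
   differentiable curve; this replaces Frechet differentiability. *)
Definition cdiff P Px Py := continuous_half P /\
  forall (X Y : R -> R) (t a b : R), is_derive t (1 : R) X a ->
    is_derive t (1 : R) Y b -> 0 < Y t ->
  is_derive t (1 : R) (fun r => P (X r, Y r))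
    (Px (X t, Y t) * a + Py (X t, Y t) * b).

Lemma is_derive_continuous (f : R -> R) (t a : R) :
  is_derive t (1 : R) f a -> {for t, continuous f}.
Proof.
by move=> d; apply: differentiable_continuous; apply/derivable1_diffP; exact: ex_derive.
Qed.

Lemma open_half : open [set p : R * R | 0 < p.2].
Proof. by apply: (@open_comp _ _ snd [set y : R | 0 < y]) => [p _|]; [exact: cvg_snd|exact: open_gt]. Qed.

Lemma near_half p : 0 < p.2 -> \forall q \near p, 0 < q.2.
Proof. by move=> p0; apply: open_nbhs_nbhs; split => //; exact: open_half. Qed.

Lemma continuous_half_cst (c : R) : continuous_half (fun=> c).
Proof. by move=> p _; exact: cvg_cst. Qed.

Arguments continuous_half_cst : clear implicits.

Lemma continuous_halfD P Q :
  continuous_half P -> continuous_half Q -> continuous_half (fun p => P p + Q p).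
Proof. by move=> cP cQ p p0; apply: continuousD; [exact: cP|exact: cQ]. Qed.

Lemma continuous_halfB P Q :
  continuous_half P -> continuous_half Q -> continuous_half (fun p => P p - Q p).
Proof. by move=> cP cQ p p0; apply: continuousB; [exact: cP|exact: cQ]. Qed.

Lemma continuous_halfM P Q :
  continuous_half P -> continuous_half Q -> continuous_half (fun p => P p * Q p).
Proof. by move=> cP cQ p p0; apply: continuousM; [exact: cP|exact: cQ]. Qed.

Lemma continuous_half_comp (f : R -> R) P :
  (forall y, 0 < y -> {for y, continuous f}) -> (forall p, 0 < p.2 -> 0 < P p) ->
  continuous_half P -> continuous_half (fun p => f (P p)).
Proof.
move=> cf P0 cP p p0; apply: (@continuous_comp _ _ _ P f); first exact: cP.
exact/cf/P0.
Qed.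

Lemma continuous_half_fst : continuous_half fst.
Proof. by move=> p _; exact: cvg_fst. Qed.

Lemma continuous_half_snd : continuous_half snd.
Proof. by move=> p _; exact: cvg_snd. Qed.

Lemma cdiff_cst (c : R) : cdiff (fun=> c) (fun=> 0) (fun=> 0).
Proof.
split=> [|X Y t a b dX dY Y0]; first exact: continuous_half_cst.
by rewrite !mul0r addr0; exact: is_derive_cst.
Qed.

Lemma cdiff_fst : cdiff fst (fun=> 1) (fun=> 0).
Proof.
split=> [|X Y t a b dX dY Y0]; first exact: continuous_half_fst.
by rewrite mul1r mul0r addr0.
Qed.

Lemma cdiff_snd : cdiff snd (fun=> 0) (fun=> 1).
Proof.
split=> [|X Y t a b dX dY Y0]; first exact: continuous_half_snd.
by rewrite mul1r mul0r add0r.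
Qed.

Lemma cdiffD P Px Py Q Qx Qy : cdiff P Px Py -> cdiff Q Qx Qy ->
  cdiff (fun p => P p + Q p) (fun p => Px p + Qx p) (fun p => Py p + Qy p).
Proof.
move=> [cP dP] [cQ dQ]; split; first exact: continuous_halfD.
move=> X Y t a b dX dY Y0; apply: is_derive_eq.
  by apply: is_deriveD; [exact: dP|exact: dQ].
ring.
Qed.

Lemma cdiffM P Px Py Q Qx Qy : cdiff P Px Py -> cdiff Q Qx Qy ->
  cdiff (fun p => P p * Q p) (fun p => Px p * Q p + P p * Qx p)
    (fun p => Py p * Q p + P p * Qy p).
Proof.
move=> [cP dP] [cQ dQ]; split; first exact: continuous_halfM.
move=> X Y t a b dX dY Y0; apply: is_derive_eq.
  by apply: is_deriveM; [exact: dP|exact: dQ].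
rewrite /GRing.scale /=; ring.
Qed.

Lemma cdiff_comp (f f' : R -> R) (P Px Py : R * R -> R) :
  (forall y : R, 0 < y -> is_derive y (1 : R) f (f' y)) ->
  (forall p, 0 < p.2 -> 0 < P p) -> cdiff P Px Py ->
  cdiff (fun p => f (P p)) (fun p => f' (P p) * Px p) (fun p => f' (P p) * Py p).
Proof.
move=> df P0 [cP dP]; split.
  apply: continuous_half_comp => // y y0.
  exact: is_derive_continuous (df y y0).
move=> X Y t a b dX dY Y0; apply: is_derive_eq.
  apply: (@is_derive1_comp _ f (fun r => P (X r, Y r))).
    by apply: df; apply: P0.
  exact: dP.
ring.
Qed.

(** Values near p decide the derivative at p, so [P'] must agree with [P] on a neighbourhood while
    its partial derivatives need to agree only at p. This fits locally finite sums, where the finite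
    set of terms changes with the point. *)
Lemma cdiff_local P Px Py : (forall p, 0 < p.2 -> exists P' Px' Py',
    [/\ cdiff P' Px' Py', \forall q \near p, P q = P' q,
        Px p = Px' p & Py p = Py' p]) -> cdiff P Px Py.
Proof.
move=> H; split.
  move=> p p0; have [P' [Px' [Py' [[cP' _] e _ _]]]] := H _ p0.
  have /nbhs_singleton ep := e.
  rewrite /prop_for /continuous_at ep; apply: cvg_trans (cP' _ p0).
  by apply: near_eq_cvg; near do apply/esym; exact: e.
move=> X Y t a b dX dY Y0.
have [P' [Px' [Py' [[_ dP'] e -> ->]]]] := H (X t, Y t) Y0.
apply: near_eq_is_derive (dP' _ _ _ _ _ dX dY Y0).
have cX : {for t, continuous X}.
  exact: is_derive_continuous dX.
have cY : {for t, continuous Y}.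
  exact: is_derive_continuous dY.
have cXY : {for t, continuous (fun r => (X r, Y r) : R * R)}.
  by apply: (@cvg_pair _ _ _ _ (nbhs (X t)) (nbhs (Y t))); [exact: cX|exact: cY].
near=> r; apply/esym; near: r; exact: (cXY _ e).
Unshelve. all: by end_near.
Qed.

Lemma cdiff_ext P Px Py P' Px' Py' : cdiff P' Px' Py' ->
  (forall p, 0 < p.2 -> P p = P' p) -> (forall p, 0 < p.2 -> Px p = Px' p) ->
  (forall p, 0 < p.2 -> Py p = Py' p) -> cdiff P Px Py.
Proof.
move=> d e ex ey; apply: cdiff_local => p p0.
exists P', Px', Py'; split => //; [|exact: ex|exact: ey].
by near=> q; apply: e; near: q; exact: near_half.
Unshelve. all: by end_near.
Qed.

Lemma cdiff_sum (I : Type) (r : seq I) (P Px Py : I -> R * R -> R) :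
  (forall i, cdiff (P i) (Px i) (Py i)) ->
  cdiff (fun p => \sum_(i <- r) P i p) (fun p => \sum_(i <- r) Px i p)
    (fun p => \sum_(i <- r) Py i p).
Proof.
move=> d; elim: r => [|i r IH].
  by apply: cdiff_ext (cdiff_cst 0) _ _ _ => p _; rewrite big_nil.
by apply: cdiff_ext (cdiffD (d i) IH) _ _ _ => p _; rewrite big_cons.
Qed.

(** The same [uxy] is the y-derivative of [ux] and the x-derivative of [uy]: symmetry of the mixed
    derivatives is built in and gets checked on explicit formulas instead of being deduced from
    continuity. *)
Definition C2 (u ux uy uxx uxy uyy : R * R -> R) : Prop :=
  [/\ cdiff u ux uy, cdiff ux uxx uxy, cdiff uy uxy uyy &
      [/\ continuous_half uxx, continuous_half uxy & continuous_half uyy]].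

Lemma C2_comp (f f' f'' : R -> R) (q qx qy qxx qxy qyy : R * R -> R) :
  (forall y : R, 0 < y -> is_derive y (1 : R) f (f' y)) ->
  (forall y : R, 0 < y -> is_derive y (1 : R) f' (f'' y)) ->
  (forall y : R, 0 < y -> {for y, continuous f''}) ->
  (forall p, 0 < p.2 -> 0 < q p) -> C2 q qx qy qxx qxy qyy ->
  C2 (fun p => f (q p)) (fun p => f' (q p) * qx p) (fun p => f' (q p) * qy p)
    (fun p => f'' (q p) * qx p ^+ 2 + f' (q p) * qxx p)
    (fun p => f'' (q p) * (qx p * qy p) + f' (q p) * qxy p)
    (fun p => f'' (q p) * qy p ^+ 2 + f' (q p) * qyy p).
Proof.
move=> df df' cf'' q0 [dq dqx dqy [cxx cxy cyy]].
have d1 := cdiff_comp df q0 dq.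
have d2 := cdiff_comp df' q0 dq.
have cf' y : 0 < y -> {for y, continuous f'} by move=> /df'; exact: is_derive_continuous.
have c1 : continuous_half (fun p => f' (q p)) by case: d2.
have c2 : continuous_half (fun p => f'' (q p)).
  by apply: continuous_half_comp => //; case: dq.
have cqx : continuous_half qx by case: dqx.
have cqy : continuous_half qy by case: dqy.
split => //.
- apply: cdiff_ext (cdiffM d2 dqx) _ _ _ => p _ //; ring.
- apply: cdiff_ext (cdiffM d2 dqy) _ _ _ => p _ //; ring.
split; apply: continuous_halfD; apply: continuous_halfM => //.
- exact: continuous_halfM.
- exact: continuous_halfM.
- exact: continuous_halfM.
Qed.

(** * The function Im(g z) and its derivatives *)

Section imaginary_part.
Variables c d : R.
Hypothesis cd0 : (c != 0) || (d != 0).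

(* For the bottom row [(c, d)] of [g], [absj] is [|c z + d|^2] and [imq] is [Im (g z)]. *)
Definition absj (p : R * R) : R := (c * p.1 + d) ^+ 2 + (c * p.2) ^+ 2.
Definition imq p := p.2 / absj p.
(** Write j = c z + d. If (c, d) is the bottom row of g in SL_2, then g' = j^-2, and the
    Cauchy-Riemann equations give [imq_x] = Im j^-2 and [imq_y] = Re j^-2. Likewise [imq_xx] and
    [imq_xy] are the imaginary and real parts of g'' = -2 c j^-3, and harmonicity gives [imq_yy]. *)
Definition imq_x p := - 2 * (c * p.1 + d) * (c * p.2) / absj p ^+ 2.
Definition imq_y p := ((c * p.1 + d) ^+ 2 - (c * p.2) ^+ 2) / absj p ^+ 2.
Definition imq_xx p :=
  c * (6 * (c * p.1 + d) ^+ 2 * (c * p.2) - 2 * (c * p.2) ^+ 3) / absj p ^+ 3.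
Definition imq_xy p :=
  c * (6 * (c * p.1 + d) * (c * p.2) ^+ 2 - 2 * (c * p.1 + d) ^+ 3) / absj p ^+ 3.
Definition imq_yy p := - imq_xx p.

Lemma absj_gt0 p : 0 < p.2 -> 0 < absj p.
Proof.
move=> p0; rewrite /absj; have [c0|c0] := eqVneq c 0.
  rewrite c0 !mul0r add0r expr0n addr0 exprn_even_gt0 //=.
  by move: cd0; rewrite c0 eqxx.
by rewrite ltr_wpDl ?sqr_ge0 // exprn_even_gt0 //= mulf_neq0 // gt_eqF.
Qed.

Lemma cdiff_absj : cdiff absj (fun p => 2 * c * (c * p.1 + d)) (fun p => 2 * c * (c * p.2)).
Proof.
have dm := cdiffD (cdiffM (cdiff_cst c) cdiff_fst) (cdiff_cst d).
have dn := cdiffM (cdiff_cst c) cdiff_snd.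
by apply: cdiff_ext (cdiffD (cdiffM dm dm) (cdiffM dn dn)) _ _ _ => p _ /=; rewrite /absj; ring.
Qed.

Lemma cdiff_absjV : cdiff (fun p => (absj p)^-1)
  (fun p => - absj p ^- 2 * (2 * c * (c * p.1 + d)))
  (fun p => - absj p ^- 2 * (2 * c * (c * p.2))).
Proof.
apply: (@cdiff_comp GRing.inv (fun x => - x ^- 2)) cdiff_absj; last exact: absj_gt0.
move=> y y0; apply: is_derive_eq.
  by apply: (@is_deriveV _ id); rewrite ?gt_eqF.
by rewrite /GRing.scale /= mulr1.
Qed.

Lemma imq_gt0 p : 0 < p.2 -> 0 < imq p.
Proof. by move=> p0; rewrite divr_gt0 // absj_gt0. Qed.

Lemma cdiff_imq : cdiff imq imq_x imq_y.
Proof.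
apply: cdiff_ext (cdiffM cdiff_snd cdiff_absjV) _ _ _ => p /absj_gt0 a0 //=;
  rewrite /imq_x /imq_y; move: a0 => /lt0r_neq0; rewrite /absj => a0; by field.
Qed.

Lemma cdiff_imq_x : cdiff imq_x imq_xx imq_xy.
Proof.
have dm := cdiffD (cdiffM (cdiff_cst c) cdiff_fst) (cdiff_cst d).
have dn := cdiffM (cdiff_cst c) cdiff_snd.
have dV := cdiffM cdiff_absjV cdiff_absjV.
apply: cdiff_ext (cdiffM (cdiffM (cdiff_cst (-2)) (cdiffM dm dn)) dV) _ _ _ => p /absj_gt0 a0 //=;
  rewrite /imq_x /imq_xx /imq_xy; move: a0 => /lt0r_neq0; rewrite /absj => a0; by field.
Qed.

Lemma cdiff_imq_y : cdiff imq_y imq_xy imq_yy.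
Proof.
have dm := cdiffD (cdiffM (cdiff_cst c) cdiff_fst) (cdiff_cst d).
have dn := cdiffM (cdiff_cst c) cdiff_snd.
have dV := cdiffM cdiff_absjV cdiff_absjV.
apply: cdiff_ext (cdiffM (cdiffD (cdiffM dm dm) (cdiffM (cdiff_cst (-1)) (cdiffM dn dn))) dV) _ _ _ => p /absj_gt0 a0 //=;
  rewrite /imq_y /imq_yy /imq_xx /imq_xy; move: a0 => /lt0r_neq0; rewrite /absj => a0; by field.
Qed.

Lemma C2_imq : C2 imq imq_x imq_y imq_xx imq_xy imq_yy.
Proof.
have [cm _] := cdiffD (cdiffM (cdiff_cst c) cdiff_fst) (cdiff_cst d).
have [cn _] := cdiffM (cdiff_cst c) cdiff_snd.
have [cV _] := cdiff_absjV.
have cV3 := continuous_halfM cV (continuous_halfM cV cV).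
have cxx : continuous_half imq_xx.
  have := continuous_halfM (continuous_halfM (continuous_half_cst c) (continuous_halfB
    (continuous_halfM (continuous_halfM (continuous_half_cst 6) (continuous_halfM cm cm)) cn)
    (continuous_halfM (continuous_half_cst 2) (continuous_halfM cn (continuous_halfM cn cn))))) cV3.
  by congr continuous_half; apply/funext => p; rewrite /imq_xx -!exprVn /=; ring.
split; [exact: cdiff_imq|exact: cdiff_imq_x|exact: cdiff_imq_y|split => //].
  have := continuous_halfM (continuous_halfM (continuous_half_cst c) (continuous_halfB
    (continuous_halfM (continuous_halfM (continuous_half_cst 6) cm) (continuous_halfM cn cn))
    (continuous_halfM (continuous_half_cst 2) (continuous_halfM cm (continuous_halfM cm cm))))) cV3.
  by congr continuous_half; apply/funext => p; rewrite /imq_xy -!exprVn /=; ring.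
by move=> p p0; apply: continuousN; exact: cxx.
Qed.

(** Both sides are |g'(z)|^2 = |c z + d|^-4. *)
Lemma imq_grad p : 0 < p.2 -> imq_x p ^+ 2 + imq_y p ^+ 2 = (imq p / p.2) ^+ 2.
Proof.
move=> p0; have := absj_gt0 p0 => /lt0r_neq0; move: p0 => /lt0r_neq0.
by rewrite /imq_x /imq_y /imq /absj => p0 a0; field; rewrite a0 p0.
Qed.

Lemma imq_grad_le p : 0 < p.2 -> `|imq_x p| <= imq p / p.2 /\ `|imq_y p| <= imq p / p.2.
Proof.
move=> p0; have q0 : 0 <= imq p / p.2 by rewrite ltW // divr_gt0 // imq_gt0.
have := imq_grad p0 => e.
split; rewrite -(ger0_norm q0) -ler_sqr ?nnegrE // !real_normK ?num_real // -e.
  by rewrite lerDl sqr_ge0.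
by rewrite lerDr sqr_ge0.
Qed.

End imaginary_part.
End curve_differentiable.

(** * Green's formula on the fundamental domain *)

Section green.
Variable R : realType.
Local Notation mu := (@lebesgue_measure R).
Local Notation mu2 := ((mu \x mu)%E).

Lemma continuous_half_pair (T : topologicalType) (G : R * R -> R) (X Y : T -> R) t :
  continuous_half G -> {for t, continuous X} -> {for t, continuous Y} ->
  0 < Y t -> {for t, continuous (fun r => G (X r, Y r))}.
Proof.
move=> cG cX cY Y0.
have cXY : {for t, continuous (fun r => (X r, Y r) : R * R)}.
  by apply: (@cvg_pair _ _ _ _ (nbhs (X t)) (nbhs (Y t))); [exact: cX|exact: cY].
by apply: (@continuous_comp _ _ _ (fun r => (X r, Y r) : R * R) G); [exact: cXY|exact: cG].
Qed.

Lemma continuous_slice1 (G : R * R -> R) x t :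
  {for (x, t), continuous G} -> {for x, continuous (fun x => G (x, t))}.
Proof.
move=> cG; have cp : {for x, continuous (fun x => (x, t) : R * R)}.
  by apply: (@cvg_pair _ _ _ _ (nbhs x) (nbhs t)); [exact: cvg_id|exact: cvg_cst].
exact: (@continuous_comp _ _ _ (fun x => (x, t) : R * R) G x cp cG).
Qed.

Lemma continuous_slice2 (G : R * R -> R) x t :
  {for (x, t), continuous G} -> {for t, continuous (fun t => G (x, t))}.
Proof.
move=> cG; have cp : {for t, continuous (fun t => (x, t) : R * R)}.
  by apply: (@cvg_pair _ _ _ _ (nbhs x) (nbhs t)); [exact: cvg_cst|exact: cvg_id].
exact: (@continuous_comp _ _ _ (fun t => (x, t) : R * R) G t cp cG).
Qed.

Lemma FTC2_is_derive (F f : R -> R) (a b : R) : a <= b ->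
  (forall x, a <= x <= b -> is_derive x (1 : R) F (f x)) ->
  (forall x, a <= x <= b -> {for x, continuous f}) ->
  (\int[mu]_(x in `[a, b]) (f x)%:E = (F b - F a)%:E)%E.
Proof.
rewrite le_eqVlt => /predU1P[-> _ _|ab dF cf].
  by rewrite set_itv1 integral_set1 subrr.
rewrite EFinB; apply: continuous_FTC2 => //.
- apply: continuous_in_subspaceT => x /set_mem/=; rewrite in_itv/=.
  by move=> xab; apply: cf.
- split=> [x /[!in_itv]/= /andP[ax xb]||].
  + have xab : a <= x <= b by rewrite !ltW.
    by have ? := dF x xab; exact: ex_derive.
  + apply: cvg_at_right_filter; apply: is_derive_continuous (dF a _).
    by rewrite lexx ltW.
  + apply: cvg_at_left_filter; apply: is_derive_continuous (dF b _).
    by rewrite lexx ltW.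
- move=> x /[!in_itv]/= /andP[ax xb]; rewrite derive1E.
  by apply: derive_val; apply: dF; rewrite !ltW.
Qed.

Lemma integral_shift (G : R -> R) (c Y : R) : 0 <= Y ->
  (forall x, c <= x <= c + Y -> {for x, continuous G}) ->
  (\int[mu]_(y in `[c, (c + Y)%R]) (G y)%:E = \int[mu]_(t in `[0%R, Y]) (G (c + t)%R)%:E)%E.
Proof.
move=> Y0 cG.
have dF (t : R) : is_derive t (1 : R) (fun t => c + t) 1.
  exact: (is_derive_eq (is_deriveD (is_derive_cst c t (1 : R)) (is_derive_id t (1 : R))) (add0r _)).
have F1 : (fun t => c + t)^`()%classic = cst 1.
  by apply/funext => t; rewrite derive1E; apply: derive_val.
have cF (t : R) : {for t, continuous (fun t => c + t)} by exact: is_derive_continuous (dF t).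
have := @integration_by_substitution_increasing R (fun t => c + t) G 0 Y Y0.
rewrite /= addr0 => ->.
- by apply: eq_integral => x _; rewrite F1 /= mulr1.
- by move=> x y _ _; rewrite ltrD2l.
- by move=> x _; rewrite F1; exact: cvg_cst.
- by rewrite F1; exact: is_cvg_cst.
- by rewrite F1; exact: is_cvg_cst.
- split=> [x _||]; first by have ? := dF x; exact: ex_derive.
  + by apply: cvg_at_right_filter; exact: cF.
  + by apply: cvg_at_left_filter; exact: cF.
- apply: continuous_in_subspaceT => x /set_mem/=; rewrite in_itv/=.
  by move=> xab; apply: cG.
Qed.

Definition arc (x : R) : R := Num.sqrt (1 - x ^+ 2).

Let is_derive_radicand (x : R) : is_derive x (1 : R) (fun x => 1 - x ^+ 2) (- (2 * x)).
Proof.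
apply: is_derive_eq (is_deriveB (is_derive_cst (1 : R) x (1 : R)) (is_deriveX 2 (is_derive_id x (1 : R)))) _.
by rewrite /GRing.scale /= sub0r mulr1 expr1.
Qed.

Lemma continuous_arc (x : R) : {for x, continuous arc}.
Proof.
have -> : arc = Num.sqrt \o (fun x => 1 - x ^+ 2) by [].
apply: continuous_comp; last exact: sqrt_continuous.
exact: is_derive_continuous (is_derive_radicand x).
Qed.

Lemma arc_ge0 x : 0 <= arc x. Proof. exact: sqrtr_ge0. Qed.

Lemma arc_sqr (x : R) : `|x| <= 1 -> x ^+ 2 + arc x ^+ 2 = 1.
Proof.
move=> x1; rewrite /arc sqr_sqrtr; first by ring.
by rewrite subr_ge0 -real_normK ?num_real // expr_le1.
Qed.

Lemma arc_gt0 (x : R) : `|x| < 1 -> 0 < arc x.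
Proof.
by move=> x1; rewrite sqrtr_gt0 subr_gt0 -real_normK ?num_real // expr_lt1.
Qed.

Lemma is_derive_arc (x : R) : `|x| < 1 -> is_derive x (1 : R) arc (- x / arc x).
Proof.
move=> x1; have h0 := arc_gt0 x1.
have s0 : 0 < 1 - x ^+ 2 by rewrite -sqrtr_gt0.
have e : arc = Num.sqrt \o (fun x => 1 - x ^+ 2) by [].
have d1 := is_derive1_sqrt s0.
have d2 := is_derive_radicand x.
have d3 := @is_derive1_comp R Num.sqrt (fun x => 1 - x ^+ 2) x _ _ d1 d2.
rewrite e; apply: (is_derive_eq d3).
rewrite /=; field.
by rewrite gt_eqF.
Qed.

Lemma arcN (x : R) : arc (- x) = arc x. Proof. by rewrite /arc sqrrN. Qed.

Lemma closed_ge0 (g : R * R -> R) : (forall p, {for p, continuous g}) ->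
  closed [set p | 0 <= g p].
Proof.
by move=> cg; apply: (@closed_comp _ _ g [set y | 0 <= y]) => [p _|]; [exact: cg|exact: closed_ge].
Qed.

(* The part of the fundamental domain below the translate of its arc by [Y]: in
   the coordinates [(x, y - arc x)] it is a rectangle. *)
Definition region (Y : R) : set (R * R) :=
  [set p | -2^-1 <= p.1 <= 2^-1 /\ arc p.1 <= p.2 <= arc p.1 + Y].

Lemma arc_le1 x : arc x <= 1.
Proof.
rewrite -sqrtr1 /arc; have [s0|s0] := leP 0 (1 - x ^+ 2).
  by rewrite ler_wsqrtr // gerBl sqr_ge0.
by rewrite ler0_sqrtr ?sqrtr_ge0 // ltW.
Qed.

Lemma half_arc_gt0 (x : R) : -2^-1 <= x <= 2^-1 -> 2^-1 < arc x.
Proof.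
rewrite -ler_norml => x2.
have x1 : `|x| < 1 by apply: le_lt_trans x2 _; lra.
have := arc_sqr (ltW x1); have := arc_gt0 x1; move: x2.
rewrite -(real_normK (num_real x)); set a := `|x|; set b := arc x => a2 b0 e.
have a0 : 0 <= a by exact: normr_ge0.
nra.
Qed.

Lemma region_half Y p : region Y p -> 2^-1 < p.2.
Proof. by move=> [/half_arc_gt0 h /andP[+ _]]; exact: lt_le_trans. Qed.

Lemma compact_region Y : compact (region Y).
Proof.
have cB : compact ((`[-2^-1, 2^-1]%classic `*` `[0, 1 + Y]%classic) : set (R * R)).
  by apply: compact_setX; exact: segment_compact.
apply: subclosed_compact cB _.
- have -> : region Y = [set p | 0 <= p.1 + 2^-1] `&` [set p | 0 <= 2^-1 - p.1] `&`
     ([set p | 0 <= p.2 - arc p.1] `&` [set p | 0 <= arc p.1 + Y - p.2]).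
    apply/seteqP; split=> [p [/andP[a b] /andP[c d]]|p [[/= a b] [c d]]].
      by split; split; rewrite /= ?subr_ge0 // -lerBlDr sub0r.
    by split; apply/andP; split; lra.
  have cf (p : R * R) : {for p, continuous fst} by exact: cvg_fst.
  have cs (p : R * R) : {for p, continuous snd} by exact: cvg_snd.
  have ca (p : R * R) : {for p, continuous (fun p => arc p.1)}.
    by apply: (@continuous_comp _ _ _ fst arc); [exact: cf|exact: continuous_arc].
  have cc (c : R) (p : R * R) : {for p, continuous (fun=> c)} by exact: cvg_cst.
  apply: closedI; apply: closedI; apply: closed_ge0 => p.
  + exact: continuousD (cf p) (cc _ p).
  + exact: continuousB (cc _ p) (cf p).
  + exact: continuousB (cs p) (ca p).
  + exact: continuousB (continuousD (ca p) (cc _ p)) (cs p).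
- move=> p [p1 /andP[p2 p3]]; split; rewrite /= in_itv/= //; apply/andP; split.
    exact: le_trans (arc_ge0 _) p2.
  by apply: le_trans p3 _; rewrite lerD2r arc_le1.
Qed.

Let I : set R := `[-2^-1, 2^-1]%classic.

Let rect Y : set (R * R) := I `*` `[0, Y].

Let compact_rect Y : compact (rect Y).
Proof. by apply: compact_setX; exact: segment_compact. Qed.

Lemma measurable_region Y : measurable (region Y).
Proof. by apply: compact_measurable_plane; exact: compact_region. Qed.

Lemma integrable_region Y G : continuous_half G -> mu2.-integrable (region Y) (EFin \o G).
Proof.
move=> cG; apply: (@compact_integrable_plane _ [set p | 0 < p.2]) => //.
- exact: open_half.
- exact: compact_region.
- by move=> p /region_half; apply: lt_trans; lra.
Qed.

Lemma integral_region Y G : continuous_half G -> 0 <= Y ->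
  (\int[mu2]_(p in region Y) (G p)%:E =
   \int[mu]_(x in I) \int[mu]_(t in `[0%R, Y]) (G (x, (arc x + t)%R))%:E)%E.
Proof.
move=> cG Y0; rewrite integral_xsection; [|exact: measurable_region|exact: integrable_region].
rewrite [RHS]integral_mkcond; apply: eq_integral => x _.
rewrite patchE; case: ifPn => [/set_mem|] xI.
  have -> : xsection (region Y) x = `[arc x, (arc x + Y)%R]%classic.
    apply/seteqP; split => y; rewrite /xsection /=.
      by move=> /set_mem[_] /=; rewrite in_itv.
    by rewrite in_itv/= => h; apply/mem_set; split.
  rewrite integral_shift // => y /andP[y1 _].
  apply: (@continuous_half_pair _ G (fun=> x) id y cG); [exact: cvg_cst|exact: cvg_id|].
  apply: lt_le_trans y1; apply: lt_trans (half_arc_gt0 _); first by lra.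
  by move: xI; rewrite /I/= in_itv/=.
have -> : xsection (region Y) x = set0.
  apply/seteqP; split => y //; rewrite /xsection/= => /set_mem[h _].
  by move: xI; rewrite notin_setE; apply; rewrite /I/= in_itv/=.
by rewrite integral_set0.
Qed.

Let measurable_rect Y : measurable (rect Y).
Proof. by apply: measurableX; exact: measurable_itv. Qed.

Lemma integral_rect12 Y (f : R * R -> R) : mu2.-integrable (rect Y) (EFin \o f) ->
  (\int[mu2]_(p in rect Y) (f p)%:E =
   \int[mu]_(x in I) \int[mu]_(t in `[0%R, Y]) (f (x, t))%:E)%E.
Proof.
move=> fi; rewrite (integral_xsection (measurable_rect Y) fi) [RHS]integral_mkcond.
apply: eq_integral => x _; rewrite patchE; case: ifPn => xI.
  by rewrite in_xsectionX.
by rewrite notin_xsectionX // integral_set0.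
Qed.

Lemma integral_rect21 Y (f : R * R -> R) : mu2.-integrable (rect Y) (EFin \o f) ->
  (\int[mu2]_(p in rect Y) (f p)%:E =
   \int[mu]_(t in `[0%R, Y]) \int[mu]_(x in I) (f (x, t))%:E)%E.
Proof.
move=> fi; rewrite (integral_ysection (measurable_rect Y) fi) [RHS]integral_mkcond.
apply: eq_integral => t _; rewrite patchE; case: ifPn => tI.
  by rewrite in_ysectionX.
by rewrite notin_ysectionX // integral_set0.
Qed.

(** An open neighbourhood of every [rect Y] on which [arc] is differentiable and the point (x, arc x
    + t) stays in the upper half-plane. *)
Let U : set (R * R) := [set p | `|p.1| < 1] `&` [set p | 0 < arc p.1 + p.2].

Let continuous_arc1 (p : R * R) : {for p, continuous (fun p : R * R => arc p.1)}.
Proof. by apply: (@continuous_comp _ _ _ fst arc); [exact: cvg_fst|exact: continuous_arc]. Qed.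

Let continuous_arcD (p : R * R) : {for p, continuous (fun p : R * R => arc p.1 + p.2)}.
Proof.
have cs : {for p, continuous (@snd R R)} by exact: cvg_snd.
exact: continuousD (@continuous_arc1 p) cs.
Qed.

Let open_U : open U.
Proof.
apply: openI.
  apply: (@open_comp _ _ (fun p : R * R => `|p.1|) [set y : R | y < 1]) => [p _|]; last exact: open_lt.
  by apply: (@continuous_comp _ _ _ fst (@Num.norm R R)); [exact: cvg_fst|exact: norm_continuous].
apply: (@open_comp _ _ (fun p : R * R => arc p.1 + p.2) [set y : R | 0 < y]) => [p _|]; last exact: open_gt.
exact: continuous_arcD.
Qed.

Let rect_U Y : rect Y `<=` U.
Proof.
move=> [x t] [/=]; rewrite /I/= !in_itv/= => xI /andP[t0 _]; split => /=.
  by apply: le_lt_trans (_ : 2^-1 < 1); [rewrite ler_norml|lra].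
by rewrite ltr_wpDr // arc_gt0 //; apply: le_lt_trans (_ : 2^-1 < 1); [rewrite ler_norml|lra].
Qed.

Let slope (x : R) := - x / arc x.

Section divergence.
Variables (P Px Py Q Qx Qy : R * R -> R) (Y : R).
Hypotheses (dP : cdiff P Px Py) (dQ : cdiff Q Qx Qy).
Hypotheses (cPx : continuous_half Px) (cPy : continuous_half Py).
Hypotheses (cQy : continuous_half Qy).
Hypothesis Y0 : 0 <= Y.
Hypotheses (P0 : forall p, Y < p.2 -> P p = 0) (Q0 : forall p, Y < p.2 -> Q p = 0).

(** In the coordinates (x, t) with y = arc x + t, [A] is the x-derivative of P at fixed t and [B] is
    the t-derivative of Q - slope P. The slope terms cancel in the sum, which leaves Px + Qy. *)
Let A p := Px (p.1, arc p.1 + p.2) + Py (p.1, arc p.1 + p.2) * slope p.1.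
Let B p := Qy (p.1, arc p.1 + p.2) - slope p.1 * Py (p.1, arc p.1 + p.2).

Let continuous_G G : continuous_half G -> forall p, U p ->
  {for p, continuous (fun p => G (p.1, arc p.1 + p.2))}.
Proof.
move=> cG p [_ p0].
have cf : {for p, continuous (@fst R R)} by exact: cvg_fst.
exact: (@continuous_half_pair _ G _ _ p cG cf (@continuous_arcD p) p0).
Qed.

Let continuous_slope p : U p -> {for p, continuous (fun p => slope p.1)}.
Proof.
move=> [p1 _]; apply: continuousM.
  by apply: continuousN; exact: cvg_fst.
apply: continuousV; first by rewrite gt_eqF // arc_gt0.
exact: continuous_arc1.
Qed.

Let cA p : U p -> {for p, continuous A}.
Proof.
move=> Up; apply: continuousD (continuous_G cPx Up) _.
exact: continuousM (continuous_G cPy Up) (continuous_slope Up).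
Qed.

Let cB p : U p -> {for p, continuous B}.
Proof.
move=> Up; apply: continuousB (continuous_G cQy Up) _.
exact: continuousM (continuous_slope Up) (continuous_G cPy Up).
Qed.

(** Shearing turns the region into a rectangle. [A] is integrated first in x, which leaves the two
    vertical sides at equal t; [B] is integrated first in t, which leaves the lower arc. *)
Lemma divergence_region :
  (\int[mu2]_(p in region Y) (Px p + Qy p)%:E =
   \int[mu]_(t in `[0%R, Y]) (P (2^-1, arc 2^-1 + t) - P (- 2^-1, arc 2^-1 + t))%:E
   + \int[mu]_(x in I) (slope x * P (x, arc x) - Q (x, arc x))%:E)%E.
Proof.
rewrite integral_region //; last exact: continuous_halfD.
have iA : mu2.-integrable (rect Y) (EFin \o A).
  exact: (@compact_integrable_plane R U _ _ open_U (@compact_rect Y) (@rect_U Y) cA).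
have iB : mu2.-integrable (rect Y) (EFin \o B).
  exact: (@compact_integrable_plane R U _ _ open_U (@compact_rect Y) (@rect_U Y) cB).
transitivity (\int[mu2]_(p in rect Y) (A p + B p)%:E)%E.
  rewrite integral_rect12; last first.
    have cAB p : U p -> {for p, continuous (fun p => A p + B p)}.
      by move=> Up; exact: continuousD (cA Up) (cB Up).
    exact: (@compact_integrable_plane R U _ _ open_U (@compact_rect Y) (@rect_U Y) cAB).
  apply: eq_integral => x _; apply: eq_integral => t _.
  by congr EFin; rewrite /A /B /=; ring.
transitivity (\int[mu2]_(p in rect Y) (A p)%:E + \int[mu2]_(p in rect Y) (B p)%:E)%E.
  apply: integralD_EFin; [exact: measurable_rect|exact: iA|exact: iB].
rewrite (integral_rect21 iA) (integral_rect12 iB); congr (_ + _)%E.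
  apply: eq_integral => t /set_mem; rewrite /= in_itv/= => /andP[t0 _].
  (* [arc] is even, so both sides start at the same height and [A] can be integrated in x at fixed
     t. *)
  rewrite -[in P (- _, _)]arcN.
  apply: (@FTC2_is_derive (fun x => P (x, arc x + t)) (fun x => A (x, t))).
  - lra.
  - move=> x xI; have x1 : `|x| < 1 by rewrite -ler_norml in xI; apply: le_lt_trans xI _; lra.
    have p0 : 0 < arc x + t by rewrite ltr_wpDr // arc_gt0.
    have dx := is_deriveD (is_derive_arc x1) (is_derive_cst t x (1 : R)).
    apply: (is_derive_eq (dP.2 _ _ x _ _ (is_derive_id x (1 : R)) dx p0)).
    by rewrite /A /= mulr1 addr0.
  - move=> x xI; apply: continuous_slice1; apply: cA; apply: (@rect_U t).
    by split; rewrite /= /I /= in_itv/= ?t0 ?lexx.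
apply: eq_integral => x /set_mem; rewrite /I /= in_itv/= => xI.
have x1 : `|x| < 1 by rewrite -ler_norml in xI; apply: le_lt_trans xI _; lra.
have a0 := arc_gt0 x1.
pose F t := Q (x, arc x + t) - slope x * P (x, arc x + t).
(* The upper edge is at y = arc x + Y, strictly above Y because arc x > 0; hence [F Y] is 0. *)
have -> : slope x * P (x, arc x) - Q (x, arc x) = F Y - F 0.
  have PY : P (x, arc x + Y) = 0 by apply: P0; rewrite /= ltrDr.
  have QY : Q (x, arc x + Y) = 0 by apply: Q0; rewrite /= ltrDr.
  by rewrite /F PY QY addr0; ring.
apply: (@FTC2_is_derive F (fun t => B (x, t))) => //.
- move=> t /andP[t0 _]; have p0 : 0 < arc x + t by rewrite ltr_wpDr.
  have dt := is_deriveD (is_derive_cst (arc x) t (1 : R)) (is_derive_id t (1 : R)).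
  have dQ' := dQ.2 _ _ t _ _ (is_derive_cst x t (1 : R)) dt p0.
  have dP' := dP.2 _ _ t _ _ (is_derive_cst x t (1 : R)) dt p0.
  apply: (is_derive_eq (is_deriveB dQ' (is_deriveM (is_derive_cst (slope x) t (1 : R)) dP'))).
  by rewrite /B /GRing.scale /=; ring.
- move=> t tY; apply: continuous_slice2; apply: cB; apply: (@rect_U Y).
  by split; rewrite /= /I /= in_itv/= ?tY.
Qed.

End divergence.

End green.

(** * Unordered sums over the cosets *)

#[local] Existing Instance totally_filter.

Section unordered_sums.
Variables (R : realType) (I : choiceType).
Implicit Types (x y m : I -> R^o) (J : {fset I}).

Lemma partial_sumE x J : partial_sum x J = \sum_(i <- J) x i.
Proof. by rewrite /partial_sum big_seq_fsetE. Qed.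

Lemma sum_cvg x l : partial_sum x @ totally --> l -> sum x = l.
Proof. by move=> xl; apply: cvg_lim => //; exact: norm_hausdorff. Qed.

Lemma sum_finsupp x J : (forall i, i \notin J -> x i = 0) -> sum x = \sum_(i <- J) x i.
Proof.
move=> x0; apply: sum_cvg; apply: cvg_near_cst; exists J => // B /= JB.
by rewrite partial_sumE; apply/esym; apply: big_fset_incl => // i _; exact: x0.
Qed.

Let sum_reindex_sub (s t : I -> I) x : cancel s t -> cancel t s ->
  partial_sum x @ totally `<=` partial_sum (x \o s) @ totally.
Proof.
move=> st ts V [A _ AV].
exists [fset t i | i in A]%fset => // B /= AB.
suff -> : partial_sum (x \o s) B = partial_sum x [fset s i | i in B]%fset.
  apply: AV => /=; apply/fsubsetP => i iA; apply/imfsetP; exists (t i) => //=.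
  by apply: (fsubsetP AB); apply/imfsetP; exists i.
rewrite !partial_sumE; rewrite big_imfset //=.
by move=> i j _ _; exact: can_inj.
Qed.

(** A bijection of the indices carries the filter of partial sums of one family to that of the
    other, so the two limits coincide even without summability. *)
Lemma sum_reindex (s t : I -> I) x : cancel s t -> cancel t s ->
  sum (x \o s) = sum x.
Proof.
move=> st ts; rewrite /sum; congr (lim _); apply/seteqP; split.
  have -> : partial_sum x = partial_sum ((x \o s) \o t).
    by congr partial_sum; apply/funext => i /=; rewrite ts.
  exact: sum_reindex_sub.
exact: (@sum_reindex_sub s t).
Qed.

Section dominated.
Variables (m : I -> R) (M : R).
Hypothesis m0 : forall i, 0 <= m i.
Hypothesis mM : forall J, \sum_(i <- J) m i <= M.

Let sum_fsetD (F : I -> R) J J' : (J `<=` J')%fset ->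
  \sum_(i <- J') F i = \sum_(i <- J) F i + \sum_(i <- (J' `\` J)%fset) F i.
Proof.
move=> JJ'; rewrite (big_fsetID _ (mem J)); congr (_ + _); apply: eq_fbigl => i.
  by rewrite !inE /=; apply/andP/idP => [[]//|iJ]; split => //; exact: (fsubsetP JJ').
by rewrite !inE /= andbC.
Qed.

(** Choose [J0] with sum within e of the supremum of all finite sums; whatever is added later then
    weighs at most e. *)
Lemma dominated_tail e : 0 < e -> exists J0 : {fset I}, forall J J', (J0 `<=` J)%fset ->
  (J `<=` J')%fset -> \sum_(i <- (J' `\` J)%fset) m i <= e.
Proof.
move=> e0; pose S := range (fun J => \sum_(i <- J) m i).
have hS : has_sup S.
  split; first by exists (\sum_(i <- fset0) m i), fset0.
  by exists M => _ [J _ <-].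
have [_ [J0 _ <-] J0S] := sup_adherent e0 hS.
exists J0 => J J' J0J JJ'.
have : \sum_(i <- J') m i <= sup S by apply: ub_le_sup; [exact: hS.2|exists J'].
have : \sum_(i <- J0) m i <= \sum_(i <- J) m i.
  by rewrite (sum_fsetD _ J0J) lerDl sumr_ge0.
rewrite (sum_fsetD _ JJ'); lra.
Qed.

Lemma dominated_sum_cvg x C : (forall i, `|x i| <= C * m i) ->
  partial_sum x @ totally --> (sum x : R^o).
Proof.
move=> xm.
apply/cauchy_cvgP; apply/cauchy_exP => e e0.
have C0 : 0 < `|C| + 1 by rewrite ltr_wpDl.
have [J0 HJ0] := dominated_tail (divr_gt0 (divr_gt0 e0 C0) (ltr0Sn R 1)).
exists (partial_sum x J0), J0 => // J /= J0J.
rewrite /ball /= !partial_sumE (sum_fsetD _ J0J) opprD addrA subrr sub0r normrN.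
apply: le_lt_trans (ler_norm_sum _ _ _) _.
apply: (@le_lt_trans _ _ ((`|C| + 1) * \sum_(i <- (J `\` J0)%fset) m i)).
  rewrite mulr_sumr; apply: ler_sum => i _; apply: le_trans (xm i) _.
  by apply: ler_wpM2r => //; rewrite (le_trans (ler_norm C)) // lerDl.
rewrite mulrC -ltr_pdivlMr //; apply: le_lt_trans (HJ0 _ _ _ J0J) _ => //.
by rewrite ltr_pdivrMr // ltr_pMr ?divr_gt0 // ltr1n.
Qed.

(** [J0] depends only on the majorant m and on e. The convergence is therefore uniform over all
    families dominated by m, in particular over families indexed by a point of the plane. *)
Lemma dominated_sum_le e : 0 < e -> exists J0 : {fset I}, forall J, (J0 `<=` J)%fset ->
  forall x C, 0 <= C -> (forall i, `|x i| <= C * m i) ->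
  `|sum x - \sum_(i <- J) x i| <= C * e.
Proof.
move=> e0; have [J0 HJ0] := dominated_tail e0; exists J0 => J J0J x C C0 xm.
have cx := dominated_sum_cvg xm.
have cd : (fun J' => `|(partial_sum x J' : R) - \sum_(i <- J) x i|) @ totally -->
    `|(sum x : R) - \sum_(i <- J) x i|.
  by apply: cvg_norm; apply: cvgB => //; exact: cvg_cst.
rewrite -(cvg_lim (@norm_hausdorff _ R) cd); apply: limr_le; first exact: cvgP cd.
exists J => // J' /= JJ'.
rewrite partial_sumE (sum_fsetD _ JJ') addrAC subrr add0r.
apply: le_trans (ler_norm_sum _ _ _) _.
apply: (@le_trans _ _ (C * \sum_(i <- (J' `\` J)%fset) m i)).
  by rewrite mulr_sumr; apply: ler_sum => i _; exact: xm.
by apply: ler_wpM2l => //; exact: HJ0.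
Qed.

Lemma dominated_sumD x y C D : (forall i, `|x i| <= C * m i) ->
  (forall i, `|y i| <= D * m i) -> sum (fun i => x i + y i : R^o) = sum x + sum y.
Proof.
move=> xm ym; apply: sum_cvg.
have -> : partial_sum (fun i => x i + y i) = (partial_sum x + partial_sum y :> (_ -> R^o)).
  by apply/funext => J; rewrite fctE !partial_sumE big_split.
exact: (cvgD (dominated_sum_cvg xm) (dominated_sum_cvg ym)).
Qed.

Lemma dominated_sumN x C : (forall i, `|x i| <= C * m i) ->
  sum (fun i => - x i : R^o) = - sum x.
Proof.
move=> xm; apply: sum_cvg.
have -> : partial_sum (fun i => - x i) = (- partial_sum x :> (_ -> R^o)).
  by apply/funext => J; rewrite fctE !partial_sumE sumrN.
exact: (cvgN (dominated_sum_cvg xm)).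
Qed.

End dominated.

End unordered_sums.

(** * Right translation on the cosets *)

Section coset_action.
Implicit Types (g h k : 'M[int]_2) (A B : cosets).

Lemma Gamma_mul g h : Gamma g -> Gamma h -> Gamma (g *m h).
Proof. by rewrite /Gamma /= det_mulmx => -> ->; rewrite mulr1. Qed.

Lemma mulmx_adjG g : Gamma g -> g *m \adj g = 1%:M.
Proof. by move=> gG; rewrite mul_mx_adj gG. Qed.

Lemma adj_mulmxG g : Gamma g -> \adj g *m g = 1%:M.
Proof. by move=> gG; rewrite mul_adj_mx gG. Qed.

Lemma Gamma_adj g : Gamma g -> Gamma (\adj g).
Proof.
move=> gG; have : \det (g *m \adj g) = 1 by rewrite mulmx_adjG // det1.
by rewrite det_mulmx gG mul1r.
Qed.

Lemma mulmx2E (g h : 'M[int]_2) i j : (g *m h) i j = g i 0 * h 0 j + g i 1 * h 1 j.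
Proof. by rewrite mxE !big_ord_recl big_ord0 addr0; congr (g i _ * h _ j + g i _ * h _ j); apply/val_inj. Qed.

Lemma det2E (g : 'M[int]_2) : \det g = g 0 0 * g 1 1 - g 0 1 * g 1 0.
Proof.
rewrite (expand_det_row _ 0) !big_ord_recl big_ord0 /cofactor !det_mx11 !mxE /=.
rewrite addr0 expr0 mul1r expr1 mulN1r mulrN.
by congr (g _ _ * g _ _ - g _ _ * g _ _); apply/val_inj.
Qed.

Lemma Gamma_inf_bottom k : Gamma_inf k -> k 1 1 = 1 \/ k 1 1 = -1.
Proof.
move=> [+ k10]; rewrite /Gamma /= det2E k10 mulr0 subr0 => e.
by have /intUnitRing.unitzPl/orP[] := e => /eqP ->; [left|right].
Qed.

Lemma Gamma_inf_mul g h : Gamma_inf g -> Gamma_inf h -> Gamma_inf (g *m h).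
Proof.
move=> [gG g0] [hG h0]; split; first exact: Gamma_mul.
by rewrite /= mulmx2E g0 h0 mul0r mulr0 addr0.
Qed.

Lemma Gamma_inf_adj g : Gamma_inf g -> Gamma_inf (\adj g).
Proof.
move=> [gG g10]; split; first exact: Gamma_adj.
have := congr1 (fun m : 'M[int]_2 => m 1 0) (adj_mulmxG gG).
have -> : (1%:M : 'M[int]_2) 1 0 = 0 by rewrite mxE.
rewrite /= mulmx2E (g10 : g 1 0 = 0) mulr0 addr0 => /eqP; rewrite mulf_eq0 => /orP[/eqP//|/eqP g00].
by move: gG; rewrite /Gamma /= det2E g00 g10 mul0r mulr0 subr0.
Qed.

Lemma Gamma_inf_translate k g : Gamma_inf k ->
  [set h *m (k *m g) | h in Gamma_inf] = [set h *m g | h in Gamma_inf].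
Proof.
move=> kG; apply/seteqP; split=> _ [h hG <-].
  by exists (h *m k); [exact: Gamma_inf_mul|rewrite mulmxA].
exists (h *m \adj k); first by apply: Gamma_inf_mul => //; exact: Gamma_inf_adj.
by rewrite mulmxA -(mulmxA h) adj_mulmxG ?mulmx1 //; case: kG.
Qed.

Lemma Gamma_inf1 : Gamma_inf 1%:M.
Proof. by split; rewrite /Gamma /= ?det1 // mxE. Qed.

Lemma coset_reprP A : Gamma (coset_repr A) /\
  val A = [set h *m coset_repr A | h in Gamma_inf].
Proof.
rewrite /coset_repr; case: A => A /= /[dup] /set_mem[g gG AE] AP.
have : A (xget 1%:M A).
  apply: xgetPex; exists g; rewrite AE.
  by exists 1%:M; [exact: Gamma_inf1|rewrite mul1mx].
rewrite {1}AE => -[k kG <-]; split; first by apply: Gamma_mul => //; case: kG.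
by rewrite Gamma_inf_translate.
Qed.

(** [coset_repr] is an arbitrary choice, and left multiplication by [Gamma_inf] fixes the bottom row
    only up to sign. The sign is harmless, since Im(g z) is even in that row. *)
Lemma coset_mem A g : val A g -> exists2 e : int, e = 1 \/ e = -1 &
  g 1 0 = e * coset_repr A 1 0 /\ g 1 1 = e * coset_repr A 1 1.
Proof.
have [_ ->] := coset_reprP A; move=> [k kG <-].
exists (k 1 1); first exact: Gamma_inf_bottom.
by case: kG => _ /= k0; rewrite !mulmx2E k0 !mul0r !add0r.
Qed.

(** The lower left entry of a b^-1 involves only the bottom rows of a and b; it is 0 when these
    agree, so a b^-1 lies in [Gamma_inf]. *)
Lemma coset_inj A B : coset_repr A 1 0 = coset_repr B 1 0 ->
  coset_repr A 1 1 = coset_repr B 1 1 -> A = B.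
Proof.
move=> e0 e1; have [aG aE] := coset_reprP A; have [bG bE] := coset_reprP B.
set a := coset_repr A in e0 e1 aG aE; set b := coset_repr B in e0 e1 bG bE.
apply/val_inj; rewrite /= aE bE.
have kG : Gamma_inf (a *m \adj b).
  split; first by apply: Gamma_mul => //; exact: Gamma_adj.
  have := congr1 (fun m : 'M[int]_2 => m 1 0) (mulmx_adjG bG).
  by rewrite /= !mulmx2E e0 e1 => ->; rewrite mxE.
by rewrite -[in RHS](Gamma_inf_translate _ kG) -mulmxA adj_mulmxG // mulmx1.
Qed.

Lemma coset_translate_subproof g A (gG : Gamma g) : [set h *m g | h in val A] \in cosets.
Proof.
have [aG ->] := coset_reprP A; apply/mem_set; exists (coset_repr A *m g).
  exact: Gamma_mul.
apply/seteqP; split => [_ [_ [k kG <-] <-]|_ [k kG <-]].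
  by exists k => //; rewrite mulmxA.
by exists (k *m coset_repr A); [exists k|rewrite mulmxA].
Qed.

Definition coset_translate g (gG : Gamma g) A : cosets :=
  SigSub (coset_translate_subproof A gG).

Lemma coset_translateK g h (gG : Gamma g) (hG : Gamma h) : g *m h = 1%:M ->
  cancel (coset_translate gG) (coset_translate hG).
Proof.
move=> gh A; apply/val_inj => /=; apply/seteqP; split=> [_ [_ [k kA <-] <-]|k kA].
  by rewrite -mulmxA gh mulmx1.
by exists (k *m g); [exists k|rewrite -mulmxA gh mulmx1].
Qed.

Lemma coset_translate_repr g (gG : Gamma g) A : exists2 e : int, e = 1 \/ e = -1 &
  coset_repr (coset_translate gG A) 1 0 = e * (coset_repr A *m g) 1 0 /\
  coset_repr (coset_translate gG A) 1 1 = e * (coset_repr A *m g) 1 1.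
Proof.
have [_ aE] := coset_reprP A.
have : val (coset_translate gG A) (coset_repr A *m g).
  exists (coset_repr A) => //; rewrite aE.
  by exists 1%:M; [exact: Gamma_inf1|rewrite mul1mx].
move=> /coset_mem[e e1 [-> ->]]; exists e => //.
by rewrite !mulrA; case: e1 => ->; rewrite ?mulrNN ?mulr1 ?mul1r.
Qed.

End coset_action.

(** * A summable majorant over the cosets *)

Section summability.
Variable R : realType.

Let w (n : int) : R := (1 + n%:~R ^+ 2)^-1.

Let w0 n : 0 <= w n.
Proof. by rewrite invr_ge0 addr_ge0 // sqr_ge0. Qed.

Lemma ler_sum_uniq (T : eqType) (r s : seq T) (F : T -> R) :
  uniq r -> uniq s -> {subset r <= s} -> (forall i, 0 <= F i) ->
  \sum_(i <- r) F i <= \sum_(i <- s) F i.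
Proof.
move=> ur us rs F0.
have -> : \sum_(i <- r) F i = \sum_(i <- s | i \in r) F i.
  rewrite -[RHS]big_filter; apply: perm_big; apply: uniq_perm => //; first exact: filter_uniq.
  by move=> i; rewrite mem_filter; apply/idP/andP => [ir|[]//]; split => //; exact: rs.
by rewrite [leRHS](bigID (mem r)) /= lerDl; apply: sumr_ge0.
Qed.

Let sum_w N : \sum_(0 <= n < N) w n%:Z <= 3.
Proof.
(* A telescoping strengthening: 1 / (1 + k^2) <= 2 / (k (k + 1)) = 2/k - 2/(k + 1) for k >= 1, with
   equality of both sides of the claim at N = 0. *)
suff h : \sum_(0 <= n < N.+1) w n%:Z <= 3 - 2 / N.+1%:R.
  apply: (@le_trans _ _ (3 - 2 / N.+1%:R)); last by rewrite gerBl divr_ge0.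
  by apply: le_trans h; rewrite big_nat_recr //= lerDl.
elim: N => [|N IH]; first by rewrite big_nat1 /w mulr0z expr0n /= addr0 invr1; lra.
rewrite big_nat_recr //=; apply: le_trans (lerD IH (lexx _)) _.
have e1 : N.+1%:R = N%:R + 1 :> R by rewrite natr1.
have e2 : N.+2%:R = N%:R + 1 + 1 :> R by rewrite !natr1.
rewrite /w -pmulrn e2 e1; move: e1 e2 => _ _.
have : 0 <= N%:R :> R by []; move: (N%:R : R) => x x0.
rewrite -lerBrDl.
have -> : 3 - 2 / (x + 1 + 1) - (3 - 2 / (x + 1)) = 2 / ((x + 1) * (x + 1 + 1)) :> R.
  by field; rewrite !gt_eqF //; lra.
have y0 : 0 < 1 + (x + 1) ^+ 2 by rewrite ltr_wpDr ?sqr_ge0.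
rewrite -[leLHS]mul1r ler_pdivrMr // mulrAC ler_pdivlMr; last by apply: mulr_gt0; lra.
nra.
Qed.

Let range_int N : seq int := map Posz (iota 0 N) ++ map Negz (iota 0 N).

Let uniq_range_int N : uniq (range_int N).
Proof.
rewrite cat_uniq !map_inj_uniq ?iota_uniq /= ?andbT; [|by move=> ? ? []|by move=> ? ? []].
by apply/hasPn => _ /mapP[n _ ->]; apply/negP => /mapP[].
Qed.

Let mem_range_int N (n : int) : (absz n < N)%N -> n \in range_int N.
Proof.
case: n => n nN; rewrite mem_cat; apply/orP; [left|right]; apply: map_f;
  rewrite mem_iota /=; move: nN => /=; lia.
Qed.

Let sum_range_int N : \sum_(n <- range_int N) w n <= 6.
Proof.
rewrite /range_int big_cat !big_map /= (_ : 6 = 3 + 3); last by ring.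
rewrite -[N in iota 0 N]subn0; apply: lerD; first exact: sum_w.
apply: le_trans (sum_w N); apply: ler_sum => n _.
rewrite /w lef_pV2 ?posrE ?ltr_wpDr ?sqr_ge0 // lerD2l NegzE mulrNz sqrrN -!pmulrn.
by rewrite lerXn2r ?nnegrE // ler_nat.
Qed.

Definition coset_c (A : cosets) : R := (coset_repr A 1 0)%:~R.
Definition coset_d (A : cosets) : R := (coset_repr A 1 1)%:~R.
(** A product of a function of c and one of d, so that the sum over all integer pairs factors into
    two one-dimensional sums. *)
Definition coset_w (A : cosets) : R := w (coset_repr A 1 0) * w (coset_repr A 1 1).

Lemma coset_wE A : coset_w A = ((1 + coset_c A ^+ 2) * (1 + coset_d A ^+ 2))^-1.
Proof. by rewrite /coset_w /w invfM. Qed.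

Lemma coset_w_ge0 A : 0 <= coset_w A.
Proof. exact: mulr_ge0. Qed.

(** The bottom row embeds the cosets in the integer pairs, and the double sum over a square of pairs
    is at most 6 * 6. *)
Lemma sum_coset_w (J : {fset cosets}) : \sum_(A <- J) coset_w A <= 36.
Proof.
pose f (A : cosets) := (coset_repr A 1 0, coset_repr A 1 1).
have injf : injective f by move=> A B [] /coset_inj; apply.
pose N := (\max_(A <- J) maxn (absz (f A).1) (absz (f A).2)).+1.
pose W (p : int * int) := w p.1 * w p.2.
have -> : \sum_(A <- J) coset_w A = \sum_(p <- map f J) W p by rewrite big_map.
apply: (@le_trans _ _ (\sum_(p <- [seq (c, d) | c <- range_int N, d <- range_int N]) W p)).
  apply: ler_sum_uniq.
  - by rewrite map_inj_uniq ?fset_uniq.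
  - by apply: allpairs_uniq => // -[a b] [c d] _ _ [-> ->].
  - move=> _ /mapP[A AJ ->]; have := @leq_bigmax_seq _ (enum_fset J) xpredT (fun A => maxn (absz (f A).1) (absz (f A).2)) A AJ isT.
    rewrite geq_max => /andP[h1 h2].
    by apply/allpairsP; exists (f A); split => //; apply: mem_range_int; rewrite ltnS.
  - by move=> p; exact: mulr_ge0.
rewrite big_allpairs /W /=; under eq_bigr do rewrite -mulr_sumr.
rewrite -mulr_suml (_ : 36 = 6 * 6); last by ring.
by apply: ler_pM => //; exact: sumr_ge0.
Qed.

Definition coset_q (A : cosets) : R * R -> R := imq (coset_c A) (coset_d A).

Lemma coset_cd_ge1 A : 1 <= coset_c A ^+ 2 + coset_d A ^+ 2.
Proof.
have [] := coset_reprP A; rewrite /Gamma /= det2E => e _.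
rewrite /coset_c /coset_d !expr2 -!intrM -intrD ler1z -!expr2.
move: e; set a := coset_repr A 0 0; set b := coset_repr A 0 1.
set c := coset_repr A 1 0; set d := coset_repr A 1 1 => e.
have P (z : int) : z != 0 -> 1 <= z ^+ 2 by move=> z0; rewrite -gtz0_ge1 lt_def sqrf_eq0 sqr_ge0 z0.
have [c0|/P c1] := eqVneq c 0; last by rewrite (le_trans c1) // lerDl sqr_ge0.
rewrite c0 expr0n add0r; apply: P; apply/eqP => d0.
by move: e; rewrite c0 d0 !mulr0.
Qed.

Lemma coset_cd_neq0 A : (coset_c A != 0) || (coset_d A != 0).
Proof.
rewrite -negb_and; apply/negP => /andP[/eqP c0 /eqP d0].
by have := coset_cd_ge1 A; rewrite c0 d0 expr0n /= addr0 ler10.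
Qed.

Lemma Im_moebius (A : cosets) p : 0 < p.2 ->
  Im (moebius (coset_repr A) (toC p)) = coset_q A p.
Proof.
move=> p0; have [+ _] := coset_reprP A; rewrite /Gamma /= det2E => e.
have := absj_gt0 (coset_cd_neq0 A) p0.
have {}e : (coset_repr A 0 0)%:~R * coset_d A - (coset_repr A 0 1)%:~R * coset_c A = 1 :> R.
  by rewrite /coset_c /coset_d -!intrM -intrB e.
rewrite /moebius /coset_q /imq /toC /absj.
rewrite -!(rmorph_int (real_complex R)) /= -/(coset_c A) -/(coset_d A).
move: e; set a := _%:~R; set b := _%:~R; set c := coset_c A; set d := coset_d A.
case: p p0 => x y /= y0 e D0.
rewrite !mul0r !addr0 !subr0 ?add0r.
set D := (c * x + d) ^+ 2 + (c * y) ^+ 2 in D0 *.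
(* The imaginary part of (a z + b) / (c z + d), with i standing for |c z + d|^-2; the terms
   containing x' cancel. *)
have key (a' b' c' d' x' y' i : R) : (a' * x' + b') * - (c' * y' * i) + a' * y' * ((c' * x' + d') * i)
  = (a' * d' - b' * c') * y' * i by ring.
by apply: etrans (key a b c d x y D^-1) _; rewrite e mul1r.
Qed.

(** [mxT] acts by z + 1 and [mxS] by -1/z. These match the sides and the two halves of the arc of
    the fundamental domain. *)
Definition mxT : 'M[int]_2 := \matrix_(i, j) (if (i == 1) && (j == 0) then 0 else 1).
Definition mxS : 'M[int]_2 := \matrix_(i, j) (if (i == 0) && (j == 1) then -1 else (i != j)%:R).

Lemma Gamma_T : Gamma mxT.
Proof. by rewrite /Gamma /= det2E !mxE. Qed.

Lemma Gamma_S : Gamma mxS.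
Proof. by rewrite /Gamma /= det2E !mxE. Qed.

Definition coset_T := coset_translate Gamma_T.
Definition coset_T' := coset_translate (Gamma_adj Gamma_T).
Definition coset_S := coset_translate Gamma_S.
Definition coset_S' := coset_translate (Gamma_adj Gamma_S).

Lemma coset_TK : cancel coset_T coset_T'.
Proof. by apply: coset_translateK; rewrite mulmx_adjG //; exact: Gamma_T. Qed.

Lemma coset_TK' : cancel coset_T' coset_T.
Proof. by apply: coset_translateK; rewrite adj_mulmxG //; exact: Gamma_T. Qed.

Lemma coset_SK : cancel coset_S coset_S'.
Proof. by apply: coset_translateK; rewrite mulmx_adjG //; exact: Gamma_S. Qed.

Lemma coset_SK' : cancel coset_S' coset_S.
Proof. by apply: coset_translateK; rewrite adj_mulmxG //; exact: Gamma_S. Qed.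

Lemma coset_q_T A x y : coset_q (coset_T A) (x, y) = coset_q A (x + 1, y).
Proof.
have [e e1 [E0 E1]] := coset_translate_repr Gamma_T A.
rewrite /coset_q /coset_c /coset_d /imq /absj /coset_T E0 E1 !mulmx2E !mxE /=.
rewrite mulr0 !mulr1 addr0 !intrM intrD /=.
by case: e1 => ->; rewrite ?rmorphN ?rmorph1 /=; congr (_ / _); ring.
Qed.

Lemma coset_q_S A x y : 0 < y ->
  coset_q (coset_S A) (x, y) = coset_q A (- x / (x ^+ 2 + y ^+ 2), y / (x ^+ 2 + y ^+ 2)).
Proof.
move=> y0; set r := x ^+ 2 + y ^+ 2.
have r0 : 0 < r by rewrite /r ltr_wpDl ?sqr_ge0 // exprn_gt0.
have y0' : 0 < y / r by exact: divr_gt0.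
have D0 := absj_gt0 (coset_cd_neq0 A) (y0' : 0 < (- x / r, y / r).2).
have [e e1 [E0 E1]] := coset_translate_repr Gamma_S A.
have Ec : coset_c (coset_S A) = e%:~R * coset_d A.
  by rewrite /coset_c /coset_S E0 mulmx2E !mxE /= mulr0 mulr1 add0r intrM.
have Ed : coset_d (coset_S A) = - (e%:~R * coset_c A).
  by rewrite /coset_d /coset_S E1 mulmx2E !mxE /= mulr0 addr0 mulrN1 mulrN mulrNz intrM.
move: D0; rewrite /coset_q /imq /absj /= Ec Ed.
move: (coset_c A) (coset_d A) => c d D0.
have -> : (e%:~R * d * x - e%:~R * c) ^+ 2 + (e%:~R * d * y) ^+ 2 =
  ((c * (- x / r) + d) ^+ 2 + (c * (y / r)) ^+ 2) * r :> R.
  have -> : ((c * (- x / r) + d) ^+ 2 + (c * (y / r)) ^+ 2) * r = (d * x - c) ^+ 2 + (d * y) ^+ 2.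
    by move: r0; rewrite /r => r0; field; rewrite gt_eqF.
  by case: e1 => ->; rewrite ?rmorphN ?rmorph1 /=; ring.
by rewrite invfM -mulrA; congr (_ * _); rewrite mulrC.
Qed.

End summability.

(** * Local finiteness of coset sums *)

Section locally_finite.
Variable R : realType.
Implicit Types (A : cosets) (p : R * R).

(** Let D = |c z + d|^2. From y >= e follows c^2 <= D / e^2, and d = (c x + d) - c x then bounds d^2
    by a multiple of D as well. Since c^2 + d^2 >= 1 for integers not both zero, 1 is also bounded
    by a multiple of D, so that (1 + c^2) (1 + d^2) is at most a constant times D^2. Hence it is the
    square of Im(g z) that [coset_w] dominates. *)
Lemma absjV_bound (X e : R) : 0 < e -> exists2 k : R, 0 < k & forall A p,
  `|p.1| <= X -> e <= p.2 ->
  (absj (coset_c R A) (coset_d R A) p)^-1 <= k /\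
  (absj (coset_c R A) (coset_d R A) p)^-1 ^+ 2 <= k * coset_w R A.
Proof.
move=> e0; pose k := 3 + 2 * (X / e) ^+ 2 + e ^- 2.
have e2 : 0 <= e ^- 2 by rewrite invr_ge0 sqr_ge0.
have Xe2 := sqr_ge0 (X / e).
have k1 : 1 <= k by rewrite /k; lra.
exists (9 * k ^+ 2); first by rewrite mulr_gt0 // exprn_gt0 // (lt_le_trans ltr01).
move=> A p pX pe; have p0 : 0 < p.2 by exact: lt_le_trans pe.
have D0 := absj_gt0 (coset_cd_neq0 R A) p0.
have := coset_cd_ge1 R A; rewrite coset_wE.
set c := coset_c R A in D0 *; set d := coset_d R A in D0 *; set D := absj c d p in D0 * => cd1.
have eD : c ^+ 2 * e ^+ 2 <= D.
  rewrite /D /absj ler_wpDl ?sqr_ge0 // exprMn ler_wpM2l ?sqr_ge0 //.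
  by rewrite lerXn2r // nnegrE ltW.
have cD : c ^+ 2 <= e ^- 2 * D by rewrite mulrC ler_pdivlMr // exprn_gt0.
have xX : p.1 ^+ 2 <= X ^+ 2.
  by rewrite -real_normK ?num_real // lerXn2r ?nnegrE // (le_trans _ pX).
have ck : c ^+ 2 <= k * D.
  by apply: le_trans cD _; rewrite ler_wpM2r ?(ltW D0) // /k; lra.
have mD : (c * p.1 + d) ^+ 2 <= D by rewrite lerDl sqr_ge0.
have dD : d ^+ 2 <= 2 * D + 2 * (c ^+ 2 * X ^+ 2).
  have : c ^+ 2 * p.1 ^+ 2 <= c ^+ 2 * X ^+ 2 by rewrite ler_wpM2l ?sqr_ge0.
  have := sqr_ge0 (c * p.1 + d + c * p.1); nra.
have cX : c ^+ 2 * X ^+ 2 <= (X / e) ^+ 2 * D.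
  have := ler_wpM2l (sqr_ge0 X) cD; rewrite expr_div_n.
  by congr (_ <= _); ring.
have dk : d ^+ 2 <= k * D.
  by rewrite /k; nra.
have kD : 1 <= 2 * k * D by lra.
have c3 : 1 + c ^+ 2 <= 3 * k * D by lra.
have d3 : 1 + d ^+ 2 <= 3 * k * D by lra.
split.
  rewrite -[leLHS]mul1r ler_pdivrMr //; apply: le_trans kD _.
  by rewrite ler_wpM2r ?(ltW D0) //; nra.
have c0 : 0 < 1 + c ^+ 2 by rewrite ltr_wpDr ?sqr_ge0.
have d0 : 0 < 1 + d ^+ 2 by rewrite ltr_wpDr ?sqr_ge0.
rewrite exprVn ler_pdivlMr ?mulr_gt0 // mulrC ler_pdivrMr ?exprn_gt0 //.
have := ler_pM (ltW c0) (ltW d0) c3 d3.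
by congr (_ <= _); ring.
Qed.

(** A single coset outside [J] is already a tail. *)
Lemma coset_w_small (e : R) : 0 < e -> exists J : {fset cosets}, forall A, A \notin J -> coset_w R A <= e.
Proof.
move=> e0.
have [J HJ] := dominated_tail (@coset_w_ge0 R) (@sum_coset_w R) e0.
exists J => A AJ.
have := HJ J (A |` J)%fset (fsubset_refl _) (fsubsetU1 _ _).
suff -> : ((A |` J) `\` J)%fset = [fset A]%fset by rewrite big_seq_fset1.
apply/fsetP => B; rewrite !inE; case: eqP => [->|_] /=; first by rewrite AJ.
by rewrite andNb.
Qed.

(** Near p, Im(g z)^2 is at most a constant times [coset_w], which is small for all but finitely
    many cosets. *)
Lemma coset_locally_finite (a : R) p : 0 < a -> 0 < p.2 -> exists J : {fset cosets},
  \forall q \near p, forall A, A \notin J -> coset_q A q < a.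
Proof.
move=> a0 p0.
have [k k0 Hk] := @absjV_bound (`|p.1| + 1) (p.2 / 2) (divr_gt0 p0 (ltr0Sn _ 1)).
have Y0 : 0 < (2 * p.2) ^+ 2 by rewrite exprn_gt0 // mulr_gt0.
(* Near p one has q^2 <= (2 p.2)^2 k w, and this choice of e makes the right side at most a^2 /
   2. *)
pose e := a ^+ 2 / 2 / ((2 * p.2) ^+ 2 * k).
have e0 : 0 < e by rewrite divr_gt0 // ?mulr_gt0 // divr_gt0 // exprn_gt0.
have [J HJ] := coset_w_small e0; exists J.
pose r := Num.min 1 (p.2 / 2).
have r0 : 0 < r by rewrite lt_min ltr01 divr_gt0.
near=> q => A /HJ wA.
have [/= b1 b2] : ball p r q by near: q; exact: nbhsx_ballx.
have q1 : `|q.1| <= `|p.1| + 1.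
  rewrite -lerBlDl; apply: le_trans (lerB_dist _ _) _; rewrite distrC.
  by apply/ltW; apply: lt_le_trans b1 _; rewrite ge_min lexx.
have : `|p.2 - q.2| < p.2 / 2 by apply: lt_le_trans b2 _; rewrite ge_min lexx orbT.
rewrite ltr_norml => /andP[b3 b4].
have q2 : p.2 / 2 <= q.2 by lra.
have q3 : q.2 <= 2 * p.2 by lra.
have [_ h] := Hk A q q1 q2.
have q0 : 0 < q.2 by apply: lt_le_trans q2; rewrite divr_gt0.
have := imq_gt0 (coset_cd_neq0 R A) q0.
rewrite -/(coset_q A q) => Q0.
rewrite -ltr_sqr ?nnegrE ?(ltW Q0) ?(ltW a0) //.
rewrite /coset_q /imq exprMn.
apply: (@le_lt_trans _ _ ((2 * p.2) ^+ 2 * (k * e))).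
  apply: ler_pM; rewrite ?sqr_ge0 //.
    by rewrite lerXn2r ?nnegrE ?(ltW q0) // mulr_ge0 // ltW.
  by apply: le_trans h _; rewrite ler_wpM2l // ltW.
rewrite mulrA mulrC /e divfK ?gt_eqF ?mulr_gt0 //.
by rewrite ltr_pdivrMr // ltr_pMr ?exprn_gt0 // ltr1n.
Unshelve. all: by end_near.
Qed.

Definition coset_total (F : cosets -> R * R -> R) p : R := sum (fun A => F A p : R^o).

Definition vanish_small (a : R) (F : cosets -> R * R -> R) :=
  forall A p, 0 < p.2 -> coset_q A p < a -> F A p = 0.

(** [J] is chosen before [F], so that a family and the families of its partial derivatives reduce to
    finite sums over the same cosets. *)
Lemma coset_total_fsum (a : R) p : 0 < a -> 0 < p.2 -> exists J : {fset cosets},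
  forall F, vanish_small a F ->
  \forall q \near p, coset_total F q = \sum_(A <- J) F A q.
Proof.
move=> a0 p0; have [J HJ] := coset_locally_finite a0 p0.
exists J => F F0; near=> q.
apply: sum_finsupp => A AJ; apply: F0; first by near: q; exact: near_half.
by move: A AJ; near: q.
Unshelve. all: by end_near.
Qed.

Lemma continuous_coset_total a F : 0 < a -> vanish_small a F ->
  (forall A, continuous_half (F A)) -> continuous_half (coset_total F).
Proof.
move=> a0 F0 cF p p0; have [J /(_ _ F0) HJ] := coset_total_fsum a0 p0.
have cs : continuous_half (fun q => \sum_(A <- J) F A q).
  elim: {HJ} (enum_fset J) => [|B s IH].
    by under [X in continuous_half X]eq_fun do rewrite big_nil; exact: continuous_half_cst.
  by under [X in continuous_half X]eq_fun do rewrite big_cons; exact: continuous_halfD.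
have e := nbhs_singleton HJ.
rewrite /prop_for /continuous_at e; apply: cvg_trans (cs _ p0).
by apply: near_eq_cvg; near do apply/esym; exact: HJ.
Unshelve. all: by end_near.
Qed.

Lemma cdiff_coset_total a F Fx Fy : 0 < a -> vanish_small a F -> vanish_small a Fx ->
  vanish_small a Fy -> (forall A, cdiff (F A) (Fx A) (Fy A)) ->
  cdiff (coset_total F) (coset_total Fx) (coset_total Fy).
Proof.
move=> a0 F0 Fx0 Fy0 dF; apply: cdiff_local => p p0.
have [J HJ] := coset_total_fsum a0 p0.
do 3 eexists; split; first exact: (cdiff_sum J dF).
- exact: HJ.
- exact: (nbhs_singleton (HJ _ Fx0)).
- exact: (nbhs_singleton (HJ _ Fy0)).
Qed.

(** If c = 0 then Im(g z) = y. Otherwise |c z + d|^2 >= y^2, and Im(g z) <= 1/y. So a series built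
    on a function supported in [1/b, b] vanishes above height b. *)
Lemma coset_q_high A (b : R) p : 1 <= b -> b < p.2 -> coset_q A p < b^-1 \/ b < coset_q A p.
Proof.
move=> b1 bp; have b0 : 0 < b by exact: lt_le_trans b1.
have p0 : 0 < p.2 by exact: lt_trans bp.
have [aG _] := coset_reprP A.
have [c0|c0] := eqVneq (coset_repr A 1 0) 0; [right|left].
  have -> // : coset_q A p = p.2.
  rewrite /coset_q /imq /absj /coset_c c0 !mul0r add0r expr0n addr0 /coset_d.
  by have [->|->] := Gamma_inf_bottom (conj aG c0); rewrite ?rmorphN rmorph1 ?sqrrN expr1n divr1.
have c1 : 1 <= coset_c R A ^+ 2.
  rewrite /coset_c expr2 -intrM ler1z -expr2 -gtz0_ge1 lt_def sqr_ge0 andbT.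
  by rewrite sqrf_eq0.
apply: (@le_lt_trans _ _ p.2^-1); last by rewrite ltf_pV2.
rewrite /coset_q /imq ler_pdivrMr ?absj_gt0 ?coset_cd_neq0 //.
rewrite mulrC ler_pdivlMr // -expr2 /absj exprMn.
by rewrite ler_wpDl ?sqr_ge0 // ler_peMl ?sqr_ge0.
Qed.

End locally_finite.

(** * Pseudo-Eisenstein series *)

Section pseudo_eisenstein.
Variable R : realType.
Implicit Types (A : cosets) (p : R * R).

Definition coset_qx A : R * R -> R := imq_x (coset_c R A) (coset_d R A).
Definition coset_qy A : R * R -> R := imq_y (coset_c R A) (coset_d R A).
Definition coset_qxx A : R * R -> R := imq_xx (coset_c R A) (coset_d R A).
Definition coset_qxy A : R * R -> R := imq_xy (coset_c R A) (coset_d R A).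
Definition coset_qyy A : R * R -> R := imq_yy (coset_c R A) (coset_d R A).

Lemma coset_q_gt0 A p : 0 < p.2 -> 0 < coset_q A p.
Proof. by move=> p0; apply: imq_gt0 => //; exact: coset_cd_neq0. Qed.

Lemma C2_coset_q A : C2 (coset_q A) (coset_qx A) (coset_qy A) (coset_qxx A) (coset_qxy A) (coset_qyy A).
Proof. by apply: C2_imq; exact: coset_cd_neq0. Qed.

(* On the unit circle [-1 / z] is the reflection [x |-> - x]; this makes the arc
   terms of Green's formula for the cosets of [g] and [g S] cancel. *)
Lemma inversion_radial (g gx gy k kx ky : R * R -> R) (x y : R) :
  cdiff g gx gy -> cdiff k kx ky ->
  (forall x y, 0 < y -> k (x, y) = g (- x / (x ^+ 2 + y ^+ 2), y / (x ^+ 2 + y ^+ 2))) ->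
  0 < y -> x ^+ 2 + y ^+ 2 = 1 ->
  x * kx (x, y) + y * ky (x, y) = - (- x * gx (- x, y) + y * gy (- x, y)).
Proof.
move=> dg dk kE y0 xy1.
have did := is_derive_id (1 : R) (1 : R).
have dV : is_derive (1 : R) (1 : R) (fun t => t^-1) (-1).
  apply: is_derive_eq (is_deriveV (oner_neq0 R) did) _.
  by rewrite /GRing.scale /= expr1n invr1 mulr1.
have dl (c : R) : is_derive (1 : R) (1 : R) (fun t => c * t) c.
  apply: is_derive_eq (is_deriveM (is_derive_cst c (1 : R) (1 : R)) did) _.
  by rewrite /GRing.scale /= mulr1 mulr0 addr0.
have dr (c : R) : is_derive (1 : R) (1 : R) (fun t => c * t^-1) (- c).
  apply: is_derive_eq (is_deriveM (is_derive_cst c (1 : R) (1 : R)) dV) _.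
  by rewrite /GRing.scale /= invr1 mulr0 addr0 mulrN1.
have y1 : 0 < y * 1 by rewrite mulr1.
have y1' : 0 < y * 1^-1 by rewrite invr1 mulr1.
have d1 := dk.2 _ _ (1 : R) _ _ (dl x) (dl y) y1.
have d2 := dg.2 _ _ (1 : R) _ _ (dr (- x)) (dr y) y1'.
(* On the ray t (x, y) through a point of the unit circle, -1/z runs through (-x, y) / t; the claim
   is the derivative of this identity at t = 1. *)
have e : \forall t \near (1 : R), g (- x * t^-1, y * t^-1) = k (x * t, y * t).
  near=> t; have t0 : 0 < t by near: t; exact: (lt_nbhsr ltr01).
  rewrite kE ?mulr_gt0 // !exprMn -mulrDl xy1 mul1r.
  by congr (g (_, _)); field; rewrite gt_eqF.
have d3 := near_eq_is_derive e d2.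
have := @derive_val _ _ _ _ _ _ _ d1; rewrite (@derive_val _ _ _ _ _ _ _ d3).
rewrite !mulr1 !invr1 !mulr1 => h; rewrite mulrC [y * _]mulrC -h; ring.
Unshelve. all: by end_near.
Qed.

Lemma translation_dx (g gx gy k kx ky : R * R -> R) (x y : R) :
  cdiff g gx gy -> cdiff k kx ky ->
  (forall x y, 0 < y -> k (x, y) = g (x + 1, y)) -> 0 < y -> kx (x, y) = gx (x + 1, y).
Proof.
move=> dg dk kE y0.
have d1 := dk.2 _ _ x _ _ (is_derive_id x (1 : R)) (is_derive_cst y x (1 : R)) y0.
have d2 := dg.2 _ _ x _ _ (is_deriveD (is_derive_id x (1 : R)) (is_derive_cst (1 : R) x (1 : R))) (is_derive_cst y x (1 : R)) y0.
have e : \forall t \near x, g (t + 1, y) = k (t, y) by near=> t; rewrite kE.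
have d3 := near_eq_is_derive e d2.
have := @derive_val _ _ _ _ _ _ _ d1; rewrite (@derive_val _ _ _ _ _ _ _ d3) /=.
by rewrite !mulr0 !addr0 !mulr1.
Unshelve. all: by end_near.
Qed.

Variables (f f1 f2 : R -> R) (b : R).
Hypothesis b1 : 1 <= b.
Hypothesis df : forall y : R, 0 < y -> is_derive y (1 : R) f (f1 y).
Hypothesis df1 : forall y : R, 0 < y -> is_derive y (1 : R) f1 (f2 y).
Hypothesis cf2 : forall y : R, 0 < y -> {for y, continuous f2}.
Hypothesis f0 : forall y, y < b^-1 \/ b < y -> [/\ f y = 0, f1 y = 0 & f2 y = 0].

Let b0 : 0 < b^-1. Proof. by rewrite invr_gt0 (lt_le_trans ltr01). Qed.

Definition pseudo := coset_total (fun A p => f (coset_q A p)).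
Definition pseudo_x := coset_total (fun A p => f1 (coset_q A p) * coset_qx A p).
Definition pseudo_y := coset_total (fun A p => f1 (coset_q A p) * coset_qy A p).
Definition pseudo_xx := coset_total (fun A p =>
  f2 (coset_q A p) * coset_qx A p ^+ 2 + f1 (coset_q A p) * coset_qxx A p).
Definition pseudo_xy := coset_total (fun A p =>
  f2 (coset_q A p) * (coset_qx A p * coset_qy A p) + f1 (coset_q A p) * coset_qxy A p).
Definition pseudo_yy := coset_total (fun A p =>
  f2 (coset_q A p) * coset_qy A p ^+ 2 + f1 (coset_q A p) * coset_qyy A p).

Lemma C2_pseudo : C2 pseudo pseudo_x pseudo_y pseudo_xx pseudo_xy pseudo_yy.
Proof.
have C A := C2_comp df df1 cf2 (@coset_q_gt0 A) (C2_coset_q A).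
split; [| | |split].
- apply: (cdiff_coset_total b0); last (by move=> A; have [h _ _ _] := C A; exact: h);
    by move=> A p p0 qb; have [e0 e1 e2] := f0 (or_introl qb); rewrite ?e0 ?e1 ?e2 ?mul0r ?addr0.
- apply: (cdiff_coset_total b0); last (by move=> A; have [_ h _ _] := C A; exact: h);
    by move=> A p p0 qb; have [e0 e1 e2] := f0 (or_introl qb); rewrite ?e0 ?e1 ?e2 ?mul0r ?addr0.
- apply: (cdiff_coset_total b0); last (by move=> A; have [_ _ h _] := C A; exact: h);
    by move=> A p p0 qb; have [e0 e1 e2] := f0 (or_introl qb); rewrite ?e0 ?e1 ?e2 ?mul0r ?addr0.
- apply: (continuous_coset_total b0); last (by move=> A; have [_ _ _ [h _ _]] := C A; exact: h);
    by move=> A p p0 qb; have [e0 e1 e2] := f0 (or_introl qb); rewrite ?e0 ?e1 ?e2 ?mul0r ?addr0.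
- apply: (continuous_coset_total b0); last (by move=> A; have [_ _ _ [_ h _]] := C A; exact: h);
    by move=> A p p0 qb; have [e0 e1 e2] := f0 (or_introl qb); rewrite ?e0 ?e1 ?e2 ?mul0r ?addr0.
- apply: (continuous_coset_total b0); last (by move=> A; have [_ _ _ [_ _ h]] := C A; exact: h);
    by move=> A p p0 qb; have [e0 e1 e2] := f0 (or_introl qb); rewrite ?e0 ?e1 ?e2 ?mul0r ?addr0.
Qed.

Lemma coset_total0 (F : cosets -> R * R -> R) p : (forall A, F A p = 0) -> coset_total F p = 0.
Proof.
move=> F0; rewrite /coset_total (_ : (fun A => F A p : R^o) = fun=> 0); last exact/funext.
by rewrite (@sum_finsupp _ _ _ fset0) // big_seq_fset0.
Qed.

Lemma pseudo_high p : b < p.2 ->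
  [/\ pseudo p = 0, pseudo_x p = 0, pseudo_y p = 0, pseudo_xx p = 0 & pseudo_yy p = 0].
Proof.
move=> bp; have h A := f0 (coset_q_high A b1 bp).
by split; apply: coset_total0 => A; have [e0 e1 e2] := h A; rewrite ?e0 ?e1 ?e2 ?mul0r ?addr0.
Qed.

Lemma pseudo_T x y : 0 < y -> pseudo (x, y) = pseudo (x + 1, y).
Proof.
move=> y0; rewrite /pseudo /coset_total -[LHS](sum_reindex _ coset_TK coset_TK').
by congr sum; apply/funext => A /=; rewrite coset_q_T.
Qed.

Lemma pseudo_S x y : 0 < y ->
  pseudo (x, y) = pseudo (- x / (x ^+ 2 + y ^+ 2), y / (x ^+ 2 + y ^+ 2)).
Proof.
move=> y0; rewrite /pseudo /coset_total -[LHS](sum_reindex _ coset_SK coset_SK').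
by congr sum; apply/funext => A /=; rewrite coset_q_S.
Qed.

End pseudo_eisenstein.

(** * The eigenvalue identity for real s *)

Section bounded_integrals.
Context d (T : measurableType d) (R : realType) (mu : {measure set T -> \bar R}).

Lemma le_norm_Rintegral_bound (D : set T) (f : T -> R) (M : R) : measurable D ->
  (mu D < +oo)%E -> mu.-integrable D (EFin \o f) -> (forall x, D x -> `|f x| <= M) ->
  `|\int[mu]_(x in D) f x| <= M * fine (mu D).
Proof.
move=> mD muD fi fM; apply: le_trans (le_normr_Rintegral mD fi) _.
rewrite -Rintegral_cst //; apply: le_Rintegral => //.
- exact: (integrable_norm fi).
- apply: measurable_bounded_integrable => //.
  by exists `|M|; split; [exact: num_real|move=> z Mz x _ /=; exact: ltW].
Qed.

End bounded_integrals.

Lemma powR_split (R : realType) (x r : R) (n : nat) : 0 < x -> x `^ r = x `^ (r - n%:R) * x ^+ n.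
Proof.
move=> x0; rewrite -powR_mulrn ?ltW // -powRD ?subrK //.
by rewrite (gt_eqF x0) implybT.
Qed.

(** * The eigenfunctions Im(g z)^s *)

Section power_family.
Variables (R : realType) (s : R).
Hypothesis s2 : 2 <= s.
Local Notation I := (`[(- 2^-1)%R, 2^-1%R]%classic : set R).
Implicit Types (A : cosets) (p : R * R).

Definition cg A p := coset_q A p `^ s.
Definition cgx A p := s * coset_q A p `^ (s - 1) * coset_qx A p.
Definition cgy A p := s * coset_q A p `^ (s - 1) * coset_qy A p.
Definition cgxx A p := s * ((s - 1) * coset_q A p `^ (s - 1 - 1)) * coset_qx A p ^+ 2
  + s * coset_q A p `^ (s - 1) * coset_qxx A p.
Definition cgxy A p := s * ((s - 1) * coset_q A p `^ (s - 1 - 1)) * (coset_qx A p * coset_qy A p)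
  + s * coset_q A p `^ (s - 1) * coset_qxy A p.
Definition cgyy A p := s * ((s - 1) * coset_q A p `^ (s - 1 - 1)) * coset_qy A p ^+ 2
  + s * coset_q A p `^ (s - 1) * coset_qyy A p.

Lemma C2_cg A : C2 (cg A) (cgx A) (cgy A) (cgxx A) (cgxy A) (cgyy A).
Proof.
have dp (r : R) (y : R) : 0 < y -> is_derive y (1 : R) (fun y => s * y `^ r) (s * (r * y `^ (r - 1))).
  move=> y0; apply: is_derive_eq (is_deriveM (is_derive_cst s y (1 : R)) (is_derive1_powR r y0)) _.
  by rewrite /GRing.scale /= mulr0 addr0.
apply: (@C2_comp R (@powR R ^~ s) (fun y => s * y `^ (s - 1)) (fun y => s * ((s - 1) * y `^ (s - 1 - 1)))).
- move=> y y0; have d := dp (s - 1 - 1) y y0.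
  have c := is_derive_continuous (is_deriveM (is_derive_cst (s - 1) y (1 : R)) d).
  have -> : (fun y => s * ((s - 1) * y `^ (s - 1 - 1))) = (cst (s - 1) * (fun y => s * y `^ (s - 1 - 1))).
    by apply/funext => z; rewrite fctE /= mulrCA.
  exact: c.
- exact: coset_q_gt0.
- exact: C2_coset_q.
Qed.

(** With q = Im(g z) harmonic, only s (s - 1) q^(s-2) |grad q|^2 survives, and |grad q| = q / y. *)
Lemma cg_laplace A p : 0 < p.2 -> cgxx A p + cgyy A p = s * (s - 1) / p.2 ^+ 2 * cg A p.
Proof.
move=> p0; have q0 := coset_q_gt0 A p0.
rewrite /cgxx /cgyy /coset_qyy /imq_yy -/(coset_qxx A p) mulrN addrACA subrr addr0 -mulrDr.
rewrite (imq_grad (coset_cd_neq0 R A) p0) -/(coset_q A p) /cg.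
have -> : coset_q A p `^ s = coset_q A p `^ (s - 1 - 1) * coset_q A p ^+ 2.
  by rewrite (powR_split s 2 q0); congr (_ `^ _ * _); ring.
by rewrite expr_div_n; ring.
Qed.

(** q^s = q^(s-2) q^2, where q^(s-2) is bounded on the region since s >= 2, and q^2 is dominated by
    [coset_w]. A derivative costs a factor s / y, which is below 2 s because y > 1/2. *)
Lemma cg_bound (Y : R) : 0 <= Y -> exists2 C : R, 0 < C & forall A p, region Y p ->
  `|cg A p| <= C * coset_w R A /\ `|cgx A p| <= C * coset_w R A /\ `|cgy A p| <= C * coset_w R A.
Proof.
have sp : 0 < s by exact: lt_le_trans s2.
have s2' := s2.
move=> Y0; have [k k0 Hk] := @absjV_bound R 2^-1 2^-1 ltac:(by lra).
pose m := (1 + Y) * k; have m0 : 0 < m by rewrite mulr_gt0 //; lra.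
pose C0 := m `^ (s - 2) * ((1 + Y) ^+ 2 * k).
have C00 : 0 < C0 by rewrite !mulr_gt0 ?powR_gt0 ?exprn_gt0 //; lra.
exists (2 * s * C0); first by rewrite mulr_gt0 // mulr_gt0.
move=> A p Kp; have p2 := region_half Kp.
have p0 : 0 < p.2 by lra.
have [/andP[x1 x2] /andP[y1 y2]] := Kp.
have pY : p.2 <= 1 + Y by apply: le_trans y2 _; rewrite lerD2r arc_le1.
have xb : `|p.1| <= 2^-1 by rewrite ler_norml x1.
have [D1 D2] := Hk A p xb (ltW p2).
have q0 := coset_q_gt0 A p0.
have Dv0 : 0 <= (absj (coset_c R A) (coset_d R A) p)^-1.
  by rewrite invr_ge0 ltW // absj_gt0 // coset_cd_neq0.
have qm : coset_q A p <= m by rewrite /coset_q /imq /m; apply: ler_pM => //; exact: ltW.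
have qs : coset_q A p `^ s <= C0 * coset_w R A.
  have -> : coset_q A p `^ s = coset_q A p `^ (s - 2) * coset_q A p ^+ 2.
    exact: powR_split.
  rewrite /C0 -mulrA; apply: ler_pM; rewrite ?powR_ge0 ?sqr_ge0 //.
    by apply: ge0_ler_powR; rewrite ?nnegrE ?(ltW q0) ?(ltW m0) ?subr_ge0.
  rewrite /coset_q /imq exprMn -mulrA; apply: ler_pM; rewrite ?sqr_ge0 //.
  by rewrite lerXn2r ?nnegrE ?(ltW p0) //; lra.
have g1 : s * coset_q A p `^ (s - 1) * (coset_q A p / p.2) <= 2 * s * C0 * coset_w R A.
  have -> : s * coset_q A p `^ (s - 1) * (coset_q A p / p.2) = s * coset_q A p `^ s / p.2.
    have -> : coset_q A p `^ s = coset_q A p `^ (s - 1) * coset_q A p; last by ring.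
    exact: (powR_split s 1 q0).
  rewrite ler_pdivrMr //; have := powR_ge0 (coset_q A p) s => qs0.
  have : s * coset_q A p `^ s <= s * (C0 * coset_w R A) by apply: ler_wpM2l => //; exact: ltW.
  have : 0 <= C0 * coset_w R A by exact: le_trans qs0 qs.
  set c0 := C0 * _; rewrite (_ : 2 * s * C0 * _ = 2 * s * c0); last by rewrite /c0; ring.
  move=> c00 h; apply: le_trans h _.
  have -> : 2 * s * c0 * p.2 = (s * c0) * (2 * p.2) by ring.
  by apply: ler_peMr; [exact: mulr_ge0 (ltW sp) c00|lra].
have s0 : 0 <= s * coset_q A p `^ (s - 1) by rewrite mulr_ge0 ?powR_ge0 // ltW.
have [gx gy] := imq_grad_le (coset_cd_neq0 R A) p0.
split; [|split].
- rewrite ger0_norm ?powR_ge0 //; apply: le_trans qs _.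
  rewrite ler_wpM2r ?coset_w_ge0 //; nra.
- by apply: le_trans g1; rewrite normrM (ger0_norm s0); apply: ler_wpM2l.
- by apply: le_trans g1; rewrite normrM (ger0_norm s0); apply: ler_wpM2l.
Qed.

Lemma cg_T A x y : cg (coset_T A) (x, y) = cg A (x + 1, y).
Proof. by rewrite /cg coset_q_T. Qed.

Lemma cg_S A x y : 0 < y -> cg (coset_S A) (x, y) = cg A (- x / (x ^+ 2 + y ^+ 2), y / (x ^+ 2 + y ^+ 2)).
Proof. by move=> y0; rewrite /cg coset_q_S. Qed.

End power_family.

(** * Green's formula summed over the cosets *)

Section green_sum.
Variable R : realType.
Local Notation mu := (@lebesgue_measure R).
Local Notation mu2 := ((mu \x mu)%E).
Local Notation I := (`[(- 2^-1)%R, 2^-1%R]%classic : set R).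
Implicit Types (A : cosets) (p : R * R).

Lemma integrable_segment (a c : R) (f : R -> R) :
  (forall x, a <= x <= c -> {for x, continuous f}) ->
  mu.-integrable `[a, c] (EFin \o f).
Proof.
move=> cf; apply: continuous_compact_integrable; first exact: segment_compact.
apply: continuous_in_subspaceT => x /set_mem/=; rewrite in_itv/=; exact: cf.
Qed.

Lemma segment_measure_lty (a c : R) : (mu `[a, c]%classic < +oo)%E.
Proof. by rewrite lebesgue_measure_itv/=; case: ifP => _; rewrite ?ltry // -EFinB ltry. Qed.

Lemma continuous_half_sndV : continuous_half (fun p : R * R => p.2^-1).
Proof.
apply: (@continuous_half_comp _ GRing.inv snd); [|by []|exact: continuous_half_snd].
by move=> y y0; apply: inv_continuous; rewrite gt_eqF.
Qed.

Variables (s : R) (b : R).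
Hypotheses (s2 : 2 <= s) (b1 : 1 <= b).
Variables u ux uy uxx uxy uyy : R * R -> R.
Hypothesis Cu : C2 u ux uy uxx uxy uyy.
Hypothesis u0 : forall p, b < p.2 -> [/\ u p = 0, ux p = 0 & uy p = 0].
Hypothesis uT : forall x y, 0 < y -> u (x, y) = u (x + 1, y).
Hypothesis uS : forall x y, 0 < y ->
  u (x, y) = u (- x / (x ^+ 2 + y ^+ 2), y / (x ^+ 2 + y ^+ 2)).

(** (P, Q) is the field g grad u - u grad g of Green's second identity, for g = [cg s A]. *)
Let P A p := ux p * cg s A p - u p * cgx s A p.
Let Q A p := uy p * cg s A p - u p * cgy s A p.
Let K : set (R * R) := region b.
Let bp : 0 <= b. Proof. exact: le_trans ler01 b1. Qed.

Let du : cdiff u ux uy. Proof. by case: Cu. Qed.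
Let dux : cdiff ux uxx uxy. Proof. by case: Cu. Qed.
Let duy : cdiff uy uxy uyy. Proof. by case: Cu. Qed.
Let cxx : continuous_half uxx. Proof. by case: Cu => _ _ _ []. Qed.
Let cxy : continuous_half uxy. Proof. by case: Cu => _ _ _ []. Qed.
Let cyy : continuous_half uyy. Proof. by case: Cu => _ _ _ []. Qed.
Let dg A : cdiff (cg s A) (cgx s A) (cgy s A). Proof. by have [] := C2_cg s A. Qed.
Let dgx A : cdiff (cgx s A) (cgxx s A) (cgxy s A). Proof. by have [] := C2_cg s A. Qed.
Let dgy A : cdiff (cgy s A) (cgxy s A) (cgyy s A). Proof. by have [] := C2_cg s A. Qed.
Let cgxx' A : continuous_half (cgxx s A). Proof. by have [_ _ _ []] := C2_cg s A. Qed.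
Let cgxy' A : continuous_half (cgxy s A). Proof. by have [_ _ _ []] := C2_cg s A. Qed.
Let cgyy' A : continuous_half (cgyy s A). Proof. by have [_ _ _ []] := C2_cg s A. Qed.

Let Px A p := uxx p * cg s A p - u p * cgxx s A p.
Let Py A p := (uxy p * cg s A p + ux p * cgy s A p) - (uy p * cgx s A p + u p * cgxy s A p).
Let Qx A p := (uxy p * cg s A p + uy p * cgx s A p) - (ux p * cgy s A p + u p * cgxy s A p).
Let Qy A p := uyy p * cg s A p - u p * cgyy s A p.

Let dP A : cdiff (P A) (Px A) (Py A).
Proof.
apply: cdiff_ext (cdiffD (cdiffM dux (dg A)) (cdiffM (cdiff_cst (-1)) (cdiffM du (dgx A)))) _ _ _ => p _.
- by rewrite /P; ring.
- by rewrite /Px; ring.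
- by rewrite /Py; ring.
Qed.

Let dQ A : cdiff (Q A) (Qx A) (Qy A).
Proof.
apply: cdiff_ext (cdiffD (cdiffM duy (dg A)) (cdiffM (cdiff_cst (-1)) (cdiffM du (dgy A)))) _ _ _ => p _.
- by rewrite /Q; ring.
- by rewrite /Qx; ring.
- by rewrite /Qy; ring.
Qed.

Let cPx A : continuous_half (Px A).
Proof. exact: continuous_halfB (continuous_halfM cxx (dg A).1) (continuous_halfM du.1 (@cgxx' A)). Qed.

Let cPy A : continuous_half (Py A).
Proof.
exact: continuous_halfB
  (continuous_halfD (continuous_halfM cxy (dg A).1) (continuous_halfM dux.1 (dgy A).1))
  (continuous_halfD (continuous_halfM duy.1 (dgx A).1) (continuous_halfM du.1 (@cgxy' A))).
Qed.

Let cQy A : continuous_half (Qy A).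
Proof. exact: continuous_halfB (continuous_halfM cyy (dg A).1) (continuous_halfM du.1 (@cgyy' A)). Qed.

Let P0 A p : b < p.2 -> P A p = 0.
Proof. by move=> /u0[e0 e1 e2]; rewrite /P e0 e1 !mul0r subrr. Qed.

Let Q0 A p : b < p.2 -> Q A p = 0.
Proof. by move=> /u0[e0 e1 e2]; rewrite /Q e0 e2 !mul0r subrr. Qed.

Let side_pt (x t : R) : `|x| = 2^-1 -> 0 <= t <= b -> region b (x, arc 2^-1 + t).
Proof.
move=> x2 /andP[t0 tb]; have ax : arc x = arc 2^-1 by rewrite /arc -real_normK ?num_real // x2.
split => /=; first by rewrite -ler_norml x2.
by rewrite ax lerDl t0 lerD2l.
Qed.

Let arc_pt (x : R) : -2^-1 <= x <= 2^-1 -> region b (x, arc x).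
Proof. by move=> xI; split => //=; rewrite lexx lerDl. Qed.

(* The sides of the domain give a telescoping sum over the cosets, since the right
   side for [A] is the left side for [A T]; the arc terms cancel in pairs [A], [A S]. *)
Let side A := \int[mu]_(t in `[0, b]) P A (- 2^-1, arc 2^-1 + t).
Let flux A x := - x / arc x * P A (x, arc x) - Q A (x, arc x).
Let arcint A := \int[mu]_(x in I) flux A x.

Let P_half A y : 0 < y -> P A (2^-1, y) = P (coset_T A) (- 2^-1, y).
Proof.
move=> y0; have e : - 2^-1 + 1 = 2^-1 :> R by lra.
rewrite /P cg_T e.
have -> : cgx s (coset_T A) (- 2^-1, y) = cgx s A (2^-1, y).
  by rewrite -[in RHS]e; apply: translation_dx (dg A) (dg (coset_T A)) _ y0 => x z _; exact: cg_T.
have -> : ux (- 2^-1, y) = ux (2^-1, y).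
  by rewrite -[in RHS]e; apply: translation_dx du du uT y0.
by rewrite (uT (- 2^-1) y0) e.
Qed.

Let continuous_side A (x t : R) : `|x| = 2^-1 -> 0 <= t <= b ->
  {for t, continuous (fun t => P A (x, arc 2^-1 + t))}.
Proof.
move=> x2 tb; have ct : {for t, continuous (fun t => arc 2^-1 + t)}.
  exact: is_derive_continuous (is_deriveD (is_derive_cst (arc 2^-1) t (1 : R)) (is_derive_id t (1 : R))).
apply: (@continuous_half_pair _ _ (P A) (fun=> x) _ t (dP A).1); [exact: cvg_cst|exact: ct|].
by have := region_half (side_pt x2 tb); apply: lt_trans; lra.
Qed.

Let continuous_flux A (x : R) : -2^-1 <= x <= 2^-1 -> {for x, continuous (flux A)}.
Proof.
move=> xI; have a2 := half_arc_gt0 xI; have a0 : 0 < arc x by apply: lt_trans a2; lra.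
have ca := @continuous_arc R x.
have cid : {for x, continuous (@id R)} by exact: cvg_id.
have cP : {for x, continuous (fun x => P A (x, arc x))}.
  exact: (@continuous_half_pair _ _ (P A) id (@arc R) x (dP A).1 cid ca a0).
have cQ : {for x, continuous (fun x => Q A (x, arc x))}.
  exact: (@continuous_half_pair _ _ (Q A) id (@arc R) x (dQ A).1 cid ca a0).
have cV : {for x, continuous (fun x => (arc x)^-1)} by apply: continuousV => //; rewrite gt_eqF.
exact: continuousB (continuousM (continuousM (continuousN cid) cV) cP) cQ.
Qed.

(** This is y^-2 (Delta u + lambda_s u): the factor y^-2 is the density of the hyperbolic
    measure. *)
Definition hyp_defect p := uxx p + uyy p - s * (s - 1) / p.2 ^+ 2 * u p.

(** As [cg s A] is an eigenfunction, the divergence of (P, Q) is [hyp_defect] times [cg s A]. The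
    right side of the domain is carried to the left one by z + 1, which replaces A by
    [coset_T A]. *)
Let green A : \int[mu2]_(p in K) (hyp_defect p * cg s A p) = side (coset_T A) - side A + arcint A.
Proof.
have n1 : `|- 2^-1| = 2^-1 :> R by rewrite normrN ger0_norm.
have n2 : `|2^-1| = 2^-1 :> R by rewrite ger0_norm.
transitivity (\int[mu2]_(p in K) (Px A p + Qy A p)).
  apply: eq_Rintegral => p /set_mem /region_half p2; have p0 : 0 < p.2 by apply: lt_trans p2; lra.
  rewrite /hyp_defect /Px /Qy -[RHS]/(uxx p * cg s A p - u p * cgxx s A p + (uyy p * cg s A p - u p * cgyy s A p)).
  have -> : uxx p * cg s A p - u p * cgxx s A p + (uyy p * cg s A p - u p * cgyy s A p) =
    (uxx p + uyy p) * cg s A p - u p * (cgxx s A p + cgyy s A p) by ring.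
  by rewrite cg_laplace //; ring.
rewrite /Rintegral (divergence_region (dP A) (dQ A) (@cPx A) (@cPy A) (@cQy A) bp (@P0 A) (@Q0 A)).
have i1 : mu.-integrable `[0, b] (EFin \o (fun t => P A (2^-1, arc 2^-1 + t))).
  by apply: integrable_segment => t tb; exact: continuous_side.
have i2 : mu.-integrable `[0, b] (EFin \o (fun t => P A (- 2^-1, arc 2^-1 + t))).
  by apply: integrable_segment => t tb; exact: continuous_side.
have i3 : mu.-integrable I (EFin \o flux A).
  by apply: integrable_segment => x xI; exact: continuous_flux.
have i12 : mu.-integrable `[0, b] (EFin \o (fun t => P A (2^-1, arc 2^-1 + t) - P A (- 2^-1, arc 2^-1 + t))).
  apply: integrable_segment => t tb.
  exact: continuousB (@continuous_side A _ t n2 tb) (@continuous_side A _ t n1 tb).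
rewrite fineD; [|by apply: integrable_fin_num i12|by apply: integrable_fin_num i3].
congr (_ + _); rewrite -/(Rintegral _ _ _) RintegralB //; congr (_ - _).
apply: eq_Rintegral => t /set_mem/=; rewrite in_itv/= => tb; apply: P_half.
by have := region_half (side_pt n2 tb); apply: lt_trans; lra.
Qed.

(** The arc lies on the unit circle, so its normal is radial and the flux is -(x P + y Q) / y. Only
    radial derivatives enter, and these transform simply under -1/z. *)
Let flux_radial A x : -2^-1 <= x <= 2^-1 ->
  flux A x = - (arc x)^-1 * ((x * ux (x, arc x) + arc x * uy (x, arc x)) * cg s A (x, arc x)
    - u (x, arc x) * (x * cgx s A (x, arc x) + arc x * cgy s A (x, arc x))).
Proof.
move=> xI; have a0 : arc x != 0 by rewrite gt_eqF //; apply: lt_trans (half_arc_gt0 xI); lra.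
by rewrite /flux /P /Q; field.
Qed.

Let flux_S A x : -2^-1 <= x <= 2^-1 -> flux (coset_S A) x = - flux A (- x).
Proof.
move=> xI; have xI' : -2^-1 <= - x <= 2^-1 by rewrite lerNl opprK lerNl andbC.
have a0 : 0 < arc x by apply: lt_trans (half_arc_gt0 xI); lra.
have x1 : x ^+ 2 + arc x ^+ 2 = 1.
  by apply: arc_sqr; rewrite -ler_norml in xI; apply: le_trans xI _; lra.
rewrite (flux_radial _ xI) (flux_radial _ xI') arcN.
rewrite (inversion_radial du du uS a0 x1).
rewrite (inversion_radial (dg A) (dg (coset_S A)) (@cg_S R s A) a0 x1).
by rewrite uS // cg_S // x1 !divr1; ring.
Qed.

Let arcint_S A : arcint (coset_S A) = - arcint A.
Proof.
have c A' : {within `[(- 2^-1)%R, 2^-1%R], continuous flux A'}.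
  apply: continuous_in_subspaceT => x /set_mem/=; rewrite in_itv/=; exact: continuous_flux.
have i3 A' : mu.-integrable I (EFin \o flux A').
  by apply: integrable_segment => x xI; exact: continuous_flux.
transitivity (\int[mu]_(x in I) (-1 * flux A (- x))).
  apply: eq_Rintegral => x /set_mem/=; rewrite in_itv/= => xI.
  by rewrite flux_S // mulN1r.
have e : (\int[mu]_(x in I) (flux A (- x))%:E = \int[mu]_(x in I) (flux A x)%:E)%E.
  apply/esym; rewrite -[in LHS](opprK (2^-1 : R)).
  have := @integration_by_substitution_oppr R (flux A) (- 2^-1) 2^-1.
  rewrite opprK; apply; [lra|exact: c].
rewrite RintegralZl //; last first.
  apply: integrable_segment => x xI.
  have xI' : -2^-1 <= - x <= 2^-1 by rewrite lerNl opprK lerNl andbC.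
  have cN : {for x, continuous (fun x : R => - x)}.
    exact: is_derive_continuous (is_deriveN (is_derive_id x (1 : R))).
  exact: (@continuous_comp _ _ _ (fun x : R => - x) (flux A) x cN (@continuous_flux A _ xI')).
by rewrite mulN1r /arcint /Rintegral e.
Qed.

Let KU : K `<=` [set p | 0 < p.2].
Proof. by move=> p /region_half; apply: lt_trans; lra. Qed.

Let continuous_defect : continuous_half hyp_defect.
Proof.
have cV := continuous_half_sndV.
have := continuous_halfB (continuous_halfD cxx cyy)
  (continuous_halfM (continuous_halfM (@continuous_half_cst R (s * (s - 1))) (continuous_halfM cV cV)) du.1).
congr continuous_half; apply/funext => p.
by rewrite /hyp_defect -expr2 exprVn.
Qed.

(** Everything summed over the cosets is O([coset_w A]). This justifies both the exchange of sum and
    integral and the splitting and reindexing of the resulting sums. *)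
Let bounds : exists2 C : R, 0 < C & (forall p, K p -> `|hyp_defect p| <= C) /\ forall A,
  [/\ `|side A| <= C * coset_w R A, `|arcint A| <= C * coset_w R A &
      forall p, K p -> `|cg s A p| <= C * coset_w R A].
Proof.
have [C C0 HC] := cg_bound s2 bp.
have [B1 B10 HB1] := compact_bounded_plane (@compact_region R b) KU du.1.
have [B2 B20 HB2] := compact_bounded_plane (@compact_region R b) KU dux.1.
have [B3 B30 HB3] := compact_bounded_plane (@compact_region R b) KU duy.1.
have [B4 B40 HB4] := compact_bounded_plane (@compact_region R b) KU continuous_defect.
pose D := (B1 + B2 + B3) * C.
have D0 : 0 < D by rewrite mulr_gt0 //; lra.
have w0 A := coset_w_ge0 R A.
have H (v v' g g' V V' G : R) : `|v| <= V -> `|v'| <= V' -> `|g| <= G -> `|g'| <= G ->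
    `|v * g - v' * g'| <= (V + V') * G.
  move=> h1 h2 h3 h4; apply: le_trans (ler_normB _ _) _; rewrite !normrM mulrDl.
  by apply: lerD; apply: ler_pM.
have PB A p : K p -> `|P A p| <= D * coset_w R A /\ `|Q A p| <= D * coset_w R A.
  move=> Kp; have [h1 [h2 h3]] := HC A p Kp.
  have q0 : 0 <= C * coset_w R A by exact: mulr_ge0 (ltW C0) (w0 A).
  split.
    apply: le_trans (H _ _ _ _ _ _ _ (HB2 p Kp) (HB1 p Kp) h1 h2) _.
    by rewrite /D -mulrA ler_wpM2r //; lra.
  apply: le_trans (H _ _ _ _ _ _ _ (HB3 p Kp) (HB1 p Kp) h1 h3) _.
  by rewrite /D -mulrA ler_wpM2r //; lra.
have n1 : `|- 2^-1| = 2^-1 :> R by rewrite normrN ger0_norm.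
pose m1 := fine (mu `[0, b]%classic); pose m2 := fine (mu I).
have m10 : 0 <= m1 by rewrite fine_ge0.
have m20 : 0 <= m2 by rewrite fine_ge0.
have E0 : 0 <= D * m1 by exact: mulr_ge0 (ltW D0) m10.
have E1 : 0 <= 2 * D * m2 by apply: mulr_ge0 m20; lra.
exists (D * m1 + 2 * D * m2 + C + B4); first by lra.
split=> [p Kp|A]; first by apply: le_trans (HB4 p Kp) _; lra.
split.
- apply: (@le_trans _ _ (D * coset_w R A * m1)).
    apply: le_norm_Rintegral_bound => //; first exact: segment_measure_lty.
      by apply: integrable_segment => t tb; exact: continuous_side.
    by move=> t; rewrite /= in_itv/= => tb; have [] := PB A _ (side_pt n1 tb).
  by rewrite mulrAC ler_wpM2r //; lra.
- apply: (@le_trans _ _ (2 * D * coset_w R A * m2)).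
    apply: le_norm_Rintegral_bound => //; first exact: segment_measure_lty.
      by apply: integrable_segment => x xI; exact: continuous_flux.
    move=> x; rewrite /= in_itv/= => xI; have [h1 h2] := PB A _ (arc_pt xI).
    have a2 := half_arc_gt0 xI; have a0 : 0 < arc x by apply: lt_trans a2; lra.
    apply: le_trans (ler_normB _ _) _; rewrite normrM.
    have -> : 2 * D * coset_w R A = 1 * (D * coset_w R A) + D * coset_w R A by ring.
    apply: lerD => //; apply: ler_pM => //.
    rewrite normrM normrN normfV (gtr0_norm a0) ler_pdivrMr // mul1r.
    by rewrite -ler_norml in xI; apply: le_trans xI _; exact: ltW.
  by rewrite mulrAC ler_wpM2r //; lra.
- move=> p Kp; have [h1 _] := HC A p Kp; apply: le_trans h1 _; rewrite ler_wpM2r //; lra.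
Qed.

Variable Es : R * R -> R.
Hypothesis mEs : measurable_fun K Es.
Hypothesis EsE : forall p, K p -> Es p = sum (fun A => cg s A p : R^o).

Let integrable_cg A : mu2.-integrable K (EFin \o (fun p => hyp_defect p * cg s A p)).
Proof. by apply: integrable_region; apply: continuous_halfM (dg A).1; exact: continuous_defect. Qed.

Let integral_sum_cg (r : seq cosets) :
  mu2.-integrable K (EFin \o (fun p => hyp_defect p * \sum_(A <- r) cg s A p)) /\
  \int[mu2]_(p in K) (hyp_defect p * \sum_(A <- r) cg s A p) =
  \sum_(A <- r) \int[mu2]_(p in K) (hyp_defect p * cg s A p).
Proof.
have mK : measurable K by exact: measurable_region.
have ir r' : mu2.-integrable K (EFin \o (fun p => hyp_defect p * \sum_(A <- r') cg s A p)).
  by apply: integrable_region; apply: continuous_halfM (cdiff_sum r' dg).1; exact: continuous_defect.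
split; first exact: ir.
elim: r => [|A r IH].
  rewrite big_nil; under eq_Rintegral do rewrite big_nil mulr0.
  by rewrite Rintegral_cst // mul0r.
rewrite big_cons -IH; under eq_Rintegral do rewrite big_cons mulrDr.
by apply: RintegralD => //; exact: ir.
Qed.

(** After the exchange of sum and integral the side terms cancel by reindexing along [coset_T], and
    reindexing along [coset_S] shows that the arc terms sum to their own negative. *)
Theorem green_eisenstein : \int[mu2]_(p in K) (hyp_defect p * Es p) = 0.
Proof.
have [C C0 [HD HC]] := bounds.
pose a A : R^o := \int[mu2]_(p in K) (hyp_defect p * cg s A p).
have mK : measurable K by exact: measurable_region.
have muK : (mu2 K < +oo)%E by apply: compact_measure_plane; exact: compact_region.
pose M := fine (mu2 K).
have M0 : 0 <= M by rewrite fine_ge0.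
have w0 := @coset_w_ge0 R; have wM := @sum_coset_w R.
have aw A : `|a A| <= (C * C * M) * coset_w R A.
  rewrite mulrAC; apply: le_norm_Rintegral_bound; [exact: mK|exact: muK|exact: integrable_cg|].
  move=> p Kp; have [_ _ h2] := HC A.
  by rewrite normrM -mulrA; apply: ler_pM => //; [exact: HD|exact: h2].
have EsA : \int[mu2]_(p in K) (hyp_defect p * Es p) = sum a.
  apply/eqP; rewrite -subr_eq0 -normr_le0; apply/ler_addgt0Pl => e e0; rewrite addr0.
  have CM0 : 0 <= C * C * M by rewrite !mulr_ge0 // ltW.
  have L0 : 0 < 2 * (C * C * M) + 1 by rewrite ltr_wpDl // mulr_ge0.
  have e'0 : 0 < e / (2 * (C * C * M) + 1) by exact: divr_gt0.
  move: e'0; set e' := e / _ => e'0.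
  (* One [J] serves the series at every point of the region and also the series of integrals [a],
     since all of them are dominated by multiples of [coset_w]. *)
  have [J HJ] := dominated_sum_le w0 wM e'0.
  have h1 := HJ J (fsubset_refl _) a _ CM0 aw.
  have [iJ eJ] := integral_sum_cg J.
  pose Er p := Es p - \sum_(A <- J) cg s A p.
  have ErB p : K p -> `|hyp_defect p * Er p| <= C * (C * e').
    move=> Kp; rewrite normrM; apply: ler_pM => //; first exact: HD.
    rewrite /Er EsE //; apply: HJ => //; first exact: ltW.
    by move=> A; have [_ _] := HC A; apply.
  have iEr : mu2.-integrable K (EFin \o (fun p => hyp_defect p * Er p)).
    apply: measurable_bounded_integrable; [exact: mK|exact: muK| |].
      apply: measurable_funM.
        exact: continuous_measurable_plane (@open_half R) mK KU continuous_defect.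
      apply: measurable_funB; first exact: mEs.
      exact: continuous_measurable_plane (@open_half R) mK KU (cdiff_sum J dg).1.
    exists (C * (C * e')); split; first exact: num_real.
    by move=> z ltz p Kp; apply: le_trans (ErB p Kp) _; exact: ltW.
  have -> : \int[mu2]_(p in K) (hyp_defect p * Es p) =
      \int[mu2]_(p in K) (hyp_defect p * Er p) + \sum_(A <- J) a A.
    rewrite -eJ -RintegralD; [|exact: mK|exact: iEr|exact: iJ].
    by apply: eq_Rintegral => p _; rewrite /Er -mulrDr subrK.
  have h2 : `|\int[mu2]_(p in K) (hyp_defect p * Er p)| <= C * (C * e') * M.
    by apply: le_norm_Rintegral_bound; [exact: mK|exact: muK|exact: iEr|exact: ErB].
  rewrite -addrA -[X in _ + X]opprB; apply: le_trans (ler_normB _ _) _.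
  apply: le_trans (lerD h2 h1) _.
  have -> : C * (C * e') * M + C * C * M * e' = 2 * (C * C * M) * e' by ring.
  by rewrite -[leRHS](divfK (lt0r_neq0 L0)) -/e' [leLHS]mulrC ler_pM2l // lerDl.
rewrite EsA.
(* A common majorant for [side A] and [side (coset_T A)]; the translate of [coset_w] has the same
   bound 36, whence 72. *)
pose m A := coset_w R A + coset_w R (coset_T A).
have m0 A : 0 <= m A by exact: addr_ge0.
have mM (J : {fset cosets}) : \sum_(A <- J) m A <= 72.
  rewrite big_split /= (_ : 72 = 36 + 36); last by ring.
  apply: lerD; first exact: wM.
  have <- : \sum_(A <- [fset coset_T A | A in J]%fset) coset_w R A =
      \sum_(A <- J) coset_w R (coset_T A).
    by rewrite big_imfset //= => A B _ _; exact: (can_inj coset_TK).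
  exact: wM.
have le1 A : C * coset_w R A <= C * m A by rewrite ler_wpM2l ?(ltW C0) // lerDl.
have le2 A : C * coset_w R (coset_T A) <= C * m A by rewrite ler_wpM2l ?(ltW C0) // lerDr.
have b1' A : `|side A| <= C * m A by have [h _ _] := HC A; exact: le_trans (le1 A).
have b2' A : `|side (coset_T A)| <= C * m A by have [h _ _] := HC (coset_T A); exact: le_trans (le2 A).
have b3' A : `|arcint A| <= C * m A by have [_ h _] := HC A; exact: le_trans (le1 A).
have b1N A : `|- side A| <= C * m A by rewrite normrN.
have b12 A : `|side (coset_T A) - side A| <= (C + C) * m A.
  by apply: le_trans (ler_normB _ _) _; rewrite mulrDl lerD.
have -> : a = (fun A => (side (coset_T A) - side A) + arcint A : R^o).
  by apply/funext => A; exact: green.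
rewrite (dominated_sumD m0 mM b12 b3') (dominated_sumD m0 mM b2' b1N) (dominated_sumN m0 mM b1').
have -> : sum (fun A => side (coset_T A) : R^o) = sum (side : _ -> R^o).
  exact: (sum_reindex (side : _ -> R^o) coset_TK coset_TK').
rewrite subrr add0r.
have : sum (fun A => arcint (coset_S A) : R^o) = - sum (arcint : _ -> R^o).
  rewrite -(dominated_sumN m0 mM b3'); congr sum; apply/funext => A; exact: arcint_S.
have -> : sum (fun A => arcint (coset_S A) : R^o) = sum (arcint : _ -> R^o).
  exact: (sum_reindex (arcint : _ -> R^o) coset_SK coset_SK').
move=> h; have : sum (arcint : _ -> R^o) *+ 2 = 0 by rewrite mulr2n {2}h subrr.
by move/eqP; rewrite mulrn_eq0 /= => /eqP.
Qed.

End green_sum.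

(** * From test functions to invariant functions of class C2 *)

Section test_functions.
Variable R : realType.
Local Notation C := (R[i]).

Lemma laplace_C2 (g u ux uy uxx uxy uyy : R * R -> R) p :
  C2 u ux uy uxx uxy uyy -> (forall q, 0 < q.2 -> g q = u q) -> 0 < p.2 ->
  laplace g p = p.2 ^+ 2 * (uxx p + uyy p).
Proof.
case: p => x y /= [du dux duy _] gu y0; rewrite /laplace /=; congr (_ * (_ + _)).
  have -> : (fun x => g (x, y)) = (fun x => u (x, y)) by apply/funext => z; rewrite gu.
  have e (h hx hy : R * R -> R) z : cdiff h hx hy -> (fun x => h (x, y))^`()%classic z = hx (z, y).
    move=> dh; rewrite derive1E.
    have d := dh.2 _ _ z _ _ (is_derive_id z (1 : R)) (is_derive_cst y z (1 : R)) y0.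
    by rewrite (@derive_val _ _ _ _ _ _ _ d) mulr1 mulr0 addr0.
  have -> : (fun x => u (x, y))^`()%classic = (fun x => ux (x, y)) by apply/funext => z; exact: e du.
  exact: e dux.
have e (h hx hy : R * R -> R) z : 0 < z -> cdiff h hx hy -> (fun y => h (x, y))^`()%classic z = hy (x, z).
  move=> z0 dh; rewrite derive1E.
  have d := dh.2 _ _ z _ _ (is_derive_cst x z (1 : R)) (is_derive_id z (1 : R)) z0.
  by rewrite (@derive_val _ _ _ _ _ _ _ d) mulr1 mulr0 add0r.
(* In the vertical direction g and u agree only for positive ordinates, so each derivative is
   compared on a neighbourhood; horizontally they agree on the whole line. *)
rewrite -(e _ _ _ _ y0 duy) !derive1E; apply: near_eq_derive.
near=> z; have z0 : 0 < z by near: z; exact: lt_nbhsr y0.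
rewrite -(e _ _ _ _ z0 du) !derive1E; apply: near_eq_derive.
near=> t; apply: gu => /=; near: t; exact: lt_nbhsr z0.
Unshelve. all: by end_near.
Qed.

(** Invariance is recorded for z + 1 and -1/z only: these are the side and arc identifications that
    Green's formula needs. *)
Definition automorphic (b : R) (g : R * R -> R) (ux uy uxx uxy uyy : R * R -> R) : Prop :=
  [/\ C2 g ux uy uxx uxy uyy,
      forall p, b < p.2 -> [/\ g p = 0, ux p = 0, uy p = 0, uxx p = 0 & uyy p = 0],
      forall x y, 0 < y -> g (x, y) = g (x + 1, y) &
      forall x y, 0 < y -> g (x, y) = g (- x / (x ^+ 2 + y ^+ 2), y / (x ^+ 2 + y ^+ 2))].

Lemma derive1_locally0 (f : R -> R) y : (\forall z \near y, f z = 0) -> f^`()%classic y = 0.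
Proof.
move=> f0; rewrite derive1E.
have d := @near_eq_is_derive _ _ _ (fun=> 0) f y 1 0 _ (is_derive_cst (0 : R) y (1 : R)).
have {}d := d _; apply: derive_val; apply: d.
by near=> z; apply/esym; near: z.
Unshelve. all: by end_near.
Qed.

Lemma smooth_automorphic (f : R -> R) (a b : R) : smooth f -> 0 < a ->
  (forall y, y < a \/ b < y -> f y = 0) ->
  forall B, 1 <= B -> a^-1 <= B -> b <= B ->
  exists ux uy uxx uxy uyy, automorphic B (coset_total (fun A p => f (coset_q A p))) ux uy uxx uxy uyy.
Proof.
move=> sf a0 f0 B B1 aB bB.
have B0 : 0 < B by exact: lt_le_trans B1.
have df n y : is_derive y (1 : R) (derive1n n f) (derive1n n.+1 f y).
  by rewrite derive1nS derive1E; apply/derivableP; exact: sf.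
have BaF : B^-1 <= a by rewrite invf_ple ?posrE.
have z0 (n : nat) y : y < B^-1 \/ B < y -> derive1n n f y = 0.
  elim: n y => [|n IH] y yB.
    rewrite derive1n0; apply: f0; case: yB => h; [left|right].
      exact: lt_le_trans BaF.
    exact: le_lt_trans h.
  rewrite derive1nS; apply: derive1_locally0; case: yB => h.
    by near=> z; apply: IH; left; near: z; exact: lt_nbhsl.
  by near=> z; apply: IH; right; near: z; exact: lt_nbhsr.
have f0' y : y < B^-1 \/ B < y -> [/\ f y = 0, derive1n 1 f y = 0 & derive1n 2 f y = 0].
  by move=> h; split; [exact: (z0 0%N)|exact: z0|exact: z0].
have df0 (y : R) : 0 < y -> is_derive y (1 : R) f (derive1n 1 f y) by move=> _; exact: (df 0%N).
have df1 (y : R) : 0 < y -> is_derive y (1 : R) (derive1n 1 f) (derive1n 2 f y) by move=> _; exact: df.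
have cf2 (y : R) : 0 < y -> {for y, continuous (derive1n 2 f)}.
  by move=> _; exact: is_derive_continuous (df 2%N y).
have Cp := C2_pseudo B1 df0 df1 cf2 f0'.
do 5 eexists; split; first exact: Cp.
- by move=> p Bp; exact: pseudo_high B1 f0' _ Bp.
- by move=> x y y0; exact: pseudo_T.
- by move=> x y y0; exact: pseudo_S.
Unshelve. all: by end_near.
Qed.

Lemma pseudo_eisenstein_data (f : R * R -> C) : pseudo_eisenstein f ->
  exists2 b : R, 1 <= b & exists u v : R * R -> R,
  [/\ forall p, 0 < p.2 -> f p = u p +i* v p,
      exists ux uy uxx uxy uyy, forall B, b <= B -> automorphic B u ux uy uxx uxy uyy &
      exists ux uy uxx uxy uyy, forall B, b <= B -> automorphic B v ux uy uxx uxy uyy].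
Proof.
move=> [phi [sr si [a [b [a0 p0]]]] ->].
(* Large enough that the support of [phi] lies in [1/B, B], with B >= 1. *)
exists (Num.max 1 (Num.max a^-1 b)); first by rewrite le_max lexx.
exists (coset_total (fun A p => Re (phi (coset_q A p)))), (coset_total (fun A p => Im (phi (coset_q A p)))).
have mono g B1 : (exists ux uy uxx uxy uyy : R * R -> R, automorphic B1 g ux uy uxx uxy uyy) ->
    exists ux uy uxx uxy uyy, forall B, B1 <= B -> automorphic B g ux uy uxx uxy uyy.
  move=> [ux [uy [uxx [uxy [uyy [h1 h2 h3 h4]]]]]].
  exists ux, uy, uxx, uxy, uyy => B BB; split => // p Bp; apply: h2.
  exact: le_lt_trans Bp.
split; [|apply: mono|apply: mono].
- move=> p p0'; rewrite /coset_sum /coset_total; congr (_ +i* _); congr sum; apply/funext => A;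
    by rewrite Im_moebius.
- apply: (smooth_automorphic sr a0 (b := b)) => [y h|||]; first by rewrite p0.
  + by rewrite le_max lexx.
  + by rewrite !le_max lexx orbT.
  + by rewrite !le_max lexx !orbT.
- apply: (smooth_automorphic si a0 (b := b)) => [y h|||]; first by rewrite p0.
  + by rewrite le_max lexx.
  + by rewrite !le_max lexx orbT.
  + by rewrite !le_max lexx !orbT.
Qed.

End test_functions.

(** * Laurent expansions and the identity theorem *)

Section complex_basics.
Variable R : realType.
Local Notation C := (R[i]).
Implicit Types z w : C.

Lemma ReD z w : Re (z + w) = Re z + Re w. Proof. by case: z w => [a b] [c d]. Qed.
Lemma ImD z w : Im (z + w) = Im z + Im w. Proof. by case: z w => [a b] [c d]. Qed.
Lemma ReN z : Re (- z) = - Re z. Proof. by case: z. Qed.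
Lemma ImN z : Im (- z) = - Im z. Proof. by case: z. Qed.
Lemma ReM z w : Re (z * w) = Re z * Re w - Im z * Im w. Proof. by case: z w => [a b] [c d]. Qed.
Lemma ImM z w : Im (z * w) = Re z * Im w + Im z * Re w. Proof. by case: z w => [a b] [c d]. Qed.
Lemma ReV z : Re z^-1 = Re z / (Re z ^+ 2 + Im z ^+ 2). Proof. by case: z. Qed.
Lemma ImV z : Im z^-1 = - (Im z / (Re z ^+ 2 + Im z ^+ 2)). Proof. by case: z. Qed.

Lemma complex_ext z w : Re z = Re w -> Im z = Im w -> z = w.
Proof. by case: z w => [a b] [c d] /= -> ->. Qed.

Lemma normcE z : normc z = Num.sqrt (Re z ^+ 2 + Im z ^+ 2). Proof. by case: z. Qed.

Lemma normc_ge0 z : 0 <= normc z. Proof. by rewrite normcE sqrtr_ge0. Qed.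

Lemma normc_sqr z : normc z ^+ 2 = Re z ^+ 2 + Im z ^+ 2.
Proof. by rewrite normcE sqr_sqrtr // addr_ge0 ?sqr_ge0. Qed.

Lemma normc_eq0 z : (normc z == 0) = (z == 0).
Proof. by apply/eqP/eqP => [/eq0_normc//|->]; rewrite normc0. Qed.

Lemma normc_gt0 z : (0 < normc z) = (z != 0).
Proof. by rewrite lt_def normc_eq0 normc_ge0 andbT. Qed.

Lemma normc_Re z : `|Re z| <= normc z.
Proof. by rewrite -ler_sqr ?nnegrE ?normc_ge0 // real_normK ?num_real // normc_sqr lerDl sqr_ge0. Qed.

Lemma normc_Im z : `|Im z| <= normc z.
Proof. by rewrite -ler_sqr ?nnegrE ?normc_ge0 // real_normK ?num_real // normc_sqr lerDr sqr_ge0. Qed.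

Lemma normc_le z : normc z <= `|Re z| + `|Im z|.
Proof.
rewrite -ler_sqr ?nnegrE ?normc_ge0 ?addr_ge0 // normc_sqr sqrrD !real_normK ?num_real //.
by rewrite addrAC lerDl mulrn_wge0 // mulr_ge0.
Qed.

Lemma normcD z w : normc (z + w) <= normc z + normc w.
Proof. exact: le_normcD. Qed.

Lemma normcX z n : normc (z ^+ n) = normc z ^+ n.
Proof. by elim: n => [|n IH]; rewrite ?expr0 ?normc1 // !exprS normcM IH. Qed.

Lemma normcB z w : normc (z - w) = normc (w - z).
Proof. by rewrite -normcN opprB. Qed.

Lemma normc_real (x : R) : normc x%:C = `|x|.
Proof. by rewrite /= expr0n addr0 sqrtr_sqr. Qed.

Lemma normc_sum (r : seq nat) (F : nat -> C) : normc (\sum_(i <- r) F i) <= \sum_(i <- r) normc (F i).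
Proof.
elim: r => [|i r IH]; first by rewrite !big_nil normc0.
by rewrite !big_cons; apply: le_trans (normcD _ _) _; rewrite lerD2l.
Qed.

Definition clim (u : nat -> C) (l : C) :=
  forall e : R, 0 < e -> exists N : nat, forall n, (N <= n)%N -> normc (u n - l) < e.

Lemma clim_Re u l : clim u l -> (fun n => Re (u n)) @ \oo --> Re l.
Proof.
move=> ul; apply/cvgrPdist_lt => e e0; have [N HN] := ul e e0; exists N => // n /= Nn.
by rewrite distrC -ReN -ReD; apply: le_lt_trans (normc_Re _) (HN n Nn).
Qed.

Lemma clim_Im u l : clim u l -> (fun n => Im (u n)) @ \oo --> Im l.
Proof.
move=> ul; apply/cvgrPdist_lt => e e0; have [N HN] := ul e e0; exists N => // n /= Nn.
by rewrite distrC -ImN -ImD; apply: le_lt_trans (normc_Im _) (HN n Nn).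
Qed.

Lemma clim_unique u l m : clim u l -> clim u m -> l = m.
Proof.
move=> ul um; apply: complex_ext.
  exact: cvg_unique (clim_Re ul) (clim_Re um).
exact: cvg_unique (clim_Im ul) (clim_Im um).
Qed.

Lemma climD u v l m : clim u l -> clim v m -> clim (fun n => u n + v n) (l + m).
Proof.
move=> ul vm e e0; have e2 : 0 < e / 2 by exact: divr_gt0.
have [N HN] := ul _ e2; have [M HM] := vm _ e2; exists (maxn N M) => n.
rewrite geq_max => /andP[/HN h1 /HM h2].
rewrite opprD addrACA; apply: le_lt_trans (normcD _ _) _.
by rewrite [ltRHS](splitr e) ltrD.
Qed.

Lemma climZ c u l : clim u l -> clim (fun n => c * u n) (c * l).
Proof.
move=> ul e e0; have c0 : 0 < normc c + 1 by rewrite ltr_wpDl ?normc_ge0.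
have [N HN] := ul _ (divr_gt0 e0 c0); exists N => n /HN h.
rewrite -mulrBr normcM; apply: (@le_lt_trans _ _ ((normc c + 1) * normc (u n - l))).
  by rewrite ler_wpM2r ?normc_ge0 // lerDl.
by rewrite mulrC -ltr_pdivlMr.
Qed.

(** At n = 0 the predecessor is 0 again, so the shifted sequence has a spurious first entry; this is
    why [clim_eq] compares positive indices only. *)
Lemma clim_shift u l : clim u l -> clim (fun n => u n.-1) l.
Proof.
move=> ul e /ul[N HN]; exists N.+1 => -[//|n] /= Nn; exact: HN.
Qed.

Lemma clim_eq u v l : (forall n, (0 < n)%N -> u n = v n) -> clim u l -> clim v l.
Proof.
move=> uv ul e /ul[N HN]; exists N.+1 => n Nn; rewrite -uv; first exact: HN (ltnW Nn).
exact: leq_trans Nn.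
Qed.

End complex_basics.

Section complex_measurable.
Context d (T : measurableType d) (R : realType) (D : set T).
Local Notation C := (R[i]).
Implicit Types f g : T -> C.

Definition cmeasurable f :=
  measurable_fun D (fun x => Re (f x)) /\ measurable_fun D (fun x => Im (f x)).

Lemma cmeasurable_cst (c : C) : cmeasurable (fun=> c).
Proof. by split; exact: measurable_cst. Qed.

Lemma cmeasurableD f g : cmeasurable f -> cmeasurable g -> cmeasurable (fun x => f x + g x).
Proof.
move=> [f1 f2] [g1 g2]; split.
  by under eq_fun do rewrite ReD; exact: measurable_funD.
by under eq_fun do rewrite ImD; exact: measurable_funD.
Qed.

Lemma cmeasurableM f g : cmeasurable f -> cmeasurable g -> cmeasurable (fun x => f x * g x).
Proof.
move=> [f1 f2] [g1 g2]; split.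
  by under eq_fun do rewrite ReM; apply: measurable_funB; exact: measurable_funM.
by under eq_fun do rewrite ImM; apply: measurable_funD; exact: measurable_funM.
Qed.

Lemma cmeasurableX f n : cmeasurable f -> cmeasurable (fun x => f x ^+ n).
Proof.
move=> mf; elim: n => [|n IH]; first exact: cmeasurable_cst.
by under eq_fun do rewrite exprS; exact: cmeasurableM.
Qed.

Lemma cmeasurable_sum (F : nat -> T -> C) n : (forall k, cmeasurable (F k)) ->
  cmeasurable (fun x => \sum_(k < n) F k x).
Proof.
move=> mF; elim: n => [|n IH].
  by under eq_fun do rewrite big_ord0; exact: cmeasurable_cst.
by under eq_fun do rewrite big_ord_recr /=; exact: cmeasurableD.
Qed.

Lemma cmeasurable_lim (F : nat -> T -> C) f : (forall k, cmeasurable (F k)) ->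
  (forall x, D x -> clim (F ^~ x) (f x)) -> cmeasurable f.
Proof.
move=> mF Ff; split.
  apply: (@measurable_fun_cvg _ _ _ D (fun n x => Re (F n x))) => [n|x Dx]; first by case: (mF n).
  exact: clim_Re (Ff x Dx).
apply: (@measurable_fun_cvg _ _ _ D (fun n x => Im (F n x))) => [n|x Dx]; first by case: (mF n).
exact: clim_Im (Ff x Dx).
Qed.

End complex_measurable.

(** * Integration of Laurent expansions *)

Section complex_integral.
Context d (T : measurableType d) (R : realType) (mu : {measure set T -> \bar R}).
Variable K : set T.
Hypotheses (mK : measurable K) (muK : (mu K < +oo)%E).
Local Notation C := (R[i]).
Implicit Types f g W : T -> C.

Definition bounded_measurable f :=
  cmeasurable K f /\ exists M : R, forall x, K x -> normc (f x) <= M.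

Definition cintegral f : C :=
  (\int[mu]_(x in K) Re (f x)) +i* (\int[mu]_(x in K) Im (f x)).

Lemma bounded_measurable_cst (c : C) : bounded_measurable (fun=> c).
Proof. by split; [exact: cmeasurable_cst|exists (normc c)]. Qed.

Lemma bounded_measurableD f g : bounded_measurable f -> bounded_measurable g ->
  bounded_measurable (fun x => f x + g x).
Proof.
move=> [mf [M fM]] [mg [N gN]]; split; first exact: cmeasurableD.
by exists (M + N) => x Kx; apply: le_trans (normcD _ _) _; apply: lerD; [exact: fM|exact: gN].
Qed.

Lemma bounded_measurableM f g : bounded_measurable f -> bounded_measurable g ->
  bounded_measurable (fun x => f x * g x).
Proof.
move=> [mf [M fM]] [mg [N gN]]; split; first exact: cmeasurableM.
exists (M * N) => x Kx; rewrite normcM.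
by apply: ler_pM; rewrite ?normc_ge0 //; [exact: fM|exact: gN].
Qed.

Lemma bounded_measurable_sum (F : nat -> T -> C) n : (forall k, bounded_measurable (F k)) ->
  bounded_measurable (fun x => \sum_(k < n) F k x).
Proof.
move=> mF; elim: n => [|n IH].
  by under eq_fun do rewrite big_ord0; exact: bounded_measurable_cst.
by under eq_fun do rewrite big_ord_recr /=; exact: bounded_measurableD.
Qed.

Lemma integrable_Re f : bounded_measurable f -> mu.-integrable K (EFin \o (fun x => Re (f x))).
Proof.
move=> [[mf _] [M fM]]; apply: measurable_bounded_integrable => //.
exists M; split; first exact: num_real.
move=> z Mz x Kx; apply: le_trans (normc_Re _) _; apply: le_trans (fM x Kx) _; exact: ltW.
Qed.

Lemma integrable_Im f : bounded_measurable f -> mu.-integrable K (EFin \o (fun x => Im (f x))).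
Proof.
move=> [[_ mf] [M fM]]; apply: measurable_bounded_integrable => //.
exists M; split; first exact: num_real.
move=> z Mz x Kx; apply: le_trans (normc_Im _) _; apply: le_trans (fM x Kx) _; exact: ltW.
Qed.

Lemma eq_cintegral f g : (forall x, K x -> f x = g x) -> cintegral f = cintegral g.
Proof.
move=> fg; rewrite /cintegral; congr (_ +i* _); apply: eq_Rintegral => x /set_mem Kx;
  by rewrite fg.
Qed.

Lemma cintegralD f g : bounded_measurable f -> bounded_measurable g ->
  cintegral (fun x => f x + g x) = cintegral f + cintegral g.
Proof.
move=> mf mg; apply: complex_ext; rewrite ?ReD ?ImD /=.
  under eq_Rintegral do rewrite ReD.
  by rewrite RintegralD //; exact: integrable_Re.
under eq_Rintegral do rewrite ImD.
by rewrite RintegralD //; exact: integrable_Im.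
Qed.

Lemma cintegralZ (c : C) f : bounded_measurable f ->
  cintegral (fun x => c * f x) = c * cintegral f.
Proof.
move=> mf; have iR := integrable_Re mf; have iI := integrable_Im mf.
have h (r : R) (g : T -> R) : mu.-integrable K (EFin \o g) -> mu.-integrable K (EFin \o (fun x => r * g x)).
  by move=> ig; apply: (eq_integrable mK _ _ _ (integrableZl mK r ig)) => // x _; rewrite /= EFinM.
apply: complex_ext; rewrite ?ReM ?ImM /=.
  under eq_Rintegral do rewrite ReM.
  by rewrite RintegralB ?RintegralZl //; exact: h.
under eq_Rintegral do rewrite ImM.
by rewrite RintegralD ?RintegralZl //; exact: h.
Qed.

Lemma cintegral_sum (F : nat -> T -> C) n : (forall k, bounded_measurable (F k)) ->
  cintegral (fun x => \sum_(k < n) F k x) = \sum_(k < n) cintegral (F k).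
Proof.
move=> mF; elim: n => [|n IH].
  under eq_cintegral do rewrite big_ord0; rewrite big_ord0.
  by apply: complex_ext; rewrite /= Rintegral_cst // mul0r.
rewrite big_ord_recr /= -IH -cintegralD //; last exact: bounded_measurable_sum.
by apply: eq_cintegral => x _; rewrite big_ord_recr.
Qed.

Lemma normc_cintegral f (M : R) : bounded_measurable f ->
  (forall x, K x -> normc (f x) <= M) -> normc (cintegral f) <= 2 * M * fine (mu K).
Proof.
move=> mf fM; apply: le_trans (normc_le _) _; rewrite -mulrA [2 * _]mulr_natl mulr2n /=.
apply: lerD; apply: le_norm_Rintegral_bound => //.
- exact: integrable_Re.
- by move=> x Kx; apply: le_trans (normc_Re _) (fM x Kx).
- exact: integrable_Im.
- by move=> x Kx; apply: le_trans (normc_Im _) (fM x Kx).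
Qed.

Section laurent.
Variables (s0 : C) (m : nat) (rho : R) (a : nat -> T -> C) (E : C -> T -> C).
Hypothesis ma : forall k, bounded_measurable (a k).
Hypothesis Elim : forall s, normc (s - s0) < rho -> s != s0 \/ m = 0%N ->
  forall e : R, 0 < e -> exists N : nat, forall n, (N <= n)%N -> forall x, K x ->
  normc (\sum_(k < n) a k x * (s - s0) ^+ k - (s - s0) ^+ m * E s x) < e.

Let ms k s : bounded_measurable (fun x => a k x * (s - s0) ^+ k).
Proof. by apply: bounded_measurableM; [exact: ma|exact: bounded_measurable_cst]. Qed.

(** (s - s0)^m E_s is a pointwise limit of finite sums, hence measurable, and lies within 1 of one
    of them uniformly on K, hence bounded. The power is nonzero and can be divided out. *)
Lemma bounded_measurable_laurent s : normc (s - s0) < rho -> s != s0 \/ m = 0%N ->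
  bounded_measurable (E s).
Proof.
move=> srho sm.
have zm : (s - s0) ^+ m != 0.
  by case: sm => [ss0|->]; rewrite ?expr0 ?oner_neq0 // expf_neq0 // subr_eq0.
have mE : bounded_measurable (fun x => (s - s0) ^+ m * E s x).
  split.
    apply: (@cmeasurable_lim _ _ _ K (fun n x => \sum_(k < n) a k x * (s - s0) ^+ k)).
      by move=> n; have [] := bounded_measurable_sum n (ms ^~ s).
    by move=> x Kx e e0; have [N HN] := Elim srho sm e0; exists N => n Nn; exact: HN.
  have [N HN] := Elim srho sm ltr01.
  have [_ [M HM]] := bounded_measurable_sum N (ms ^~ s).
  exists (1 + M) => x Kx; have := HN N (leqnn N) x Kx; rewrite normcB => h.
  rewrite -[X in normc X](subrK (\sum_(k < N) a k x * (s - s0) ^+ k)).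
  by apply: le_trans (normcD _ _) _; apply: lerD; [exact: ltW|exact: HM].
have := bounded_measurableM (bounded_measurable_cst ((s - s0) ^- m)) mE.
by congr bounded_measurable; apply/funext => x; rewrite mulKf.
Qed.

(** Uniform convergence on a set of finite measure passes through the integral against a bounded
    weight, so the integral has the expansion whose coefficients are the integrals of W a_k. *)
Lemma clim_laurent_cintegral W s : bounded_measurable W ->
  normc (s - s0) < rho -> s != s0 \/ m = 0%N ->
  clim (fun n => \sum_(k < n) cintegral (fun x => W x * a k x) * (s - s0) ^+ k)
    ((s - s0) ^+ m * cintegral (fun x => W x * E s x)).
Proof.
move=> mW srho sm e e0.
have mE := bounded_measurable_laurent srho sm.
have [_ [B WB]] := mW.
pose L := 2 * (`|B| + 1) * fine (mu K) + 1.
have B0 : 0 < `|B| + 1 by rewrite ltr_wpDl.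
have L0 : 0 < L by rewrite ltr_wpDl // mulr_ge0 ?fine_ge0 // mulr_ge0 // ltW.
have [N HN] := Elim srho sm (divr_gt0 e0 L0).
exists N => n Nn.
have mWs : bounded_measurable (fun x => \sum_(k < n) W x * a k x * (s - s0) ^+ k).
  apply: (@bounded_measurable_sum (fun k x => W x * a k x * (s - s0) ^+ k)) => k.
  by apply: bounded_measurableM; [exact: bounded_measurableM|exact: bounded_measurable_cst].
have mWE := bounded_measurableM mW mE.
have mWE' := bounded_measurableM (bounded_measurable_cst (- (s - s0) ^+ m)) mWE.
have -> : \sum_(k < n) cintegral (fun x => W x * a k x) * (s - s0) ^+ k -
    (s - s0) ^+ m * cintegral (fun x => W x * E s x) =
    cintegral (fun x => W x * (\sum_(k < n) a k x * (s - s0) ^+ k - (s - s0) ^+ m * E s x)).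
  transitivity (cintegral (fun x => \sum_(k < n) W x * a k x * (s - s0) ^+ k)
      + cintegral (fun x => - (s - s0) ^+ m * (W x * E s x))).
    rewrite cintegralZ // mulNr; congr (_ - _).
    rewrite (@cintegral_sum (fun k x => W x * a k x * (s - s0) ^+ k)) => [|k]; last first.
      by apply: bounded_measurableM; [exact: bounded_measurableM|exact: bounded_measurable_cst].
    apply: eq_bigr => k _; rewrite mulrC -cintegralZ; last exact: bounded_measurableM.
    by apply: eq_cintegral => x _; rewrite mulrC.
  rewrite -cintegralD //; apply: eq_cintegral => x _.
  rewrite mulrBr mulr_sumr; congr (_ + _); last by rewrite mulNr mulrCA.
  by apply: eq_bigr => k _; rewrite mulrA.
apply: (@le_lt_trans _ _ (2 * ((`|B| + 1) * (e / L)) * fine (mu K))).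
  apply: normc_cintegral => [|x Kx].
    apply: bounded_measurableM => //.
    have := bounded_measurableD (bounded_measurable_sum n (ms ^~ s))
      (bounded_measurableM (bounded_measurable_cst (- (s - s0) ^+ m)) mE).
    by congr bounded_measurable; apply/funext => x; rewrite mulNr.
  rewrite normcM; apply: ler_pM; rewrite ?normc_ge0 //.
    by apply: le_trans (WB x Kx) _; rewrite (le_trans (ler_norm B)) // lerDl.
  by apply/ltW; exact: HN.
have -> : 2 * ((`|B| + 1) * (e / L)) * fine (mu K) = (2 * (`|B| + 1) * fine (mu K)) * e / L by ring.
by rewrite ltr_pdivrMr // [e * L]mulrC ltr_pM2r // /L ltrDl.
Qed.

End laurent.

End complex_integral.

(** * The identity theorem for meromorphic functions *)

Section identity_theorem.
Variable R : realType.
Local Notation C := (R[i]).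
Implicit Types (G H : C -> C) (s z : C) (b : nat -> C).

(** The leading coefficients may vanish, so m only bounds the order of a pole. This lets expansions
    with a common m be added even when their polar parts cancel. *)
Definition laurent_at G s0 (m : nat) (rho : R) b :=
  forall s, normc (s - s0) < rho -> s != s0 \/ m = 0%N ->
  clim (fun n => \sum_(k < n) b k * (s - s0) ^+ k) ((s - s0) ^+ m * G s).

Lemma laurent_atD G H s0 m rho b c : laurent_at G s0 m rho b -> laurent_at H s0 m rho c ->
  laurent_at (fun s => G s + H s) s0 m rho (fun k => b k + c k).
Proof.
move=> lG lH s s1 s2; have := climD (lG s s1 s2) (lH s s1 s2).
rewrite -mulrDr; apply: clim_eq => n _; rewrite -big_split /=.
by apply: eq_bigr => k _; rewrite mulrDl.
Qed.

Lemma laurent_atN G s0 m rho b : laurent_at G s0 m rho b ->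
  laurent_at (fun s => - G s) s0 m rho (fun k => - b k).
Proof.
move=> lG s s1 s2; have := climZ (-1) (lG s s1 s2).
rewrite mulN1r -mulrN; apply: clim_eq => n _; rewrite mulN1r -sumrN.
by apply: eq_bigr => k _; rewrite mulNr.
Qed.

(** Write s = s0 + (s - s0): the second summand shifts the coefficients by one place. *)
Lemma laurent_at_mul_id G s0 m rho b : laurent_at G s0 m rho b ->
  laurent_at (fun s => s * G s) s0 m rho
    (fun k => s0 * b k + (if k is j.+1 then b j else 0)).
Proof.
move=> lG s s1 s2; have l := lG s s1 s2.
have := climD (climZ s0 l) (climZ (s - s0) (clim_shift l)).
rewrite -mulrDl [s0 + _]addrC subrK mulrCA; apply: clim_eq => -[//|n] _ /=.
under [RHS]eq_bigr do rewrite mulrDl.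
rewrite big_split /=; congr (_ + _).
  by rewrite mulr_sumr; apply: eq_bigr => k _; rewrite mulrA.
rewrite big_ord_recl mul0r add0r mulr_sumr; apply: eq_bigr => k _ /=.
by rewrite exprS mulrCA.
Qed.

Lemma geometric_tail (q : R) (m n : nat) : 0 <= q -> q <= 2^-1 ->
  \sum_(m <= k < n) q ^+ k <= 2 * q ^+ m.
Proof.
move=> q0 q2; have [mn|nm] := leqP m n; last first.
  by rewrite big_geq ?(ltnW nm) // mulr_ge0 // exprn_ge0.
have e : (1 - q) * \sum_(m <= k < n) q ^+ k = q ^+ m - q ^+ n.
  rewrite mulr_sumr; under eq_bigr do rewrite mulrBl mul1r -exprS.
  rewrite (eq_bigr (fun k => - q ^+ k.+1 - - q ^+ k)) => [|k _]; last by rewrite opprK addrC.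
  by rewrite (telescope_sumr (fun k => - q ^+ k)) // opprK addrC.
have : 0 <= q ^+ n by exact: exprn_ge0.
have : 0 <= \sum_(m <= k < n) q ^+ k by apply: sumr_ge0 => k _; exact: exprn_ge0.
move: e; move: (\sum_(m <= k < n) q ^+ k) (q ^+ m) (q ^+ n) => S x y; nra.
Qed.

Lemma laurent_coef_bound b (r : R) l : 0 < r ->
  clim (fun n => \sum_(k < n) b k * (r%:C) ^+ k) l ->
  exists2 M : R, 0 < M & forall k, normc (b k) * r ^+ k <= M.
Proof.
move=> r0 /(_ 1 ltr01)[N HN].
pose t k := normc (b k) * r ^+ k.
have t0 k : 0 <= t k by rewrite mulr_ge0 ?normc_ge0 // exprn_ge0 // ltW.
exists (2 + \sum_(k < N) t k); first by rewrite ltr_wpDr // sumr_ge0.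
move=> k; have [kN|Nk] := ltnP k N.
  rewrite (bigD1 (Ordinal kN)) //= -/(t k).
  have : 0 <= \sum_(i < N | i != Ordinal kN) t i by apply: sumr_ge0.
  lra.
have h1 := HN k Nk; have h2 := HN k.+1 (leqW Nk).
have -> : normc (b k) * r ^+ k = normc (b k * (r%:C) ^+ k).
  by rewrite normcM normcX normc_real gtr0_norm.
have -> : b k * (r%:C) ^+ k = (\sum_(i < k.+1) b i * (r%:C) ^+ i - l) + (l - \sum_(i < k) b i * (r%:C) ^+ i).
  by rewrite addrA subrK big_ord_recr /= addrAC subrr add0r.
apply: le_trans (normcD _ _) _; rewrite [X in _ + X]normcB.
have : 0 <= \sum_(i < N) t i by apply: sumr_ge0.
lra.
Qed.

(** Either all coefficients are 0, or the first nonzero one dominates the rest of the series close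
    to s0. *)
Lemma laurent_dichotomy G s0 m rho b : 0 < rho -> laurent_at G s0 m rho b ->
  (exists2 r : R, 0 < r & forall s, 0 < normc (s - s0) < r -> G s = 0) \/
  (exists2 r : R, 0 < r & forall s, 0 < normc (s - s0) < r -> G s != 0).
Proof.
move=> rho0 lG; have ne s : 0 < normc (s - s0) -> s != s0 by rewrite normc_gt0 subr_eq0.
have [b0|] := pselect (forall k, b k = 0).
  left; exists rho => // s /andP[/ne s1 s2].
  have := lG s s2 (or_introl s1).
  have zm : (s - s0) ^+ m != 0 by rewrite expf_neq0 // subr_eq0.
  have cl : clim (fun n => \sum_(k < n) b k * (s - s0) ^+ k) 0.
    move=> e e0; exists 0%N => n _; rewrite big1 => [|k _]; last by rewrite b0 mul0r.
    by rewrite subrr normc0.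
  by move=> /(clim_unique cl)/esym/eqP; rewrite mulf_eq0 (negbTE zm) => /eqP.
move=> /existsNP bn; right.
have ex : exists k, b k != 0 by have [k /eqP bk] := bn; exists k.
pose k0 := ex_minn ex.
have [bk0 bmin] : b k0 != 0 /\ forall k, (k < k0)%N -> b k = 0.
  rewrite /k0; case: ex_minnP => k bk kmin; split => // j jk.
  by apply/eqP; apply: contraTT jk => /kmin; rewrite -leqNgt.
pose r1 := rho / 2; have r10 : 0 < r1 by exact: divr_gt0.
have sr : s0 + r1%:C - s0 = r1%:C by rewrite addrAC subrr add0r.
have [M M0 HM] : exists2 M : R, 0 < M & forall k, normc (b k) * r1 ^+ k <= M.
  have := lG (s0 + r1%:C); rewrite sr normc_real gtr0_norm // => /(_ _ _)/laurent_coef_bound.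
  apply => //; first by rewrite /r1 ltr_pdivrMr // ltr_pMr // ltr1n.
  by left; apply: ne; rewrite sr normc_real gtr0_norm.
pose B := normc (b k0); have B0 : 0 < B by rewrite normc_gt0.
(* The first bound gives q <= 1/2 for the geometric tail. The second makes the leading term B |z|^k0
   exceed the tail bound 2 M (|z| / r1)^(k0 + 1). *)
pose r := Num.min (r1 / 2) (B * r1 ^+ k0.+1 / (2 * M)).
have r0 : 0 < r by rewrite lt_min !divr_gt0 ?mulr_gt0 ?exprn_gt0.
exists r => // s /andP[sp]; rewrite lt_min => /andP[sr1 sr2].
have srho : normc (s - s0) < rho by rewrite /r1 in sr1; lra.
apply/eqP => Gs0; have := lG s srho (or_introl (ne s sp)).
rewrite Gs0 mulr0; set z := s - s0; rewrite -/z in sp sr1 sr2.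
pose q := normc z / r1.
have q0 : 0 < q by exact: divr_gt0.
have q2 : q <= 2^-1 by rewrite /q ler_pdivrMr // mulrC ltW.
have tail n : (k0 < n)%N -> B * normc z ^+ k0 <= normc (\sum_(k < n) b k * z ^+ k) + M * (2 * q ^+ k0.+1).
  move=> kn; rewrite -(big_mkord xpredT (fun k => b k * z ^+ k)).
  rewrite (big_cat_nat (n := k0)) ?(ltnW kn) //= big_nat big1 => [|k /andP[_ kk]]; last by rewrite bmin // mul0r.
  rewrite add0r big_ltn //.
  have -> : B * normc z ^+ k0 = normc (b k0 * z ^+ k0) by rewrite normcM normcX.
  set T := \sum_(_ <= i < n) _.
  rewrite -[X in normc X <= _](addrK T); apply: le_trans (normcD _ _) _; rewrite normcN lerD2l.
  apply: le_trans (normc_sum _ _) _; rewrite -/(index_iota _ _).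
  apply: (@le_trans _ _ (M * \sum_(k0.+1 <= k < n) q ^+ k)); last first.
    by rewrite ler_wpM2l ?(ltW M0) // geometric_tail // ltW.
  rewrite mulr_sumr; apply: ler_sum => k _.
  rewrite normcM normcX /q expr_div_n mulrA ler_pdivlMr ?exprn_gt0 // mulrAC.
  by rewrite ler_wpM2r ?exprn_ge0 ?normc_ge0.
move=> cl.
have : B * normc z ^+ k0 <= M * (2 * q ^+ k0.+1).
  apply/ler_addgt0Pr => e /cl[N HN].
  have := tail (maxn N k0.+1) (leq_maxr _ _); have := HN (maxn N k0.+1) (leq_maxl _ _).
  by rewrite subr0 => h1 h2; apply: le_trans h2 _; rewrite addrC lerD2l ltW.
have -> : M * (2 * q ^+ k0.+1) = normc z ^+ k0 * (normc z * (2 * M) / r1 ^+ k0.+1).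
  by rewrite /q expr_div_n [normc z ^+ _.+1]exprSr; move: (r1 ^+ _) => y; ring.
rewrite mulrC ler_pM2l ?exprn_gt0 // leNgt => /negP; apply.
by rewrite ltr_pdivrMr ?exprn_gt0 // -ltr_pdivlMr // mulr_gt0.
Qed.

(** The disc is punctured because s0 may be a pole, where the value of G carries no information. *)
Definition vanishes_near G s0 :=
  exists2 r : R, 0 < r & forall s, 0 < normc (s - s0) < r -> G s = 0.

Lemma vanishes_near_open G c (r : R) : (forall s, 0 < normc (s - c) < r -> G s = 0) ->
  0 < r -> forall s, normc (s - c) < r -> vanishes_near G s.
Proof.
move=> Gc r0 s sr; have [->|sc] := eqVneq s c; first by exists r.
have d0 : 0 < normc (s - c) by rewrite normc_gt0 subr_eq0.
exists (Num.min (normc (s - c)) (r - normc (s - c))); first by rewrite lt_min d0 subr_gt0.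
move=> t /andP[ts]; rewrite lt_min => /andP[t1 t2]; apply: Gc; apply/andP; split.
  rewrite normc_gt0 subr_eq0; apply: contraTneq t1 => ->.
  by rewrite normcB ltxx.
have -> : t - c = (t - s) + (s - c) by rewrite addrA subrK.
apply: le_lt_trans (normcD _ _) _; lra.
Qed.

Section continuation.
Variable G : C -> C.
Hypothesis lG : forall s0, exists m rho b, 0 < rho /\ laurent_at G s0 m rho b.

(** Otherwise G is nonzero on a punctured disc at c. A point s of that disc near which G vanishes
    can be moved by a small real e into both punctured discs, a contradiction. *)
Lemma vanishes_near_closed c : (forall r : R, 0 < r -> exists2 s, normc (s - c) < r & vanishes_near G s) ->
  vanishes_near G c.
Proof.
move=> Vc; have [m [rho [b [rho0 l]]]] := lG c.
have [//|[r r0 Gr]] := laurent_dichotomy rho0 l.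
have [s sr [t t0 Gt]] := Vc r r0; have [sc|sc] := eqVneq s c; first by rewrite -sc; exists t.
have d0 : 0 < normc (s - c) by rewrite normc_gt0 subr_eq0.
pose e := Num.min t (Num.min (normc (s - c)) (r - normc (s - c))) / 2.
have m0 : 0 < Num.min t (Num.min (normc (s - c)) (r - normc (s - c))) by rewrite !lt_min t0 d0 subr_gt0.
have e0 : 0 < e by exact: divr_gt0.
have : e < Num.min t (Num.min (normc (s - c)) (r - normc (s - c))) by rewrite /e ltr_pdivrMr // ltr_pMr // ltr1n.
rewrite !lt_min => /and3P[et ec er].
pose s' := s + e%:C.
have ss' : s' - s = e%:C by rewrite /s' addrAC subrr add0r.
have := Gt s'; rewrite ss' normc_real gtr0_norm // e0 et => /(_ isT) G0.
have : G s' != 0.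
  apply: Gr; apply/andP; split.
    rewrite normc_gt0 subr_eq0; apply/eqP => s'c.
    move: ss'; rewrite s'c => /(congr1 (@normc R)); rewrite normcB normc_real gtr0_norm //; lra.
  have -> : s' - c = (s' - s) + (s - c) by rewrite addrA subrK.
  apply: le_lt_trans (normcD _ _) _; rewrite ss' normc_real gtr0_norm //; lra.
by rewrite G0 eqxx.
Qed.

(** The vanishing is propagated along the segment from s1 to s0: the parameters reached have a
    supremum u, which is itself reached because the property is closed, and is not below 1 because
    the property is open. *)
Theorem identity_theorem s1 :
  (forall r : R, 0 < r -> exists2 s, 0 < normc (s - s1) < r & G s = 0) ->
  forall s0, vanishes_near G s0.
Proof.
move=> z1 s0.
have V1 : vanishes_near G s1.
  have [m [rho [b [rho0 l]]]] := lG s1.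
  have [//|[r r0 Gr]] := laurent_dichotomy rho0 l.
  by have [s /Gr/eqP] := z1 r r0.
(* A Lipschitz constant of the segment that is positive even if s0 = s1. *)
pose L := normc (s0 - s1) + 1.
have L0 : 0 < L by rewrite ltr_wpDl ?normc_ge0.
pose g (t : R) : C := s1 + t%:C * (s0 - s1).
have gL t t' (r : R) : `|t - t'| < r / L -> normc (g t - g t') < r.
  move=> h; have -> : g t - g t' = (t - t')%:C * (s0 - s1).
    by rewrite rmorphB /= /g opprD addrACA subrr add0r mulrBl.
  rewrite normcM normc_real; apply: (@le_lt_trans _ _ (`|t - t'| * L)).
    by rewrite ler_wpM2l // lerDl.
  by rewrite -ltr_pdivlMr.
pose S := [set t : R | 0 <= t <= 1 /\ forall t', 0 <= t' <= t -> vanishes_near G (g t')].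
have g0 : g 0 = s1 by rewrite /g mul0r addr0.
have S0 : S 0.
  by split=> [|t' t0]; [rewrite lexx ler01|rewrite -(le_anti t0) g0].
have hS : has_sup S by split; [exists 0|exists 1 => t [/andP[]]].
pose u := sup S.
have u0 : 0 <= u by apply: ub_le_sup => //; exact: hS.2.
have u1 : u <= 1 by apply: ge_sup; [exists 0|move=> t [/andP[]]].
have below t : 0 <= t -> t < u -> vanishes_near G (g t).
  move=> t0 tu; have ut : 0 < u - t by rewrite subr_gt0.
  have [x [_ Sx] tx] := sup_adherent ut hS.
  by apply: Sx; rewrite t0 ltW //; move: tx; rewrite -/u; lra.
have Vu : vanishes_near G (g u).
  apply: vanishes_near_closed => r r0.
  have rL : 0 < r / L by exact: divr_gt0.
  have [x Sx' ux] := sup_adherent rL hS; have [/andP[x0 _] Sx] := Sx'.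
  have xu : x <= u by apply: ub_le_sup; [exact: hS.2|exact: Sx'].
  exists (g x); last by apply: Sx; rewrite x0 lexx.
  by apply: gL; rewrite distrC ger0_norm ?subr_ge0 //; move: ux; rewrite -/u; lra.
have [u_1|] := eqVneq u 1.
  by move: Vu; rewrite u_1 /g mul1r addrC subrK.
move=> un1; have {un1}u1' : u < 1 by rewrite lt_neqAle un1.
have [r r0 Gr] := Vu.
have rL : 0 < r / L by exact: divr_gt0.
pose v := Num.min 1 (u + r / L / 2).
have uv : u < v by rewrite lt_min u1' ltrDl divr_gt0.
suff Sv : S v by have := ub_le_sup hS.2 Sv; rewrite leNgt uv.
split; first by rewrite (ltW (le_lt_trans u0 uv)) ge_min lexx.
move=> t /andP[t0]; rewrite le_min => /andP[t1 t2].
have [tu|ut] := ltP t u; first exact: below.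
apply: (vanishes_near_open Gr r0); apply: gL.
rewrite ger0_norm ?subr_ge0 //; have : r / L / 2 < r / L by rewrite ltr_pdivrMr // ltr_pMr // ltr1n.
lra.
Qed.

End continuation.

End identity_theorem.

(** * The eigenvalue identity by continuation *)

Section eigenvalue_identity.
Variable R : realType.
Local Notation C := (R[i]).
Local Notation mu := (@lebesgue_measure R).
Local Notation mu2 := ((mu \x mu)%E).
Local Notation RR := (measurableTypeR R * measurableTypeR R)%type.
Implicit Types (f g : R * R -> C) (s : C) (p : R * R).

Definition region_bounded b g := bounded_measurable (region b : set RR) (g : RR -> C).

Definition plane_integral b g : C := cintegral mu2 (region b : set RR) (g : RR -> C).

Let mK b : @measurable _ RR (region b). Proof. exact: measurable_region. Qed.
Let muK b : (mu2 (region b) < +oo)%E.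
Proof. by apply: compact_measure_plane; exact: compact_region. Qed.

Let region_uhp b : region b `<=` [set p : R * R | 0 < p.2].
Proof. by move=> p /region_half; apply: lt_trans; lra. Qed.

Lemma region_bounded_continuous b g (u v : R * R -> R) : continuous_half u -> continuous_half v ->
  (forall p, 0 < p.2 -> g p = u p +i* v p) -> region_bounded b g.
Proof.
move=> cu cv guv.
have [M M0 HM] := compact_bounded_plane (@compact_region R b) (@region_uhp b) cu.
have [N N0 HN] := compact_bounded_plane (@compact_region R b) (@region_uhp b) cv.
split; last first.
  exists (M + N) => p Kp; rewrite (guv _ (region_uhp Kp)).
  by apply: le_trans (normc_le _) _; apply: lerD; [exact: HM|exact: HN].
split.
  apply: (@eq_measurable_fun _ _ _ _ _ u) => [p /set_mem Kp|].
    by rewrite (guv _ (region_uhp Kp)).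
  exact: continuous_measurable_plane (@open_half R) (@mK b) (@region_uhp b) cu.
apply: (@eq_measurable_fun _ _ _ _ _ v) => [p /set_mem Kp|].
  by rewrite (guv _ (region_uhp Kp)).
exact: continuous_measurable_plane (@open_half R) (@mK b) (@region_uhp b) cv.
Qed.

Lemma region_bounded_continuous_uhp b g : continuous_uhp g -> region_bounded b g.
Proof.
move=> cg; apply: (@region_bounded_continuous b g (fun p => Re (g p)) (fun p => Im (g p))).
- by move=> p p0; have [] := cg p p0.
- by move=> p p0; have [] := cg p p0.
- by move=> p _; case: (g p).
Qed.

Definition ysq p : C := (p.2 ^- 2)%:C.

Lemma continuous_ysq : continuous_half (fun p : R * R => p.2 ^- 2).
Proof.
have := continuous_halfM (@continuous_half_sndV R) (@continuous_half_sndV R).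
by congr continuous_half; apply/funext => p; rewrite -expr2 exprVn.
Qed.

Lemma region_bounded_ysq b : region_bounded b ysq.
Proof. by apply: region_bounded_continuous continuous_ysq (@continuous_half_cst R 0) _. Qed.

(** The part of the fundamental domain outside [region b] lies above height b, where g vanishes; so
    the noncompact integral becomes one over a compact set. *)
Lemma hyp_integral_region b g : 0 <= b ->
  (forall p, b < p.2 -> g p = 0) -> hyp_integral g = plane_integral b (fun p => g p * ysq p).
Proof.
move=> b0 g0.
have fdE : forall p : R * R, fundamental_domain p -> ~ region b p -> b < p.2.
  move=> p [x2 xy y0] nK; rewrite ltNge; apply/negP => yb; apply: nK.
  have x1 : `|p.1| <= 1 by apply: le_trans x2 _; lra.
  split; first by rewrite -ler_norml.
  have := arc_sqr x1; have := arc_ge0 p.1 => a0 e; apply/andP; split.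
    by rewrite -ler_sqr ?nnegrE ?(ltW y0) //; lra.
  by apply: le_trans yb _; rewrite lerDr.
have Kfd : region b `<=` @fundamental_domain R.
  move=> p Kp; have p0 := region_uhp Kp; have [xI /andP[ya _]] := Kp.
  rewrite -ler_norml in xI; have x1 : `|p.1| <= 1 by apply: le_trans xI _; lra.
  split => //; have := arc_sqr x1; have := arc_ge0 p.1.
  move: ya p0; move: (arc p.1) => a /=; nra.
have key (h : R * R -> R) : (forall p, b < p.2 -> h p = 0) ->
    \int[mu2]_(p in @fundamental_domain R) (h p / p.2 ^+ 2) = \int[mu2]_(p in region b) (h p * p.2 ^- 2).
  move=> h0; rewrite Rintegral_mkcond [RHS]Rintegral_mkcond; apply: eq_Rintegral => p _.
  rewrite !patchE; case: ifPn => [/set_mem Fp|/negP Fp]; case: ifPn => [/set_mem Kp|/negP Kp] //.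
    by rewrite h0 ?mul0r //; apply: fdE => // Kp'; apply: Kp; exact/mem_set.
  by case: Fp; apply/mem_set; exact: Kfd.
apply: complex_ext; rewrite /= /hyp_Rintegral.
  rewrite key => [|p /g0 ->//]; apply: eq_Rintegral => p _.
  by rewrite ReM /= mulr0 subr0.
rewrite key => [|p /g0 ->//]; apply: eq_Rintegral => p _.
by rewrite ImM /= mulr0 add0r.
Qed.

Lemma pseudo_eisenstein_region_bounded f : pseudo_eisenstein f -> exists2 b0 : R, 1 <= b0 &
  forall b, b0 <= b ->
  [/\ region_bounded b f, region_bounded b (Laplace f),
      forall p, b < p.2 -> f p = 0 /\ Laplace f p = 0 &
      forall (s : R) (Es : R * R -> R), 2 <= s -> measurable_fun (region b : set RR) (Es : RR -> R) ->
        (forall p, 0 < p.2 -> Es p = sum (fun A => cg s A p : R^o)) ->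
        (exists M : R, forall p, region b p -> `|Es p| <= M) ->
        plane_integral b (fun p => (Laplace f p + (s * (1 - s))%:C * f p) * ysq p * (Es p)%:C) = 0].
Proof.
move=> /pseudo_eisenstein_data[b0 b01 [u [v [fuv [ux [uy [uxx [uxy [uyy au]]]]] [vx [vy [vxx [vxy [vyy av]]]]]]]]].
exists b0 => // b bb; have b1 := le_trans b01 bb.
have [Cu u0 uT uS] := au b bb; have [Cv v0 vT vS] := av b bb.
have c2 : continuous_half (fun p : R * R => p.2 ^+ 2) by exact: continuous_halfM (@continuous_half_snd R) (@continuous_half_snd R).
have [du _ _ [cuxx _ cuyy]] := Cu; have [dv _ _ [cvxx _ cvyy]] := Cv.
have Lf p : 0 < p.2 -> Laplace f p = (p.2 ^+ 2 * (uxx p + uyy p)) +i* (p.2 ^+ 2 * (vxx p + vyy p)).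
  move=> p0; rewrite /Laplace; congr (_ +i* _).
    by apply: (laplace_C2 Cu) => // q /fuv ->.
  by apply: (laplace_C2 Cv) => // q /fuv ->.
have b0' : 0 < b by exact: lt_le_trans b1.
have nf : region_bounded b f by exact: region_bounded_continuous du.1 dv.1 fuv.
have nL : region_bounded b (Laplace f).
  apply: region_bounded_continuous Lf; first exact: continuous_halfM c2 (continuous_halfD cuxx cuyy).
  exact: continuous_halfM c2 (continuous_halfD cvxx cvyy).
split => //.
  move=> p bp; have p0 := lt_trans b0' bp.
  have [e0 _ _ e3 e4] := u0 p bp; have [h0 _ _ h3 h4] := v0 p bp.
  by rewrite Lf // fuv // e0 e3 e4 h0 h3 h4 !addr0 !mulr0.
move=> s Es s2 mEs EsE [M EsM].
have zero w wx wy wxx wxy wyy (g : R * R -> R) : automorphic b w wx wy wxx wxy wyy ->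
    (forall p, region b p -> g p = hyp_defect s w wxx wyy p * Es p) ->
    \int[mu2]_(p in region b) g p = 0.
  move=> [Cw w0 wT wS] gE.
  rewrite -[RHS](@green_eisenstein R s b s2 b1 w wx wy wxx wxy wyy Cw _ wT wS Es mEs (fun p Kp => EsE p (region_uhp Kp))).
    by apply: eq_Rintegral => p /set_mem/gE.
  by move=> p /w0[].
have alg p : region b p -> (Laplace f p + (s * (1 - s))%:C * f p) * ysq p * (Es p)%:C =
    (hyp_defect s u uxx uyy p * Es p) +i* (hyp_defect s v vxx vyy p * Es p).
  move=> Kp; have p0 := region_uhp Kp; have py : p.2 != 0 by rewrite gt_eqF.
  rewrite Lf // fuv //; apply: complex_ext; rewrite ?ReM ?ImM ?ReD ?ImD ?ReM ?ImM /=.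
    by rewrite /hyp_defect; field.
  by rewrite /hyp_defect; field.
apply: complex_ext => /=.
  by apply: (zero _ _ _ _ _ _ _ (au b bb)) => p /alg ->.
by apply: (zero _ _ _ _ _ _ _ (av b bb)) => p /alg ->.
Qed.

Section eisenstein.
Variable E : C -> R * R -> C.
Hypothesis hE : eisenstein E.

Lemma eisenstein_local (s0 : C) : exists (m : nat) (rho : R) (a : nat -> R * R -> C),
  [/\ 0 < rho, forall b k, region_bounded b (a k) &
      forall b s, normc (s - s0) < rho -> s != s0 \/ m = 0%N ->
      forall e : R, 0 < e -> exists N : nat, forall n, (N <= n)%N -> forall p, region b p ->
      normc (\sum_(k < n) a k p * (s - s0) ^+ k - (s - s0) ^+ m * E s p) < e].
Proof.
have [m [rho [a [rho0 ca _ Ha]]]] := hE.2 s0.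
exists m, rho, a; split => // [b k|b s s1 s2]; first exact: region_bounded_continuous_uhp.
exact: (Ha s s1 s2 (region b) (@compact_region R b) (@region_uhp b)).
Qed.

Lemma region_bounded_eisenstein (s0 : C) : exists2 rho : R, 0 < rho &
  forall s, 0 < normc (s - s0) < rho -> forall b, region_bounded b (E s).
Proof.
have [m [rho [a [rho0 na Ha]]]] := eisenstein_local s0.
exists rho => // s /andP[s1 s2] b.
have ss0 : s != s0 by move: s1; rewrite normc_gt0 subr_eq0.
exact: (@bounded_measurable_laurent _ RR R (region b) s0 m rho a E (na b) (Ha b) s s2 (or_introl ss0)).
Qed.

(** m and rho come from E alone, so integrals of different functions g have expansions that can be
    added. *)
Lemma laurent_plane_integral (s0 : C) : exists (m : nat) (rho : R), 0 < rho /\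
  forall b g, region_bounded b g -> exists c, laurent_at (fun s => plane_integral b (fun p => g p * E s p)) s0 m rho c.
Proof.
have [m [rho [a [rho0 na Ha]]]] := eisenstein_local s0.
exists m, rho; split => // b g ng.
exists (fun k => plane_integral b (fun p => g p * a k p)) => s s1 s2.
exact: (@clim_laurent_cintegral _ RR R _ _ (@mK b) (@muK b) s0 m rho a E (na b) (Ha b) g s ng s1 s2).
Qed.

Lemma cpow_real (y s : R) : cpow y s%:C = (y `^ s)%:C.
Proof. by rewrite /cpow /= mul0r cos0 sin0 mulr0 mulr1. Qed.

Lemma eisenstein_real (s : R) p : 1 < s -> 0 < p.2 ->
  E s%:C p = (sum (fun A => cg s A p : R^o))%:C.
Proof.
move=> s1 p0; rewrite hE.1 //; rewrite /coset_sum.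
have -> : (fun A : cosets => Re (cpow (Im (moebius (coset_repr A) (toC p))) s%:C) : R^o) = (fun A => cg s A p : R^o).
  by apply/funext => A; rewrite cpow_real Im_moebius.
have -> : (fun A : cosets => Im (cpow (Im (moebius (coset_repr A) (toC p))) s%:C) : R^o) = (fun=> 0).
  by apply/funext => A; rewrite cpow_real.
by congr (_ +i* _); exact: (@coset_total0 R (fun _ _ => 0) p (fun=> erefl)).
Qed.

(* The integral of [(Laplace f + lambda s f) E s], as a combination of two functions
   of [s] that have Laurent expansions everywhere. *)
Definition weak_defect f b s : C :=
  plane_integral b (fun p => Laplace f p * ysq p * E s p)
  + lambda s * plane_integral b (fun p => f p * ysq p * E s p).

Lemma weak_defectE f b s : region_bounded b f -> region_bounded b (Laplace f) -> region_bounded b (E s) ->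
  weak_defect f b s = plane_integral b (fun p => (Laplace f p + lambda s * f p) * ysq p * E s p).
Proof.
move=> nf nL nE.
have n1 : region_bounded b (fun p => Laplace f p * ysq p * E s p).
  by apply: bounded_measurableM => //; apply: bounded_measurableM => //; exact: region_bounded_ysq.
have n0 : region_bounded b (fun p => f p * ysq p * E s p).
  by apply: bounded_measurableM => //; apply: bounded_measurableM => //; exact: region_bounded_ysq.
rewrite /weak_defect /plane_integral -(cintegralZ (@mK b) (@muK b)) // -(cintegralD (@mK b) (@muK b)) //; last first.
  by apply: bounded_measurableM n0; exact: bounded_measurable_cst.
by apply: eq_cintegral => p _; ring.
Qed.

(** The derivatives fall on f alone, so both integrals are meromorphic in s although E_s is only
    continuous in z. Near 5 the identity is Green's formula for the convergent series. *)
Theorem weak_defect_vanishes f : pseudo_eisenstein f -> exists2 b0 : R, 1 <= b0 &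
  forall b, b0 <= b -> [/\ region_bounded b f, region_bounded b (Laplace f),
    forall p, b < p.2 -> f p = 0 /\ Laplace f p = 0 &
    forall s0, vanishes_near (weak_defect f b) s0].
Proof.
move=> /pseudo_eisenstein_region_bounded[b0 b01 Hf]; exists b0 => // b bb.
have [nf nL f0 Hz] := Hf b bb; split => //.
have ny := region_bounded_ysq b.
(* The points 5 + d with small d > 0 accumulate at 5; there the series represents E and s >= 2 gives
   the domination. *)
apply: (@identity_theorem _ _ _ 5%:C).
  move=> s0; have [m [rho [rho0 Hl]]] := laurent_plane_integral s0.
  have [c1 l1] := Hl b _ (bounded_measurableM nL ny).
  have [c0 l0] := Hl b _ (bounded_measurableM nf ny).
  have li := laurent_at_mul_id l0.
  (* lambda_s G = s G - s (s G), so multiplying twice by the identity is enough. *)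
  have l := laurent_atD l1 (laurent_atD li (laurent_atN (laurent_at_mul_id li))).
  do 3 eexists; split; first exact: rho0.
  move: l; congr laurent_at; apply/funext => s.
  by rewrite /weak_defect /lambda; ring.
move=> r r0; have [rho rho0 Hn] := region_bounded_eisenstein 5%:C.
pose d := Num.min r rho / 2.
have m0 : 0 < Num.min r rho by rewrite lt_min r0.
have d0 : 0 < d by exact: divr_gt0.
have : d < Num.min r rho by rewrite /d ltr_pdivrMr // ltr_pMr // ltr1n.
rewrite lt_min => /andP[dr drho].
have e : (5 + d)%:C - 5%:C = d%:C by rewrite rmorphD /= addrAC subrr add0r.
exists (5 + d)%:C; first by rewrite e normc_real gtr0_norm // d0.
have nE := Hn (5 + d)%:C; rewrite e normc_real gtr0_norm // d0 drho in nE.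
have {}nE := nE isT b.
pose Es p : R := sum (fun A => cg (5 + d) A p : R^o).
have EE p : 0 < p.2 -> E (5 + d)%:C p = (Es p)%:C by apply: eisenstein_real; lra.
rewrite weak_defectE //.
rewrite -[RHS](Hz (5 + d) Es).
- apply: eq_cintegral => p /region_uhp p0; rewrite EE //; congr (_ * _ * _); congr (_ + _ * _).
  by rewrite /lambda rmorphM /= rmorphB.
- lra.
- apply: (@eq_measurable_fun _ _ _ _ _ (fun p => Re (E (5 + d)%:C p))) => [p /set_mem/region_uhp p0|].
    by rewrite EE.
  by have [[]] := nE.
- by move=> p _.
- have [_ [M HM]] := nE; exists M => p Kp; apply: le_trans (HM p Kp).
  by rewrite EE ?normc_real //; exact: region_uhp Kp.
Qed.

End eisenstein.

End eigenvalue_identity.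

(** * Transforms on the critical line *)

Section punctured_neighborhoods.
Variable R : realType.
Local Notation mu := (@lebesgue_measure R).

Let rat_interval (x r : R) : 0 < r -> exists2 pq : rat * rat,
  ratr pq.1 < x < ratr pq.2 & forall t, ratr pq.1 < t < ratr pq.2 -> `|t - x| < r.
Proof.
move=> r0.
have /rat_in_itvoo[p] : x - r < x by rewrite ltrBlDr ltrDl.
have /rat_in_itvoo[q] : x < x + r by rewrite ltrDl.
rewrite !in_itv/= => /andP[q1 q2] /andP[p1 p2]; exists (p, q) => /=; first by rewrite p2.
move=> t /andP[t1 t2]; rewrite ltr_norml; apply/andP; split; lra.
Qed.

(** Each point of B is the only point of B in some rational interval, and there are countably many
    such intervals. *)
Lemma discrete_countable (B : set R) :
  (forall x, exists2 r : R, 0 < r & forall t, 0 < `|t - x| < r -> ~ B t) -> countable B.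
Proof.
move=> HB; pose F (pq : rat * rat) : set R := [set t | [/\ B t, ratr pq.1 < t < ratr pq.2 &
  forall t', B t' -> ratr pq.1 < t' < ratr pq.2 -> t' = t]].
have cF pq : countable (F pq).
  have [->|/set0P[t Ft]] := eqVneq (F pq) set0; first exact: countable0.
  apply: (@sub_countable _ _ _ [set t]); last exact: countable1.
  by apply: subset_card_le => t' [Bt' t'I _]; case: Ft => _ _; apply.
apply: (@sub_countable _ _ _ (\bigcup_pq F pq)); last by apply: bigcup_countable.
apply: subset_card_le => t Bt; have [r r0 Hr] := HB t.
have [pq tpq Hpq] := rat_interval t r0; exists pq => //; split => // t' Bt' t'pq.
have [//|tt] := eqVneq t' t.
by have [] := Hr t' _ Bt'; rewrite normr_gt0 subr_eq0 tt Hpq.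
Qed.

(** At a possible pole the value is arbitrary, so nothing is asked at the centre; it is put back as
    a singleton, on which every function is measurable. Countably many rational intervals then cover
    the line. *)
Lemma punctured_measurable (h : R -> R) :
  (forall x : R, exists2 r : R, 0 < r & measurable_fun [set t : R | 0 < `|t - x| < r] h) ->
  measurable_fun setT h.
Proof.
move=> Hh.
pose I (pq : rat * rat) : set R := `]ratr pq.1, ratr pq.2[%classic.
pose F (n : nat) : set R := if (choice.unpickle n : option (rat * rat)) is Some pq then
  (if `[< measurable_fun (I pq) h >] then I pq else set0) else set0.
have mF n : measurable (F n).
  rewrite /F; case: choice.unpickle => [pq|//]; case: asboolP => // _; exact: measurable_itv.
have -> : setT = \bigcup_n F n.
  apply/esym; rewrite -subTset => x _.
  have [r r0 Hr] := Hh x; have [pq xpq Hpq] := rat_interval x r0.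
  exists (choice.pickle pq); first exact: Logic.I.
  rewrite /F choice.pickleK.
  case: asboolP => [_|[]]; first by rewrite /I /= in_itv.
  have mD : measurable [set t : R | 0 < `|t - x| < r].
    have -> : [set t : R | 0 < `|t - x| < r] = `]x - r, x + r[%classic `\ x.
      apply/seteqP; split=> [t /= /andP[t1 t2]|t /= [+ tx]]; rewrite in_itv/=.
        split; first by move: t2; rewrite ltr_norml => /andP[]; lra.
        by move=> tx; move: t1; rewrite tx subrr normr0 ltxx.
      move=> /andP[t1 t2]; apply/andP; split; first by rewrite normr_gt0 subr_eq0; apply/eqP.
      by rewrite ltr_norml; apply/andP; split; lra.
    by apply: measurableD => //; exact: measurable_itv.
  apply: (@measurable_funS _ _ _ _ ([set t | 0 < `|t - x| < r] `|` [set x])).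
  - by apply: measurableU => //; exact: measurable_set1.
  - move=> t; rewrite /I /= in_itv/= => tpq; have [->|tx] := eqVneq t x; [by right|left].
    by rewrite normr_gt0 subr_eq0 tx Hpq.
  - by apply/measurable_funU => //; split => //; exact: measurable_fun_set1.
apply/measurable_fun_bigcup => // n; rewrite /F; case: choice.unpickle => [pq|]; last exact: measurable_fun_set0.
by case: asboolP => // _; exact: measurable_fun_set0.
Qed.

End punctured_neighborhoods.

Lemma cmeasurableV d (T : measurableType d) (R : realType) (D : set T) (f : T -> R[i]) :
  cmeasurable D f -> cmeasurable D (fun x => (f x)^-1).
Proof.
move=> [fR fI].
have mi : measurable_fun D (fun x => (Re (f x) ^+ 2 + Im (f x) ^+ 2)^-1).
  under eq_fun do rewrite -powR_inv1 ?addr_ge0 ?sqr_ge0 //.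
  apply: (measurableT_comp (measurable_powR _)).
  by apply: measurable_funD; exact: measurable_funX.
split.
  by under eq_fun do rewrite ReV; exact: measurable_funM.
under eq_fun do rewrite ImV -mulrN1 mulrC mulrA mulN1r.
apply: measurable_funM => //; exact: measurableT_comp.
Qed.

Section critical_line.
Variable R : realType.
Local Notation C := (R[i]).
Local Notation mu := (@lebesgue_measure R).
Local Notation mu2 := ((mu \x mu)%E).
Local Notation RR := (measurableTypeR R * measurableTypeR R)%type.
Implicit Types (f g : R * R -> C) (s : C) (p : R * R).

Definition cusp_vanishing b g := region_bounded b g /\ forall p, b < p.2 -> g p = 0.

(** Required for all large b, so that two functions can always be integrated over one common
    region. *)
Definition regular g := exists2 b0 : R, 0 <= b0 & forall b, b0 <= b -> cusp_vanishing b g.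

Lemma cusp_vanishingB b f g : cusp_vanishing b f -> cusp_vanishing b g ->
  cusp_vanishing b (fun p => f p - g p).
Proof.
move=> [nf f0] [ng g0]; split=> [|p bp]; last by rewrite f0 ?g0 ?subrr.
have := bounded_measurableD nf (bounded_measurableM (bounded_measurable_cst _ (-1)) ng).
by congr bounded_measurable; apply/funext => p; rewrite mulN1r.
Qed.

Lemma cusp_vanishingZ b (c : C) f : cusp_vanishing b f -> cusp_vanishing b (fun p => c * f p).
Proof.
move=> [nf f0]; split=> [|p bp]; last by rewrite f0 ?mulr0.
exact: bounded_measurableM (bounded_measurable_cst _ c) nf.
Qed.

Lemma regular2 f g : regular f -> regular g -> exists2 b : R, 0 <= b &
  cusp_vanishing b f /\ cusp_vanishing b g.
Proof.
move=> [b b0 fb] [c c0 gc]; exists (Num.max b c); first by rewrite le_max b0.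
by split; [apply: fb|apply: gc]; rewrite le_max lexx ?orbT.
Qed.

Lemma regularB f g : regular f -> regular g -> regular (fun p => f p - g p).
Proof.
move=> [b b0 fb] [c c0 gc]; exists (Num.max b c); first by rewrite le_max b0.
by move=> a; rewrite ge_max => /andP[ba ca]; apply: cusp_vanishingB; [exact: fb|exact: gc].
Qed.

Lemma regularZ (c : C) f : regular f -> regular (fun p => c * f p).
Proof. by move=> [b b0 fb]; exists b => // a ba; apply: cusp_vanishingZ; exact: fb. Qed.

Lemma pseudo_eisenstein_regular f : pseudo_eisenstein f -> regular f /\ regular (Laplace f).
Proof.
move=> /pseudo_eisenstein_region_bounded[b0 b01 Hf].
have b00 : 0 <= b0 by exact: le_trans b01.
by split; exists b0 => // b /Hf[nf nL f0 _]; split => // p /f0[].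
Qed.

Lemma shifted_laplacianE (w : C) (u : nat -> R * R -> C) n :
  shifted_laplacian w u n = fun p => (-1) * Laplace (u n) p - lambda w * u n p.
Proof. by apply/funext => p; rewrite mulN1r. Qed.

Lemma shifted_laplacian_regular w (u : nat -> R * R -> C) n : pseudo_eisenstein (u n) ->
  regular (shifted_laplacian w u n).
Proof.
move=> /pseudo_eisenstein_regular[ru rL]; rewrite shifted_laplacianE.
by apply: regularB; exact: regularZ.
Qed.

Lemma subr_critical (t : R) : 1 - critical t = critical (- t).
Proof. by apply: complex_ext; rewrite ?ReD ?ImD ?ReN ?ImN /=; lra. Qed.

Lemma normc_criticalB (t u : R) : normc (critical t - critical u) = `|t - u|.
Proof. by rewrite normcE ReD ImD ReN ImN /= subrr expr0n add0r sqrtr_sqr. Qed.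

Lemma lambda_subr1 s : lambda (1 - s) = lambda s.
Proof. by rewrite /lambda; ring. Qed.

Section eisenstein.
Variable E : C -> R * R -> C.
Hypothesis hE : eisenstein E.

Lemma transform_plane_integral b g s : 0 <= b -> cusp_vanishing b g ->
  transform E g s = plane_integral b (fun p => g p * ysq p * E (1 - s) p).
Proof.
move=> b0 [ng g0]; rewrite /transform (hyp_integral_region b0) => [|p /g0 ->]; last by rewrite mul0r.
by apply: eq_cintegral => p _; rewrite mulrAC.
Qed.

Let mK b : @measurable _ RR (region b). Proof. exact: measurable_region. Qed.
Let muK b : (mu2 (region b) < +oo)%E.
Proof. by apply: compact_measure_plane; exact: compact_region. Qed.

Let plane_integral_linear b (c d : C) f g : region_bounded b f -> region_bounded b g ->
  plane_integral b (fun p => c * f p + d * g p) = c * plane_integral b f + d * plane_integral b g.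
Proof.
move=> nf ng; have n (a : C) h : region_bounded b h -> region_bounded b (fun p => a * h p).
  exact: bounded_measurableM (bounded_measurable_cst _ a).
rewrite /plane_integral -!(cintegralZ (@mK b) (@muK b)) // -(cintegralD (@mK b) (@muK b)) //; exact: n.
Qed.

Let punctured (t x : R) r : 0 < `|t - x| < r ->
  0 < normc (1 - critical t - (1 - critical x)) < r.
Proof. by rewrite !subr_critical normc_criticalB -opprD normrN. Qed.

Lemma countable_singular : countable [set t : R | ~ forall b, region_bounded b (E (1 - critical t))].
Proof.
apply: discrete_countable => x; have [r r0 Hr] := region_bounded_eisenstein hE (1 - critical x).
by exists r => // t /punctured/Hr h; apply.
Qed.

(** At a pole the value of E is unconstrained and may fail to be integrable, so linearity is claimed
    only where it is bounded and measurable on every region. By [countable_singular] this excludes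
    countably many t. *)
Lemma transformB f g t : regular f -> regular g -> (forall b, region_bounded b (E (1 - critical t))) ->
  transform E (fun p => f p - g p) (critical t) =
  transform E f (critical t) - transform E g (critical t).
Proof.
move=> rf rg nE; have [b b0 [fb gb]] := regular2 rf rg.
rewrite !(@transform_plane_integral b) //; last exact: cusp_vanishingB.
have n h : cusp_vanishing b h -> region_bounded b (fun p => h p * ysq p * E (1 - critical t) p).
  move=> [nh _]; apply: bounded_measurableM; last exact: nE.
  by apply: bounded_measurableM => //; exact: region_bounded_ysq.
have := plane_integral_linear 1 (-1) (n f fb) (n g gb); rewrite mul1r mulN1r => <-.
by apply: eq_cintegral => p _; ring.
Qed.

(** The transform at s uses E at 1 - s. There the weak identity holds off isolated points, and
    lambda is invariant under s -> 1 - s. *)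
Lemma transform_shifted_laplacian w (u : nat -> R * R -> C) n : pseudo_eisenstein (u n) ->
  countable [set t : R | transform E (shifted_laplacian w u n) (critical t) <>
    (lambda (critical t) - lambda w) * transform E (u n) (critical t)].
Proof.
move=> pu; have [b0 b01 Hu] := weak_defect_vanishes hE pu.
have [nu nL u0 Hz] := Hu b0 (lexx _); have b00 : 0 <= b0 by exact: le_trans b01.
apply: discrete_countable => x.
have [r r0 Hr] := region_bounded_eisenstein hE (1 - critical x).
have [q q0 Hq] := Hz (1 - critical x).
exists (Num.min r q); first by rewrite lt_min r0.
move=> t /punctured/andP[t0]; rewrite lt_min => /andP[tr tq]; apply.
have nE : region_bounded b0 (E (1 - critical t)) by apply: Hr; rewrite t0.
have := Hq (1 - critical t); rewrite t0 tq => /(_ isT).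
have su : cusp_vanishing b0 (u n) by split => // p /u0[].
have sL : cusp_vanishing b0 (Laplace (u n)) by split => // p /u0[].
have ss : cusp_vanishing b0 (shifted_laplacian w u n).
  by rewrite shifted_laplacianE; apply: cusp_vanishingB; exact: cusp_vanishingZ.
rewrite !(@transform_plane_integral b0) // /weak_defect lambda_subr1.
have m h : region_bounded b0 h -> region_bounded b0 (fun p => h p * ysq p * E (1 - critical t) p).
  move=> nh; apply: bounded_measurableM => //.
  by apply: bounded_measurableM => //; exact: region_bounded_ysq.
have -> : plane_integral b0 (fun p => shifted_laplacian w u n p * ysq p * E (1 - critical t) p) =
    - plane_integral b0 (fun p => Laplace (u n) p * ysq p * E (1 - critical t) p)
    - lambda w * plane_integral b0 (fun p => u n p * ysq p * E (1 - critical t) p).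
  have := plane_integral_linear (-1) (- lambda w) (m _ nL) (m _ nu); rewrite mulN1r mulNr => <-.
  by apply: eq_cintegral => p _; rewrite /shifted_laplacian; ring.
by move=> /eqP; rewrite addr_eq0 => /eqP ->; ring.
Qed.

(** Near x, the transform times z^m is the pointwise limit of polynomials in z given by its Laurent
    expansion; dividing by z^m leaves out only the point x. *)
Lemma cmeasurable_transform g : regular g ->
  cmeasurable setT (fun t : R => transform E g (critical t)).
Proof.
move=> [b b0 gb]; have sg := gb b (lexx _); have [ng _] := sg.
suff loc (x : R) : exists2 r : R, 0 < r &
    cmeasurable [set t : R | 0 < `|t - x| < r] (fun t : R => transform E g (critical t)).
  by split; apply: punctured_measurable => x; have [r r0 []] := loc x; exists r.
have [m [r [r0 Hr]]] := laurent_plane_integral hE (1 - critical x).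
have [c lc] := Hr b _ (bounded_measurableM ng (region_bounded_ysq b)).
exists r => //; set D := [set t | _].
pose z (t : R) : C := 1 - critical t - (1 - critical x).
have zE t : z t = 0 +i* (x - t).
  by apply: complex_ext; rewrite /z !subr_critical ?ReD ?ImD ?ReN ?ImN /=; lra.
have mz : cmeasurable D z.
  split; first by under eq_fun do rewrite zE; exact: measurable_cst.
  by under eq_fun do rewrite zE /=; apply: measurable_funB; [exact: measurable_cst|exact: measurable_id].
have mP : cmeasurable D (fun t => z t ^+ m * transform E g (critical t)).
  apply: (@cmeasurable_lim _ _ _ D (fun n t => \sum_(k < n) c k * z t ^+ k)) => [n|t Dt].
    apply: (@cmeasurable_sum _ _ _ D (fun k t => c k * z t ^+ k)) => k.
    by apply: cmeasurableM; [exact: cmeasurable_cst|exact: cmeasurableX].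
  rewrite (transform_plane_integral _ b0 sg).
  have /andP[t0 tr] := punctured Dt.
  by apply: lc => //; left; rewrite -subr_eq0 -normc_gt0.
have := cmeasurableM (cmeasurableX m (cmeasurableV mz)) mP.
have e t : D t -> (z t)^-1 ^+ m * (z t ^+ m * transform E g (critical t)) = transform E g (critical t).
  move=> /punctured/andP[]; rewrite normc_gt0 -/(z t) => zt _.
  by rewrite mulrA -exprMn mulVf // expr1n mul1r.
move=> [mR mI]; split.
  by apply: eq_measurable_fun mR => t /set_mem/e ->.
by apply: eq_measurable_fun mI => t /set_mem/e ->.
Qed.

End eisenstein.

End critical_line.

(** * The estimate *)

Lemma measurable_normc d (T : measurableType d) (R : realType) (D : set T) (f : T -> R[i]) :
  cmeasurable D f -> measurable_fun D (fun x => normc (f x)).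
Proof.
move=> [fR fI].
under eq_fun do rewrite normcE -powR12_sqrt ?addr_ge0 ?sqr_ge0 //.
apply: (measurableT_comp (measurable_powR _)).
by apply: measurable_funD; exact: measurable_funX.
Qed.

Lemma cvge_lt (R : realType) (u : nat -> \bar R) (l e : \bar R) : u @ \oo --> l -> (l < e)%E ->
  exists N : nat, forall n, (N <= n)%N -> (u n < e)%E.
Proof.
move=> ul le; have : nbhs l [set y : \bar R | (y < e)%E].
  by apply: open_nbhs_nbhs; split => //; exact: open_ereal_lt_ereal.
by move=> /ul[N _ HN]; exists N => n; exact: HN.
Qed.

Section integral_bound.
Context d (T : measurableType d) (R : realType) (mu : {measure set T -> \bar R}).

(** The constant c costs the measure of D, while P and Q are controlled by their integrals over the
    whole space. *)
Lemma integral_le_combination (D : set T) (f P Q : T -> R) (l c a b p q : R) :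
  measurable D -> mu D = l%:E -> 0 <= c -> 0 <= a -> 0 <= b ->
  (forall x, 0 <= f x) -> (forall x, 0 <= P x) -> (forall x, 0 <= Q x) ->
  measurable_fun setT f -> measurable_fun setT P -> measurable_fun setT Q ->
  {ae mu, forall x, D x -> f x <= c + a * P x + b * Q x} ->
  (\int[mu]_x (P x)%:E <= p%:E)%E -> (\int[mu]_x (Q x)%:E <= q%:E)%E ->
  (\int[mu]_(x in D) (f x)%:E <= (c * l + a * p + b * q)%:E)%E.
Proof.
move=> mD muD c0 a0 b0 f0 P0 Q0 mf mP mQ fle Pp Qq.
have mE (g : T -> R) : measurable_fun setT g -> measurable_fun D (EFin \o g).
  by move=> mg; apply/measurable_EFinP; apply: measurable_funS mg.
have bound (g : T -> R) (k y : R) : 0 <= k -> (forall x, 0 <= g x) -> measurable_fun setT g ->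
    (\int[mu]_x (g x)%:E <= y%:E)%E ->
    (\int[mu]_(x in D) (k * g x)%:E <= (k * y)%:E)%E.
  move=> k0 g0 mg gy; under eq_integral do rewrite EFinM.
  rewrite ge0_integralZl_EFin //; [|by move=> x _; rewrite lee_fin|exact: mE].
  rewrite EFinM lee_wpmul2l ?lee_fin //; apply: le_trans gy.
  apply: ge0_subset_integral => //; first exact/measurable_EFinP.
  by move=> x _; rewrite lee_fin.
apply: (@le_trans _ _ (\int[mu]_(x in D) ((c%:E + (a * P x)%:E) + (b * Q x)%:E))%E).
  apply: ae_ge0_le_integral => //.
  - by move=> x _; rewrite lee_fin.
  - exact: mE.
  - by move=> x _; rewrite lee_fin !addr_ge0 ?mulr_ge0.
  - apply: (mE (fun x => c + a * P x + b * Q x)); apply: measurable_funD; last exact: measurable_funM.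
    by apply: measurable_funD => //; exact: measurable_funM.
rewrite ge0_integralD //; last 4 first.
- by move=> x _; rewrite lee_fin addr_ge0 ?mulr_ge0.
- apply: (mE (fun x => c + a * P x)); apply: measurable_funD => //; exact: measurable_funM.
- by move=> x _; rewrite lee_fin mulr_ge0.
- by apply: (mE (fun x => b * Q x)); exact: measurable_funM.
rewrite ge0_integralD //; last 2 first.
- by move=> x _; rewrite lee_fin mulr_ge0.
- by apply: (mE (fun x => a * P x)); exact: measurable_funM.
rewrite integral_cst // muD !EFinD.
apply: leeD; last exact: bound.
by apply: leeD; [rewrite -EFinM|exact: bound].
Qed.

Lemma integralD_le (P Q : T -> R) (p q : R) :
  (forall x, 0 <= P x) -> (forall x, 0 <= Q x) ->
  measurable_fun setT P -> measurable_fun setT Q ->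
  (\int[mu]_x (P x)%:E <= p%:E)%E -> (\int[mu]_x (Q x)%:E <= q%:E)%E ->
  (\int[mu]_x (P x + Q x)%:E <= (p + q)%:E)%E.
Proof.
move=> P0 Q0 mP mQ Pp Qq; under eq_integral do rewrite EFinD.
rewrite ge0_integralD //; [|by move=> x _; rewrite lee_fin|exact/measurable_EFinP|
  by move=> x _; rewrite lee_fin|exact/measurable_EFinP].
by rewrite EFinD; exact: leeD.
Qed.

End integral_bound.

Section weights.
Variable R : realType.
Implicit Type t : R.

Lemma lambda_critical t : lambda (critical t) = (4^-1 + t ^+ 2)%:C.
Proof.
rewrite /lambda subr_critical; apply: complex_ext; rewrite ?ReM ?ImM /=; last by lra.
by rewrite expr2; lra.
Qed.

Lemma weightE r t : weight r t = (5 / 4 + t ^+ 2) `^ r.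
Proof. by rewrite /weight lambda_critical /= addrA; congr ((_ + _) `^ _); lra. Qed.

Lemma weight_ge0 r t : 0 <= weight r t. Proof. exact: powR_ge0. Qed.

Lemma measurable_weight r : measurable_fun setT (fun t : R => weight r t).
Proof.
under eq_fun do rewrite weightE.
apply: (measurableT_comp (measurable_powR _)).
by apply: measurable_funD; [exact: measurable_cst|exact: measurable_funX].
Qed.

Lemma weight1_ge1 t : 1 <= weight 1 t.
Proof.
rewrite weightE powRr1; last by rewrite addr_ge0 ?sqr_ge0.
by have := sqr_ge0 t; lra.
Qed.

Lemma weightN1_ge (A t : R) : `|t| <= A -> (5 / 4 + A ^+ 2)^-1 <= weight (-1) t.
Proof.
move=> tA; rewrite weightE powR_inv1; last by rewrite addr_ge0 ?sqr_ge0.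
have : t ^+ 2 <= A ^+ 2 by rewrite -real_normK ?num_real // ler_sqr ?nnegrE // (le_trans _ tA).
have := sqr_ge0 t => t2 tA2.
by rewrite lef_pV2 ?posrE; lra.
Qed.

(** Im lambda_w = Im w (1 - 2 Re w). So either Re w = 1/2, or w is real and lambda_w = 1/4 - (w -
    1/2)^2 <= 1/4. *)
Lemma lambda_real_critical (w : R[i]) : Im (lambda w) = 0 -> 4^-1 < Re (lambda w) ->
  w = critical (Im w).
Proof.
case: w => a b; rewrite /lambda ReM ImM ReD ImD ReN ImN /= => h1 h2.
apply: complex_ext => //=.
have /eqP : b * (2 * a - 1) = 0 by lra.
rewrite mulf_eq0 => /orP[/eqP b0|/eqP]; last by lra.
by move: h2; rewrite b0; nra.
Qed.

Section norms.
Variable E : R[i] -> R * R -> R[i].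

Lemma integral_transform_le r f (e : R) : (norm_sq E r f < e%:E)%E ->
  (\int[@lebesgue_measure R]_t (normc (transform E f (critical t)) ^+ 2 * weight r t)%:E
    <= (4 * pi * e)%:E)%E.
Proof.
have p0 : 0 < 4 * pi :> R by rewrite mulr_gt0 ?pi_gt0.
rewrite /norm_sq; set I := (\int[_]_t _)%E => h.
have : (((4 * pi)^-1)%:E * I <= e%:E)%E.
  apply: le_trans (ltW h); rewrite leeDr // lee_fin.
  apply: divr_ge0; first by rewrite mulr_ge0 ?powR_ge0 ?exprn_ge0 ?normc_ge0.
  apply: Rintegral_ge0 => p _; rewrite ReM /= oppr0 mulr0 subr0 mulr1 divr_ge0 ?sqr_ge0 //.
by rewrite muleC lee_pdivrMr // -EFinM mulrC.
Qed.

End norms.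

End weights.

Lemma ae_countable (R : realType) (B : set R) (P : R -> Prop) : countable B ->
  (forall t, ~ B t -> P t) -> {ae @lebesgue_measure R, forall t, P t}.
Proof.
move=> cB BP; exists B; split.
- by apply: countable_measurable => // t; exact: measurable_set1.
- exact: countable_lebesgue_measure0.
- by move=> t /= nP; apply: contrapT => /BP.
Qed.

Lemma sqrD_le (R : realFieldType) (x y z : R) : 0 <= x -> x <= y + z -> x ^+ 2 <= 2 * y ^+ 2 + 2 * z ^+ 2.
Proof.
move=> x0 xyz; apply: (@le_trans _ _ ((y + z) ^+ 2)); first by rewrite ler_sqr ?nnegrE // (le_trans x0).
by have := sqr_ge0 (y - z); rewrite !expr2; lra.
Qed.

(** * The bound near the height tau *)

Section equation.
Variables (R : realType) (E : R[i] -> R * R -> R[i]) (tau : R).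
Hypothesis hE : eisenstein E.
Local Notation mu := (@lebesgue_measure R).
Local Notation w := (critical tau).

(** A pointwise form of Cauchy-Schwarz: v <= k + v^2 / k, with r the square root of eps. The two
    error terms use k = r, and the factor 5/4 + A^2 undoes the weight of index -1. The main term
    uses k = 1/r: with |lambda_s - lambda_w| <= 2 A r^2 it is at most 2 A r + 2 A r^3 |E u_n|^2, and
    splitting E u_n into two parts doubles the last coefficient. *)
Lemma transform_solution_bound (theta u : nat -> R * R -> R[i]) (F : R -> R[i]) (n N : nat) (A r t : R) :
  pseudo_eisenstein (theta n) -> (forall k, pseudo_eisenstein (u k)) ->
  0 < r -> `|t - tau| <= r ^+ 2 -> `|t| <= A -> `|tau| <= A ->
  (forall b, region_bounded b (E (1 - critical t))) ->
  transform E (shifted_laplacian w u n) (critical t) =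
    (lambda (critical t) - lambda w) * transform E (u n) (critical t) ->
  normc (F t) <= (2 + 2 * A) * r
    + ((5 / 4 + A ^+ 2) / r)
      * (normc (F t - transform E (theta n) (critical t)) ^+ 2 * weight (-1) t
         + normc (transform E (fun p => shifted_laplacian w u n p - theta n p) (critical t)) ^+ 2
           * weight (-1) t)
    + (4 * A * r ^+ 3)
      * (normc (transform E (fun p => u n p - u N p) (critical t)) ^+ 2 * weight 1 t
         + normc (transform E (u N) (critical t)) ^+ 2 * weight 1 t).
Proof.
move=> pt pu r0 tr tA tauA nE eqn.
have [rt _] := pseudo_eisenstein_regular pt.
have [run _] := pseudo_eisenstein_regular (pu n).
have [ruN _] := pseudo_eisenstein_regular (pu N).
have rs := shifted_laplacian_regular w (pu n).
have lam : lambda (critical t) - lambda w = ((t + tau) * (t - tau))%:C.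
  by rewrite !lambda_critical -rmorphB; congr (_%:C); ring.
rewrite (transformB rs rt nE) (transformB run ruN nE) eqn lam.
set f := F t; set S := transform E (theta n) _; set T := transform E (u n) _.
set T' := transform E (u N) _; set g := (_ * _)%:C.
have A0 : 0 <= A by exact: le_trans tA.
have gle : normc g <= 2 * A * r ^+ 2.
  rewrite normc_real normrM; apply: ler_pM => //; apply: le_trans (ler_normD _ _) _; lra.
have fle : normc f <= normc (f - S) + normc (g * T - S) + normc g * normc T.
  (* g T is the transform of (-Delta - lambda_w) u_n by the eigenvalue identity [eqn], so the middle
     term is the error in the equation. *)
  have {1}-> : f = (f - S) + (S - g * T) + g * T by rewrite !addrA !subrK.
  apply: le_trans (normcD _ _) _; rewrite -normcM lerD2r.
  by apply: le_trans (normcD _ _) _; rewrite (normcB S).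
move: fle gle (weight1_ge1 t) (weightN1_ge tA).
have : normc T ^+ 2 <= 2 * normc (T - T') ^+ 2 + 2 * normc T' ^+ 2.
  by apply: sqrD_le; [exact: normc_ge0|rewrite -[X in normc X <= _](subrK T') normcD].
have := normc_ge0 T; have := normc_ge0 g.
move: (normc f) (normc g) (normc T) (normc (T - T')) (normc T') (normc (f - S)) (normc (g * T - S)).
move: (weight 1 t) (weight (-1) t) => W1 WN a c z z1 z2 x y c0 z0 zle ale cle W11 WNge.
have B0 : 0 < 5 / 4 + A ^+ 2 by rewrite ltr_pwDl ?sqr_ge0.
have amgm (v k : R) : 0 < k -> v <= k + v ^+ 2 / k.
  move=> k0; have -> : v = (v * k) / k by rewrite mulfK ?gt_eqF.
  rewrite -[X in X + _](mulfK (x := k)) ?gt_eqF // -mulrDl ler_pM2r ?invr_gt0 //.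
  rewrite mulfK ?gt_eqF //; have := sqr_ge0 (v - k); have := sqr_ge0 v; have := sqr_ge0 k; rewrite !expr2; lra.
have hx (v : R) : v <= r + (5 / 4 + A ^+ 2) / r * (v ^+ 2 * WN).
  apply: le_trans (amgm v r r0) _; rewrite lerD2l [leRHS]mulrAC ler_pM2r ?invr_gt0 //.
  rewrite mulrCA ler_peMr ?sqr_ge0 //.
  by rewrite -(@ler_pM2l _ (5 / 4 + A ^+ 2)^-1) ?invr_gt0 // mulr1 mulKf ?gt_eqF.
have hz : c * z <= 2 * A * r + 2 * A * r ^+ 3 * z ^+ 2.
  apply: le_trans (ler_wpM2r z0 cle) _.
  have /(amgm z) : 0 < r^-1 by rewrite invr_gt0.
  rewrite invrK => h; have p0 : 0 <= 2 * A * r ^+ 2 by apply: mulr_ge0; rewrite ?sqr_ge0 ?mulr_ge0.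
  apply: le_trans (ler_wpM2l p0 h) _.
  by rewrite le_eqVlt; apply/orP; left; apply/eqP; field; rewrite gt_eqF.
have hzz : 2 * A * r ^+ 3 * z ^+ 2 <= 4 * A * r ^+ 3 * (z1 ^+ 2 * W1 + z2 ^+ 2 * W1).
  have -> : 4 * A * r ^+ 3 * (z1 ^+ 2 * W1 + z2 ^+ 2 * W1) = 2 * A * r ^+ 3 * (2 * (z1 ^+ 2 * W1) + 2 * (z2 ^+ 2 * W1)) by ring.
  apply: ler_wpM2l; first by rewrite !mulr_ge0 // ?exprn_ge0 // ltW.
  apply: le_trans zle _.
  have h (v : R) : v ^+ 2 <= v ^+ 2 * W1 by rewrite ler_peMr ?sqr_ge0.
  by have := h z1; have := h z2; lra.
have := hx x; have := hx y.
rewrite mulrDr; lra.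
Qed.

(** The order of choices matters: [N], and with it the bound [I], is fixed before eps, so K does not
    depend on eps. The index n is chosen after eps and may grow as eps shrinks. *)
Theorem solution_estimate (theta u : nat -> R * R -> R[i]) (F : R -> R[i]) :
  completion E (-1) theta -> completion E 1 u ->
  completion_eq E (-1) (shifted_laplacian w u) theta -> is_transform E (-1) theta F ->
  forall eps0 : R, 0 < eps0 -> exists K : R, forall eps : R, 0 < eps -> eps <= eps0 ->
    (\int[mu]_(t in `[(tau - eps)%R, (tau + eps)%R]) (normc (F t))%:E <= (K * eps `^ (3 / 2))%:E)%E.
Proof.
move=> [ptheta _ _] [pu ufin ucauchy] eqn [mFR mFI FS] eps0 eps00.
(* For n >= N the difference u_n - u_N has squared norm below 1, so E u_n is bounded in L^2
   uniformly in n through E u_N. *)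
have [N HN] := ucauchy 1 ltr01.
have [I HI] : exists I : R,
    (\int[mu]_t (normc (transform E (u N) (critical t)) ^+ 2 * weight 1 t)%:E <= I%:E)%E.
  have := ufin N; case e : (norm_sq E 1 (u N)) => [x| |] // _.
    by exists (4 * pi * (x + 1)); apply: integral_transform_le; rewrite e lte_fin ltrDl.
  by exists (4 * pi * 0); apply: integral_transform_le; rewrite e ltNyr.
(* Bounds |tau| and |t| on all the intervals with eps <= eps0. *)
pose A := `|tau| + eps0.
have A0 : 0 <= A by rewrite addr_ge0 // ltW.
pose omega := (5 / 4 + A ^+ 2)^-1.
have omega0 : 0 < omega by rewrite invr_gt0 ltr_pwDl ?sqr_ge0.
have pi0 : 0 < 4 * pi :> R by rewrite mulr_gt0 ?pi_gt0.
exists ((2 + 2 * A) * 2 + 2 + 4 * A * (4 * pi * 1 + I)) => eps eps_gt0 eps_le.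
pose r := eps `^ 2^-1.
have r0 : 0 < r by exact: powR_gt0.
have r2 : r ^+ 2 = eps by rewrite /r powR12_sqrt ?sqr_sqrtr // ltW.
have r3 : eps `^ (3 / 2) = r ^+ 3 by rewrite mulrC powRrM -/r powR_mulrn // ltW.
(* Then the two errors together contribute (5/4 + A^2) / r * 2 eta = 2 r^3, the summand 2 of K. The
   summand (2 + 2 A) * 2 comes from the constant part times the length 2 eps = 2 r^2. *)
pose eta := omega * r ^+ 4.
have eta0 : 0 < eta by rewrite mulr_gt0 // exprn_gt0.
have [n1 Hn1] := cvge_lt eqn (e := (eta / (4 * pi))%:E) (divr_gt0 eta0 pi0).
have [n2 Hn2] := cvge_lt FS (e := eta%:E) eta0.
pose n := maxn N (maxn n1 n2).
have Nn : (N <= n)%N by exact: leq_maxl.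
have n1n : (n1 <= n)%N by rewrite /n !leq_max leqnn orbT.
have n2n : (n2 <= n)%N by rewrite /n !leq_max leqnn !orbT.
have HX := ltW (Hn2 n n2n).
have HY := integral_transform_le (Hn1 n n1n); rewrite mulrC divfK ?gt_eqF // in HY.
have HZ := integral_transform_le (HN n N Nn (leqnn N)).
have rt k : regular (theta k) by have [] := pseudo_eisenstein_regular (ptheta k).
have ru k : regular (u k) by have [] := pseudo_eisenstein_regular (pu k).
have rs := shifted_laplacian_regular w (pu n).
have meas g s : cmeasurable setT g -> measurable_fun setT (fun t : R => normc (g t) ^+ 2 * weight s t).
  move=> mg; apply: measurable_funM; last exact: measurable_weight.
  by apply: measurable_funX; exact: measurable_normc.
have mF : cmeasurable setT F by split.
have mX := meas _ (-1) (cmeasurableD mF (cmeasurableM (cmeasurable_cst setT (-1)) (cmeasurable_transform hE (rt n)))).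
have {}mX : measurable_fun setT (fun t : R => normc (F t - transform E (theta n) (critical t)) ^+ 2 * weight (-1) t).
  by move: mX; congr measurable_fun; apply/funext => t; rewrite mulN1r.
have mY := meas _ (-1) (cmeasurable_transform hE (regularB rs (rt n))).
have mZ := meas _ 1 (cmeasurable_transform hE (regularB (ru n) (ru N))).
have mT := meas _ 1 (cmeasurable_transform hE (ru N)).
have ge0 (z : R[i]) s (t : R) : 0 <= normc z ^+ 2 * weight s t by rewrite mulr_ge0 ?sqr_ge0 ?weight_ge0.
have HXY : (\int[mu]_t (normc (F t - transform E (theta n) (critical t)) ^+ 2 * weight (-1) t
    + normc (transform E (fun p => shifted_laplacian w u n p - theta n p) (critical t)) ^+ 2
      * weight (-1) t)%:E <= (eta + eta)%:E)%E.
  by apply: integralD_le HX HY => // t; exact: ge0.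
have HZT : (\int[mu]_t (normc (transform E (fun p => u n p - u N p) (critical t)) ^+ 2 * weight 1 t
    + normc (transform E (u N) (critical t)) ^+ 2 * weight 1 t)%:E <= (4 * pi * 1 + I)%:E)%E.
  by apply: integralD_le HZ HI => // t; exact: ge0.
have -> : ((2 + 2 * A) * 2 + 2 + 4 * A * (4 * pi * 1 + I)) * eps `^ (3 / 2) =
    (2 + 2 * A) * r * (2 * eps) + (5 / 4 + A ^+ 2) / r * (eta + eta) + 4 * A * r ^+ 3 * (4 * pi * 1 + I).
  rewrite r3 -r2 /eta /omega; field.
  by rewrite !gt_eqF // ltr_pwDl // mulr_ge0 ?sqr_ge0.
apply: integral_le_combination HXY HZT.
- exact: measurable_itv.
- apply: etrans (lebesgue_measure_itv _) _; rewrite /= lte_fin ifT; last by lra.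
  by rewrite -EFinB; congr (_%:E); lra.
- by rewrite mulr_ge0 ?(ltW r0) // addr_ge0 // mulr_ge0.
- by rewrite divr_ge0 ?(ltW r0) // addr_ge0 ?sqr_ge0.
- by apply: mulr_ge0; [rewrite mulr_ge0|rewrite exprn_ge0 // ltW].
- by move=> t; exact: normc_ge0.
- by move=> t; rewrite addr_ge0.
- by move=> t; rewrite addr_ge0.
- exact: measurable_normc.
- exact: measurable_funD.
- exact: measurable_funD.
apply: filterS2 (ae_countable (countable_singular hE) (fun t => @contrapT _))
  (ae_countable (transform_shifted_laplacian hE w (pu n)) (fun t => @contrapT _)).
  exact: (ae_filter_ringOfSetsType mu).
move=> t /= nE te.
rewrite in_itv/= => /andP[t1 t2].
have tt : `|t - tau| <= r ^+ 2 by rewrite r2 ler_norml; apply/andP; split; lra.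
apply: transform_solution_bound => //.
- have -> : t = tau + (t - tau) by rewrite addrC subrK.
  by apply: le_trans (ler_normD _ _) _; rewrite lerD2l (le_trans tt) // r2.
- by rewrite lerDl ltW.
Qed.

End equation.

Theorem theorem10 (R : realType) (E : R[i] -> R * R -> R[i])
    (hE : eisenstein E)
    (theta : nat -> R * R -> R[i])
    (htheta : completion E (-1) theta)
    (theta_real : completion_eq E (-1) (conj_ext theta) theta)
    (theta_notin : ~ exists2 g, completion E 0 g & completion_eq E (-1) g theta)
    (w : R[i]) (w_real : Im (lambda w) = 0) (w_gt : 4^-1 < Re (lambda w))
    (solvable : exists2 u, completion E 1 u &
       completion_eq E (-1) (shifted_laplacian w u) theta)
    (Etheta : R -> R[i]) (hEtheta : is_transform E (-1) theta Etheta) :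
  forall eps0 : R, 0 < eps0 -> exists K : R,
    forall eps : R, 0 < eps -> eps <= eps0 ->
      (\int[@lebesgue_measure R]_(t in `[(Im w - eps)%R, (Im w + eps)%R])
         (normc (Etheta t))%:E <= (K * eps `^ (3 / 2))%:E)%E.

Proof.
have we := lambda_real_critical w_real w_gt; have [u cu eqn] := solvable.
rewrite we in eqn.
exact: (solution_estimate hE htheta cu eqn hEtheta).
Qed.
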